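(* Let $W=W(\sigma)$ be a family of integer-valued random variables with $\mathrm{Var}\,W=\sigma^2$, such that for some $\sigma$-algebra $\mathcal{F}$, \[ W=Y+\sum_{i=1}^N Z_i, \] where $N$ is $\mathcal{F}$-measurable, $Y,Z_1,Z_2,\dots$ are integer-valued, and conditional on $\mathcal{F}$ the variables $Y,Z_1,\dots,Z_N$ are mutually independent. Assume there are constants $u$ and $\beta$, not depending on $\sigma$, such that, conditional on $\mathcal{F}$, $0<u\le 1-\tfrac12 D_1(Z_i)$ for all $1\le i\le N$ (where $D_1(Z_i)$ is computed for the conditional law of $Z_i$ given $\mathcal{F}$), and such that \[ \mathbb{P}[N<\beta\sigma^2]=O(\sigma^{-k})\quad\text{as }\sigma\to\infty \] for some $k\ge 2$. Let $\tilde W=(W-\mathbb{E}W)/\sigma$ and let $\Phi$ denote the standard normal distribution. Then, as $\sigma\to\infty$, \[ d_{\mathrm{loc}}\bigl(\mathcal{L}(W),\mathrm{TP}(\mathbb{E}W,\sigma^2)\bigr)=O\Bigl(\frac{d_{\mathrm{K}}(\mathcal{L}(\tilde W),\Phi)^{1-1/k}}{\sigma}\Bigr) \] and \[ d_{\mathrm{loc}}\bigl(\mathcal{L}(W),\mathrm{TP}(\mathbb{E}W,\sigma^2)\bigr)=O\Bigl(\frac{d_{\mathrm{W}}(\mathcal{L}(\tilde W),\Phi)^{1-2/(k+1)}}{\sigma}\Bigr). \] Moreover, if all the previous hypotheses hold except that the tail condition on $N$ holds for some $k\ge 1$, then as $\sigma\to\infty$, \[ d_{\mathrm{TV}}\bigl(\mathcal{L}(W),\mathrm{TP}(\mathbb{E}W,\sigma^2)\bigr)=O\bigl(d_{\mathrm{W}}(\mathcal{L}(\tilde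 W),\Phi)^{k/(k+1)}\bigr). \]
   Context: For $f:\mathbb{Z}\to\mathbb{R}$, $\|f\|_1=\sum_i|f(i)|$, $\|f\|_\infty=\sup_i|f(i)|$; $\Delta^0 f=f$, $\Delta^{n+1}f(k)=\Delta^nf(k+1)-\Delta^nf(k)$, $\Delta=\Delta^1$. For an integer-valued random variable $X$ with distribution function $F(j)=\mathbb{P}[X\le j]$, $D_1(X)=D_1(\mathcal{L}(X)):=\|\Delta^2F\|_1$. For integer-supported laws with distribution functions $F,G$: $d_{\mathrm{loc}}=\|\Delta F-\Delta G\|_\infty$, $d_{\mathrm{TV}}=\frac12\|\Delta F-\Delta G\|_1$. For general real distributions with distribution functions $F,G$: $d_{\mathrm{K}}=\sup_{x\in\mathbb{R}}|F(x)-G(x)|$, $d_{\mathrm{W}}=\int_{\mathbb{R}}|F(x)-G(x)|\,dx$. Translated Poisson: for $\mu\in\mathbb{R}$, $\sigma^2>0$, $Z\sim\mathrm{TP}(\mu,\sigma^2)$ means $Z-\lfloor\mu-\sigma^2\rfloor\sim\mathrm{Po}(\sigma^2+\gamma)$ with $\gamma=\mu-\sigma^2-\lfloor\mu-\sigma^2\rfloor$.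
   Formalization: The constant β is assumed to be positive; for β ≤ 0 the tail condition on N is empty and the stated bounds fail, for example for N = 0 and W twice a Poisson variable. *)

(* Defs.v *)
From HB Require Import structures.
From mathcomp Require Import all_boot all_order all_algebra.
From mathcomp Require Import all_classical all_reals all_analysis.

Set Implicit Arguments.
Unset Strict Implicit.
Unset Printing Implicit Defensive.

Import Order.TTheory GRing.Theory Num.Theory.
Import numFieldNormedType.Exports.

Local Open Scope classical_set_scope.
Local Open Scope ring_scope.

Section Defs.
Context {R : realType}.

Definition Dif (f : int -> R) : int -> R := fun k => f (k + 1)%R - f k.

Definition norm1 (f : int -> R) : \bar R := \esum_(i in [set: int]) (`|f i|)%:E.
Definition norminf (f : int -> R) : \bar R :=
  ereal_sup [set (`|f i|)%:E | i in [set: int]].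

Definition is_pmf (p : int -> R) : Prop :=
  (forall j, 0 <= p j) /\ \esum_(j in [set: int]) (p j)%:E = 1%E.
Definition cdf_pmf (p : int -> R) : int -> R :=
  fun j => fine (\esum_(i in [set i : int | i <= j]) (p i)%:E).

Definition D1 (p : int -> R) : \bar R := norm1 (Dif (Dif (cdf_pmf p))).

(** distances between integer-supported laws given by distribution functions *)
Definition dloc (F G : int -> R) : \bar R := norminf (fun j => (Dif F j - Dif G j)%R).
Definition dTV (F G : int -> R) : \bar R := (2^-1)%:E * norm1 (fun j => (Dif F j - Dif G j)%R).

(** distances between real laws given by distribution functions *)
Definition dK (F G : R -> R) : \bar R :=
  ereal_sup [set (`|F x - G x|)%:E | x in [set: R]].
Definition dW (F G : R -> R) : \bar R :=
  (\int[lebesgue_measure]_(x in [set: R]) (`|F x - G x|)%:E)%E.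

Definition Phi (x : R) : R :=
  fine (\int[lebesgue_measure]_(t in `]-oo, x]) (normal_pdf 0 1 t)%:E)%E.

Definition poisson_int (lam : R) (m : int) : R :=
  if (0 <= m)%R then expR (- lam) * lam ^+ `|m|%N / (`|m|%N)`!%:R else 0.

(** Translated Poisson TP(mu, s2): Z - floor(mu - s2) ~ Po(s2 + gamma),
    gamma = mu - s2 - floor(mu - s2). *)
Definition TP_pmf (mu s2 : R) (j : int) : R :=
  let a := Num.floor (mu - s2) in
  let gam := mu - s2 - a%:~R in
  poisson_int (s2 + gam) (j - a).

End Defs.

Section RV.
Context {d : measure_display} {T : measurableType d} {R : realType}.
Variable P : probability T R.

Definition int_rv (X : T -> int) : Prop := forall j : int, measurable [set w | X w = j].

Definition cdf_int (X : T -> int) : int -> R := fun j => fine (P [set w | X w <= j]).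

Definition cdf_real (X : T -> R) : R -> R := fun x => fine (P [set w | X w <= x]).

Definition sub_sigma (F : set (set T)) : Prop :=
  sigma_algebra setT F /\ F `<=` measurable.

Definition F_measurable_R (F : set (set T)) (g : T -> R) : Prop :=
  forall B : set R, measurable B -> F (g @^-1` B).

Definition cond_pmf (F : set (set T)) (X : T -> int) (k : T -> int -> R) : Prop :=
  [/\ forall w, is_pmf (k w),
      forall j, F_measurable_R F (fun w => k w j) &
      forall A j, F A ->
        P (A `&` [set w | X w = j]) = (\int[P]_(w in A) (k w j)%:E)%E].
End RV.

Section Model.
Context {d : measure_display} {T : measurableType d} {R : realType}.
Variable P : probability T R.
Local Open Scope ereal_scope.

Definition realW (W : T -> int) : T -> R := fun w => ((W w)%:~R)%R.

Definition mean_int (W : T -> int) : R := fine 'E_P[realW W].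

Definition cdf_std (W : T -> int) (sigma : R) : R -> R :=
  cdf_real P (fun w => ((realW W w - mean_int W) / sigma)%R).

(** All hypotheses of the theorem for one member W = W(sigma) of the family:
    F sub-sigma-algebra, N F-measurable, Y, Z_i, W integer valued,
    W = Y + sum_{i=1}^N Z_i, conditionally on F the variables Y, Z_1..Z_N are
    mutually independent (joint conditional pmf on {N = n} factorizes into the
    conditional marginal pmfs kY, kZ i), a.s. u <= 1 - D_1(L(Z_i | F))/2 for
    1 <= i <= N, Var W = sigma^2 (finite), and P[N < beta sigma^2] <= Ct sigma^-k. *)
Definition model_hyp (F : set (set T)) (N : T -> nat) (Y : T -> int)
    (Z : nat -> T -> int) (W : T -> int) (u beta k Ct sigma : R) : Prop :=
  sub_sigma F /\
      (forall n, F [set w | N w = n]) /\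
      (int_rv Y /\ (forall i, int_rv (Z i)) /\ int_rv W) /\
      (forall w, W w = (Y w + \sum_(1 <= i < (N w).+1) Z i w)%R) /\
      (exists (kY : T -> int -> R) (kZ : nat -> T -> int -> R),
        [/\ cond_pmf P F Y kY,
            (forall i, cond_pmf P F (Z i) (kZ i)),
            (forall (A : set T) (n : nat) (y : int) (z : nat -> int), F A ->
               P (A `&` [set w | N w = n /\ Y w = y /\
                                 forall i, (1 <= i <= n)%N -> Z i w = z i]) =
               \int[P]_(w in A `&` [set w | N w = n])
                  (kY w y * \prod_(1 <= i < n.+1) kZ i w (z i))%:E) &
            (forall i, (1 <= i)%N ->
               {ae P, forall w, (i <= N w)%N ->
                  u%:E <= 1 - (2^-1)%:E * D1 (kZ i w)})]) /\
      (realW W \in Lfun P 2%:E /\ 'V_P[realW W] = (sigma ^+ 2)%:E) /\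
      P [set w | ((N w)%:R < beta * sigma ^+ 2)%R] <= (Ct * powR sigma (- k))%:E.
End Model.

(* Main.v *)
(** Let [D = X - 1] act on functions on the integers as the difference operator,
    let [e] be the difference of the two mass functions and [f] that of the
    distribution functions, so that [e = D f] up to a shift. Conditionally on the
    sigma-algebra, [W] contains at least [beta * sigma ^ 2] independent summands
    each of which dominates a multiple of [(1 + X) / 2], so the part of the mass
    function of [W] living on [N >= beta * sigma ^ 2] has [D ^ (2 l)]-norm
    [O(sigma ^ (- 2 l))]; the same holds for the translated Poisson law as a limit
    of binomial laws. Convolving [e] with averages over [L] consecutive integers
    gives a one-step Landau-Kolmogorov inequality: high differences of [e] at cost
    [L ^ m], plus [f] at gain [1 / L], or [1 / L ^ 2] when [f] is controlled in
    [l1]. Since [D ^ m] can be taken with [m] large, [L = sigma * d ^ theta] loses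
    only a power [theta] of the distance [d] to the normal law, and [theta] is
    chosen to hit the required exponents. Finally [f] is bounded by [d] plus the
    distance of the translated Poisson law to the normal one, which is
    [O(sigma ^ (delta - 1))] for every [delta > 0] by comparing ratios of
    consecutive masses; this is absorbed because a lattice law is at distance at
    least [c / sigma] from the normal law. *)

Require Import Defs.
From HB Require Import structures.
From mathcomp Require Import all_boot all_order all_algebra.
From mathcomp Require Import all_classical all_reals all_analysis.
From mathcomp Require Import simple_functions measurable_realfun.
From mathcomp Require Import ring lra zify.

Set Implicit Arguments.
Unset Strict Implicit.
Unset Printing Implicit Defensive.

Import Order.TTheory GRing.Theory Num.Theory.
Import numFieldNormedType.Exports.
Local Open Scope classical_set_scope.
Local Open Scope ring_scope.

(** * Polynomials in the shift operator *)

Section PolyNorm.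
Context {R : realFieldType}.
Implicit Types (p q : {poly R}) (f g : int -> R) (c : R).

(** The local bounds carry a factor [1 / sigma] that total variation lacks. It comes from spending
    one of the [2 l] differences: an l1 bound on [D ^ (2 l) p] is a sup bound on [D ^ (2 l - 1) p]
    of the same order [sigma ^ (- 2 l)], while smoothing then costs only [L ^ (2 l - 1)]. The
    obstacle is the event [N < beta * sigma ^ 2], where no smoothness is available. Since [avgC L]
    has norm at most 2 for every [L], this part goes through the decomposition with a constant
    factor, and its mass, [O(sigma ^ -2)] for the local bounds and [O(sigma ^ -1)] for total
    variation, becomes [d / sigma], respectively [d], by the lattice bound [d >= c / sigma].
    Estimating [f] loses [theta] in the exponent of [d], and every division by [L] loses another
    [theta]. Hence the exponents [1 - 2 theta], [1 - 3 theta], [1 - 2 theta], with [theta] equal to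
    [1 / (2 k)], [2 / (3 (k + 1))] and [1 / (2 (k + 1))] in the three assertions. *)

Definition pnorm p : R := \sum_(i < size p) `|p`_i|.

(** ['X] acts as [f j -> f (j + 1)], so products of polynomials act as compositions ([actM]) and
    norm bounds can be proved on polynomials alone. *)
Definition act p f : int -> R := fun j => \sum_(i < size p) p`_i * f (j + i%:Z).

(** Quantifying over finite lists bounds the l1 norm without summability conditions or extended
    reals; [l1leP] links it to [norm1]. *)
Definition l1le f c := forall s : seq int, uniq s -> \sum_(j <- s) `|f j| <= c.

Lemma pnorm_widen p n : (size p <= n)%N -> pnorm p = \sum_(i < n) `|p`_i|.
Proof.
move=> pn; rewrite /pnorm (big_ord_widen n (fun i => `|p`_i|))// big_mkcond/=.
by apply: eq_bigr => i _; case: ltnP => // /(nth_default 0) ->; rewrite normr0.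
Qed.

Lemma pnorm_ge0 p : 0 <= pnorm p.
Proof. by apply: sumr_ge0 => i _; exact: normr_ge0. Qed.

Lemma pnorm0 : pnorm 0 = 0.
Proof. by rewrite /pnorm size_poly0 big_ord0. Qed.

Lemma pnormD p q : pnorm (p + q) <= pnorm p + pnorm q.
Proof.
pose n := maxn (size p) (size q).
rewrite (@pnorm_widen (p + q) n) ?size_polyD// (@pnorm_widen p n) ?leq_maxl//.
rewrite (@pnorm_widen q n) ?leq_maxr// -big_split/= ler_sum// => i _.
by rewrite coefD ler_normD.
Qed.

Lemma pnormZ c p : pnorm (c *: p) = `|c| * pnorm p.
Proof.
rewrite (@pnorm_widen (c *: p) (size p)) ?size_scale_leq// /pnorm mulr_sumr.
by apply: eq_bigr => i _; rewrite coefZ normrM.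
Qed.

Lemma pnormN p : pnorm (- p) = pnorm p.
Proof. by rewrite -scaleN1r pnormZ normrN1 mul1r. Qed.

Lemma pnormC c : pnorm c%:P = `|c|.
Proof.
rewrite (@pnorm_widen _ 1) ?size_polyC_leq1//.
by rewrite big_ord1 coefC.
Qed.

Lemma pnorm1 : pnorm 1 = 1.
Proof. by rewrite pnormC normr1. Qed.

(** A Horner step only adds a new constant coefficient, so the norm is additive and inductions along
    [poly_ind] lose nothing. *)
Lemma pnorm_cons p c : pnorm (p * 'X + c%:P) = pnorm p + `|c|.
Proof.
rewrite (@pnorm_widen _ (size p).+1); last first.
  by rewrite size_MXaddC; case: ifP => // _.
rewrite big_ord_recl/= addrC coefD coefMX coefC/= add0r; congr (_ + _).
by apply: eq_bigr => i _; rewrite coefD coefMX coefC/= addr0.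
Qed.

Lemma pnormMX p : pnorm (p * 'X) = pnorm p.
Proof. by have := pnorm_cons p 0; rewrite addr0 normr0 addr0. Qed.

Lemma pnormXn n : pnorm 'X^n = 1.
Proof. by elim: n => [|n IH]; rewrite ?expr0 ?pnorm1// exprSr pnormMX. Qed.

Lemma pnormM p q : pnorm (p * q) <= pnorm p * pnorm q.
Proof.
elim/poly_ind: p => [|p c IH]; first by rewrite mul0r pnorm0 mul0r.
rewrite pnorm_cons mulrDl mulrDl (le_trans (pnormD _ _))// lerD//.
  by rewrite mulrAC pnormMX.
by rewrite mul_polyC pnormZ.
Qed.

Lemma pnormM_le p q a b : pnorm p <= a -> pnorm q <= b -> pnorm (p * q) <= a * b.
Proof.
by move=> pa qb; rewrite (le_trans (pnormM _ _))// ler_pM// pnorm_ge0.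
Qed.

Lemma pnormX_le p a n : pnorm p <= a -> pnorm (p ^+ n) <= a ^+ n.
Proof.
move=> pa; elim: n => [|n IH]; first by rewrite !expr0 pnorm1.
by rewrite !exprS pnormM_le.
Qed.

Lemma pnorm_sum (I : Type) (r : seq I) (P : pred I) (F : I -> {poly R}) :
  pnorm (\sum_(i <- r | P i) F i) <= \sum_(i <- r | P i) pnorm (F i).
Proof.
elim/big_rec2: _ => [|i y1 y2 _ IH]; first by rewrite pnorm0.
by rewrite (le_trans (pnormD _ _))// lerD2l.
Qed.

Lemma act_widen p n f j : (size p <= n)%N ->
  act p f j = \sum_(i < n) p`_i * f (j + i%:Z).
Proof.
move=> pn; rewrite /act (big_ord_widen n (fun i => p`_i * f (j + i%:Z)))//.
rewrite big_mkcond/=.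
by apply: eq_bigr => i _; case: ltnP => // /(nth_default 0) ->; rewrite mul0r.
Qed.

Lemma act0 f : act 0 f =1 fun=> 0.
Proof. by move=> j; rewrite /act size_poly0 big_ord0. Qed.

Lemma actD p q f j : act (p + q) f j = act p f j + act q f j.
Proof.
pose n := maxn (size p) (size q).
rewrite (@act_widen (p + q) n) ?size_polyD// (@act_widen p n) ?leq_maxl//.
rewrite (@act_widen q n) ?leq_maxr// -big_split/=; apply: eq_bigr => i _.
by rewrite coefD mulrDl.
Qed.

Lemma actZ c p f j : act (c *: p) f j = c * act p f j.
Proof.
rewrite (@act_widen (c *: p) (size p)) ?size_scale_leq// /act mulr_sumr.
by apply: eq_bigr => i _; rewrite coefZ mulrA.
Qed.

Lemma actN p f j : act (- p) f j = - act p f j.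
Proof. by rewrite -scaleN1r actZ mulN1r. Qed.

Lemma actB p q f j : act (p - q) f j = act p f j - act q f j.
Proof. by rewrite actD actN. Qed.

Lemma actC c f j : act c%:P f j = c * f j.
Proof.
by rewrite (@act_widen _ 1) ?size_polyC_leq1// big_ord1 coefC addr0.
Qed.

Lemma act1 f j : act 1 f j = f j.
Proof. by rewrite actC mul1r. Qed.

Lemma act_cons p c f j : act (p * 'X + c%:P) f j = act p f (j + 1) + c * f j.
Proof.
rewrite (@act_widen _ (size p).+1); last first.
  by rewrite size_MXaddC; case: ifP => // _.
rewrite big_ord_recl/= addrC coefD coefMX coefC/= add0r addr0; congr (_ + _).
apply: eq_bigr => i _; rewrite coefD coefMX coefC/= addr0.
by rewrite /bump/= add1n -addrA -intS.
Qed.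

Lemma actX f j : act 'X f j = f (j + 1).
Proof. by have := act_cons 1 0 f j; rewrite mul1r addr0 mul0r addr0 act1. Qed.

Lemma eq_act p f g : f =1 g -> act p f =1 act p g.
Proof. by move=> fg j; apply: eq_bigr => i _; rewrite fg. Qed.

Lemma act_fD p f g j : act p (fun x => f x + g x) j = act p f j + act p g j.
Proof. by rewrite /act -big_split; apply: eq_bigr => i _; rewrite mulrDr. Qed.

Lemma act_fB p f g j : act p (fun x => f x - g x) j = act p f j - act p g j.
Proof. by rewrite /act -sumrB; apply: eq_bigr => i _; rewrite mulrBr. Qed.

Lemma act_fZ p c f j : act p (fun x => c * f x) j = c * act p f j.
Proof. by rewrite /act mulr_sumr; apply: eq_bigr => i _; rewrite mulrCA. Qed.

Lemma act_shift p f (a j : int) : act p (fun x => f (x + a)) j = act p f (j + a).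
Proof. by apply: eq_bigr => i _; rewrite addrAC. Qed.

Lemma actM p q f j : act (p * q) f j = act p (act q f) j.
Proof.
elim/poly_ind: p j => [|p c IH] j; first by rewrite mul0r !act0.
rewrite act_cons mulrDl actD mul_polyC actZ -IH; congr (_ + _).
by rewrite mulrAC -[_ * 'X]addr0 -polyC0 act_cons mul0r addr0.
Qed.

Lemma actXn n f j : act 'X^n f j = f (j + n%:Z).
Proof.
elim: n j => [|n IH] j; first by rewrite expr0 act1 addr0.
by rewrite exprS actM actX IH -addrA -intS.
Qed.

Lemma l1le_ge0 f c : l1le f c -> 0 <= c.
Proof. by move=> /(_ [::] isT); rewrite big_nil. Qed.

Lemma l1le_pt f c j : l1le f c -> `|f j| <= c.
Proof. by move=> /(_ [:: j] isT); rewrite big_seq1. Qed.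

Lemma l1le_le f c c' : l1le f c -> c <= c' -> l1le f c'.
Proof. by move=> fc cc' s us; rewrite (le_trans (fc s us)). Qed.

Lemma l1le_ext f g c : f =1 g -> l1le f c -> l1le g c.
Proof.
by move=> fg fc s us; rewrite (le_trans _ (fc s us))// ler_sum// => j _; rewrite fg.
Qed.

Lemma l1leD f g a b : l1le f a -> l1le g b -> l1le (fun j => f j + g j) (a + b).
Proof.
move=> fa gb s us; rewrite (le_trans _ (lerD (fa s us) (gb s us)))//.
by rewrite -big_split/= ler_sum// => j _; rewrite ler_normD.
Qed.

Lemma l1leN f a : l1le f a -> l1le (fun j => - f j) a.
Proof.
by move=> fa s us; rewrite (le_trans _ (fa s us))// ler_sum// => j _; rewrite normrN.
Qed.

Lemma l1leB f g a b : l1le f a -> l1le g b -> l1le (fun j => f j - g j) (a + b).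
Proof. by move=> fa /l1leN; exact: l1leD. Qed.

Lemma l1leZ c f a : l1le f a -> l1le (fun j => c * f j) (`|c| * a).
Proof.
move=> fa s us.
under eq_bigr do rewrite normrM.
by rewrite -mulr_sumr ler_wpM2l// fa.
Qed.

Lemma l1le_shift f a (k : int) : l1le f a -> l1le (fun j => f (j + k)) a.
Proof.
move=> fa s us; rewrite (le_trans _ (fa (map (fun j => j + k) s) _))//.
  by rewrite big_map.
by rewrite map_inj_uniq//; exact: addIr.
Qed.

Lemma l1le_act p f a c : pnorm p <= c -> l1le f a -> l1le (act p f) (c * a).
Proof.
move=> pc fa; suff: l1le (act p f) (pnorm p * a).
  by move=> H; apply: l1le_le H _; rewrite ler_wpM2r// (l1le_ge0 fa).
move: {pc} f fa; elim/poly_ind: p => [|p b IH] f fa.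
  rewrite pnorm0 mul0r => s us; rewrite big1// => i _.
  by rewrite act0 normr0.
rewrite pnorm_cons mulrDl.
apply: (@l1le_ext (fun j => act p f (j + 1) + b * f j)).
  by move=> j; rewrite act_cons.
by apply: l1leD; [apply/l1le_shift/IH|apply: l1leZ].
Qed.

Lemma act_sup p f a c : pnorm p <= c -> (forall j, `|f j| <= a) ->
  forall j, `|act p f j| <= c * a.
Proof.
move=> pc fa j; have a0 : 0 <= a := le_trans (normr_ge0 _) (fa 0).
rewrite (@le_trans _ _ (pnorm p * a))//; last by rewrite ler_wpM2r.
rewrite /act (le_trans (ler_norm_sum _ _ _))// mulr_suml ler_sum// => i _.
by rewrite normrM ler_wpM2l.
Qed.

End PolyNorm.

(** * Averages over consecutive integers *)

Section Smoothing.
Context {R : realType}.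
Implicit Types (f g : int -> R).

Local Notation D := ('X - 1 : {poly R}).

Definition avg (L : nat) : {poly R} := L%:R^-1 *: \sum_(i < L) 'X^i.

(** The average is squared because it has two jobs: one copy is merged with [D] and gains [1 / L],
    the other can turn an l1 bound into a sup bound and gain a second [1 / L]. *)
Definition avgC (L : nat) : {poly R} := 1 - avg L * avg L.

(** The quotient of [1 - avgC L ^+ m] by [1 - avgC L = avg L * avg L]. *)
Definition avgQ (m L : nat) : {poly R} := \sum_(i < m) avgC L ^+ i.

Lemma avgQE m L : 1 = avgC L ^+ m + avg L * avg L * avgQ m L.
Proof.
have := subrX1 (avgC L) m; rewrite -/(avgQ m L) {2}/avgC.
move=> H; apply/eqP; rewrite -subr_eq0.
have -> : 1 - (avgC L ^+ m + avg L * avg L * avgQ m L) =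
  - ((avgC L ^+ m - 1) - (1 - avg L * avg L - 1) * avgQ m L) by ring.
by rewrite H subrr oppr0.
Qed.

Lemma pnorm_avg L : (0 < L)%N -> pnorm (avg L) <= 1.
Proof.
move=> L0; rewrite /avg pnormZ ger0_norm ?invr_ge0// ler_pdivrMl ?ltr0n// mulr1.
rewrite (le_trans (pnorm_sum _ _ _))//.
by under eq_bigr do rewrite pnormXn; rewrite sumr_const card_ord.
Qed.

Lemma pnorm_avgC L : (0 < L)%N -> pnorm (avgC L) <= 2.
Proof.
move=> L0; rewrite (le_trans (pnormD _ _))// pnormN pnorm1.
have := pnormM_le (pnorm_avg L0) (pnorm_avg L0); lra.
Qed.

Lemma pnorm_avgQ m L : (0 < L)%N -> pnorm (avgQ m L) <= 2 ^+ m.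
Proof.
move=> L0; rewrite (@le_trans _ _ (\sum_(i < m) 2 ^+ i))//.
  rewrite (le_trans (pnorm_sum _ _ _))// ler_sum// => i _.
  by rewrite pnormX_le// pnorm_avgC.
have := subrX1 (2 : R) m; have -> : 2 - 1 = 1 :> R by ring.
rewrite mul1r => <-; lra.
Qed.

(** The product telescopes to [('X^L - 1) / L]. *)
Lemma pnorm_avgD L : (0 < L)%N -> pnorm (D * avg L) <= 2 / L%:R.
Proof.
move=> L0; rewrite /avg -scalerAr -subrX1 pnormZ ger0_norm ?invr_ge0// mulrC.
rewrite ler_wpM2r ?invr_ge0// (le_trans (pnormD _ _))//.
by rewrite pnormN pnorm1 pnormXn.
Qed.

(** [1 - avg L] vanishes at 1, hence is divisible by [D]; the quotient is an average of geometric
    sums of length below [L]. The remaining factor [1 + avg L] has norm at most 2. Each factor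
    [avgC L] thus yields one difference at cost [2 L]. *)
Lemma avgC_factor L : (0 < L)%N ->
  exists2 r : {poly R}, avgC L = D * r & pnorm r <= 2 * L%:R.
Proof.
move=> L0; pose r0 : {poly R} := L%:R^-1 *: \sum_(i < L) \sum_(j < i) 'X^j.
have E : 1 - avg L = - (D * r0).
  rewrite /r0 /avg -scalerAr mulr_sumr.
  under [in RHS]eq_bigr do rewrite -subrX1.
  rewrite sumrB scalerBr opprB; congr (_ - _).
  rewrite sumr_const card_ord -[in RHS]mul_polyC -[1 *+ L]/(L%:R).
  by rewrite -polyC_natr -polyCM mulVf// pnatr_eq0 -lt0n.
have nr0 : pnorm r0 <= L%:R.
  rewrite /r0 pnormZ ger0_norm ?invr_ge0// ler_pdivrMl ?ltr0n//.
  rewrite (le_trans (pnorm_sum _ _ _))//.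
  rewrite (@le_trans _ _ (\sum_(i < L) L%:R))//; last first.
    by rewrite sumr_const card_ord mulr_natl.
  apply: ler_sum => i _; rewrite (le_trans (pnorm_sum _ _ _))//.
  under eq_bigr do rewrite pnormXn.
  by rewrite sumr_const card_ord ler_nat ltnW.
exists (- r0 * (1 + avg L)).
  by rewrite mulrA mulrN -E /avgC; ring.
rewrite mulrC; apply: pnormM_le; last by rewrite pnormN.
rewrite (le_trans (pnormD _ _))// pnorm1; have := pnorm_avg L0; lra.
Qed.

Lemma act_avg_l1 L f a : (0 < L)%N -> l1le f a ->
  forall j, `|act (avg L) f j| <= a / L%:R.
Proof.
move=> L0 fa j; rewrite /avg actZ normrM ger0_norm ?invr_ge0// mulrC.
rewrite ler_wpM2r ?invr_ge0//.
have -> : act (\sum_(i < L) 'X^i) f j = \sum_(i < L) f (j + i%:Z).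
  elim: L {L0} => [|L IH]; first by rewrite !big_ord0 act0.
  by rewrite !big_ord_recr/= actD IH actXn.
rewrite (le_trans (ler_norm_sum _ _ _))//.
have := fa (map (fun i : nat => j + i%:Z) (iota 0 L)).
rewrite big_map map_inj_uniq ?iota_uniq; last by move=> x y /addrI [].
by move=> /(_ isT); rewrite -{1}[L]subn0 -/(index_iota 0 L) big_mkord.
Qed.

(** Summability forces arbitrarily small values to the right of [j]; telescoping from [j] to such a
    point costs at most the l1 norm of the difference. The bound [b] only provides the decay and
    does not enter the conclusion. *)
Lemma l1le_sup_diff f a b : l1le f b -> l1le (act D f) a ->
  forall j, `|f j| <= a.
Proof.
move=> fb da j; apply/ler_addgt0Pr => e e0.
(* Chosen with [n * e > b]: if [n] consecutive values all exceeded [e], their sum would exceed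
   [b]. *)
pose n := (Num.bound (b / e)).
have bn : b < n%:R * e.
  by rewrite -ltr_pdivrMr// archi_boundP// divr_ge0 ?(l1le_ge0 fb)// ltW.
have telesc i : `|f j| <= `|f (j + i%:Z)| + \sum_(l < i) `|act D f (j + l%:Z)|.
  elim: i => [|i IH]; first by rewrite big_ord0 !addr0.
  rewrite big_ord_recr/=; apply: (le_trans IH).
  have -> : act D f (j + i%:Z) = f (j + i.+1%:Z) - f (j + i%:Z).
    by rewrite actB actX act1 -addrA [_ + 1]addrC -intS.
  have := ler_normB (f (j + i.+1%:Z)) (f (j + i.+1%:Z) - f (j + i%:Z)).
  have -> : f (j + i.+1%:Z) - (f (j + i.+1%:Z) - f (j + i%:Z)) = f (j + i%:Z) by ring.
  by move=> H; rewrite [leLHS]addrC [leRHS]addrCA lerD2l.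
have [i fi] : exists i : 'I_n, `|f (j + (i : nat)%:Z)| <= e.
  apply: contrapT => /forallNP H.
  have := fb (map (fun i : nat => j + i%:Z) (iota 0 n)).
  rewrite big_map map_inj_uniq ?iota_uniq; last by move=> x y /addrI [].
  move=> /(_ isT); rewrite -{1}[n]subn0 -/(index_iota 0 n) big_mkord leNgt => /negP; apply.
  apply: (lt_le_trans bn); rewrite mulrC -[X in _ <= X]/(\sum_(i < n) _).
  rewrite -[in leLHS](card_ord n) mulr_natr -sumr_const ler_sum// => i _.
  by have /negP := H i; rewrite -ltNge => /ltW.
apply: (le_trans (telesc i)); rewrite addrC lerD//.
have := da (map (fun i : nat => j + i%:Z) (iota 0 i)).
rewrite big_map map_inj_uniq ?iota_uniq; last by move=> x y /addrI [].
by move=> /(_ isT); rewrite -{1}[nat_of_ord i]subn0 -/(index_iota 0 i) big_mkord.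
Qed.

End Smoothing.

(** * Landau-Kolmogorov inequalities for a difference of mass functions *)

Section LandauKolmogorov.
Context {R : realType}.
Local Notation D := ('X - 1 : {poly R}).

(* The averaging kernel [avg L] splits a difference [e] of probability mass
   functions into [e = avgC L ^+ m * e + avg L ^+ 2 * avgQ m L * e]: the first
   term carries [m] differences, the second one is smooth at scale [L] *)
Lemma smoothing_split m L (e f : int -> R) j : e =1 act D f ->
  e j = act (avgC L ^+ m) e j + act (avg L) (act (avgQ m L * (D * avg L)) f) j.
Proof.
move=> ef; rewrite -[LHS]act1 {1}(avgQE m L) actD; congr (_ + _).
rewrite (eq_act _ ef) -!actM; congr (act _ _ _); ring.
Qed.

Lemma act_avgCX_sup m L (f : int -> R) (a : R) : (0 < L)%N ->
  (forall j, `|act (D ^+ m) f j| <= a) ->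
  forall j, `|act (avgC L ^+ m) f j| <= (2 * L%:R) ^+ m * a.
Proof.
move=> L0 fa j; have [r -> nr] := @avgC_factor R L L0.
rewrite exprMn_comm; last exact: mulrC.
by rewrite mulrC actM; apply: act_sup; [exact: pnormX_le|].
Qed.

Lemma l1le_avgCX m L (f : int -> R) (a : R) : (0 < L)%N ->
  l1le (act (D ^+ m) f) a ->
  l1le (act (avgC L ^+ m) f) ((2 * L%:R) ^+ m * a).
Proof.
move=> L0 fa; have [r -> nr] := @avgC_factor R L L0.
rewrite exprMn_comm; last exact: mulrC.
apply: (@l1le_ext _ (act (r ^+ m) (act (D ^+ m) f))).
  by move=> j; rewrite mulrC actM.
by apply: l1le_act => //; exact: pnormX_le.
Qed.

Lemma pnorm_avgQD m L : (0 < L)%N ->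
  pnorm (avgQ m L * (D * avg L)) <= 2 ^+ m * (2 / L%:R).
Proof. by move=> L0; apply: pnormM_le; [exact: pnorm_avgQ|exact: pnorm_avgD]. Qed.

Section Bounds.
Variables (m L : nat) (L0 : (0 < L)%N) (p1 p2 q f : int -> R) (a b eps : R).
Hypothesis pqf : (fun j => p1 j + p2 j - q j) =1 act D f.
Let e j := p1 j + p2 j - q j.

Let eE j : act (avgC L ^+ m) e j =
  act (avgC L ^+ m) p1 j + act (avgC L ^+ m) p2 j - act (avgC L ^+ m) q j.
Proof. by rewrite /e act_fB act_fD. Qed.

(** The smooth pieces [p1] and [q] pay [(2 L) ^ m] for their [m] differences; the rough piece [p2]
    pays only [2 ^ m], the norm of [avgC L ^+ m]. The bound [c] on the averaged part stays abstract,
    to be filled from a sup or an l1 bound on [f]. *)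
Lemma dloc_split :
  (forall j, `|act (D ^+ m) p1 j| <= a) -> (forall j, `|act (D ^+ m) q j| <= b) ->
  (forall j, `|p2 j| <= eps) ->
  forall c : R, (forall j, `|act (avg L) (act (avgQ m L * (D * avg L)) f) j| <= c) ->
  forall j, `|p1 j + p2 j - q j| <= (2 * L%:R) ^+ m * (a + b) + 2 ^+ m * eps + c.
Proof.
move=> pa qb peps c fc j.
have -> : p1 j + p2 j - q j = _ := smoothing_split m L j pqf.
rewrite -/e eE.
have h1 := act_avgCX_sup L0 pa j.
have h2 := act_avgCX_sup L0 qb j.
have h3 := act_sup (pnormX_le m (pnorm_avgC L0)) peps j.
have h4 := fc j.
rewrite mulrDr (le_trans (ler_normD _ _))// lerD//.
rewrite (le_trans (ler_normB _ _))//.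
have := ler_normD (act (avgC L ^+ m) p1 j) (act (avgC L ^+ m) p2 j); lra.
Qed.

Lemma dloc_le_sup (c : R) :
  (forall j, `|act (D ^+ m) p1 j| <= a) -> (forall j, `|act (D ^+ m) q j| <= b) ->
  (forall j, `|p2 j| <= eps) -> (forall j, `|f j| <= c) ->
  forall j, `|p1 j + p2 j - q j| <=
    (2 * L%:R) ^+ m * (a + b) + 2 ^+ m * eps + 2 ^+ m * (2 / L%:R) * c.
Proof.
move=> pa qb peps fc; apply: dloc_split => // j.
rewrite -[X in _ <= X]mul1r; apply: act_sup; first exact: pnorm_avg.
by apply: act_sup => //; exact: pnorm_avgQD.
Qed.

Lemma dloc_le_l1 (c : R) :
  (forall j, `|act (D ^+ m) p1 j| <= a) -> (forall j, `|act (D ^+ m) q j| <= b) ->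
  (forall j, `|p2 j| <= eps) -> l1le f c ->
  forall j, `|p1 j + p2 j - q j| <=
    (2 * L%:R) ^+ m * (a + b) + 2 ^+ m * eps + 2 ^+ m * (2 / L%:R) * c / L%:R.
Proof.
move=> pa qb peps fc; apply: dloc_split => // j.
by apply: act_avg_l1 => //; apply: l1le_act => //; exact: pnorm_avgQD.
Qed.

Lemma dTV_le_l1 c :
  l1le (act (D ^+ m) p1) a -> l1le (act (D ^+ m) q) b ->
  l1le p2 eps -> l1le f c ->
  l1le (fun j => p1 j + p2 j - q j)
    ((2 * L%:R) ^+ m * (a + b) + 2 ^+ m * eps + 2 ^+ m * (2 / L%:R) * c).
Proof.
move=> pa qb peps fc.
apply: (@l1le_ext _ (fun j => act (avgC L ^+ m) e j +
    act (avg L) (act (avgQ m L * (D * avg L)) f) j)).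
  by move=> j; rewrite -(smoothing_split m L j pqf).
apply: l1leD; last first.
  rewrite -[X in l1le _ X]mul1r; apply: l1le_act; first exact: pnorm_avg.
  by apply: l1le_act => //; exact: pnorm_avgQD.
apply: (@l1le_ext _ (fun j => (act (avgC L ^+ m) p1 j - act (avgC L ^+ m) q j) +
  act (avgC L ^+ m) p2 j)).
  by move=> j; rewrite eE; ring.
apply: l1leD; last by apply: l1le_act => //; exact/pnormX_le/pnorm_avgC.
by rewrite mulrDr; apply: l1leB; exact: l1le_avgCX.
Qed.

End Bounds.
End LandauKolmogorov.

(** * Differences of powers of the fair coin polynomial *)

Section Binomial.
Context {R : realType}.
Local Notation D := ('X - 1 : {poly R}).

Definition halfB : {poly R} := 2^-1 *: ('X + 1).

Lemma coef_X1n n i : (('X + 1 : {poly R}) ^+ n)`_i = 'C(n, i)%:R.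
Proof.
elim: n i => [|n IH] [|i].
- by rewrite expr0 coef1 bin0.
- by rewrite expr0 coef1 bin0n.
- by rewrite exprSr mulrDr mulr1 coefD coefMX/= IH add0r !bin0.
- by rewrite exprSr mulrDr mulr1 coefD coefMX/= !IH binS natrD addrC.
Qed.

Lemma sum_binR n : \sum_(i < n.+1) 'C(n, i)%:R = 2 ^+ n :> R.
Proof.
rewrite -natrX (Pascal 1 1 n) natr_sum; apply: eq_bigr => i _.
by rewrite !exp1n !muln1.
Qed.

(** Pascal's rule, read as conditioning on the last of [n + 1] coin tosses. *)
Lemma sum_bin_shift n (F : nat -> R) :
  \sum_(i < n.+2) 'C(n.+1, i)%:R * F i =
  \sum_(i < n.+1) 'C(n, i)%:R * (F i + F i.+1).
Proof.
rewrite big_ord_recl/= bin0 mul1r.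
under eq_bigr do rewrite /bump/= add1n binS natrD mulrDl.
rewrite big_split/= big_ord_recr/= bin_small// mul0r addr0.
under [RHS]eq_bigr do rewrite mulrDr.
rewrite [RHS]big_split/= addrA; congr (_ + _).
by rewrite [RHS]big_ord_recl/= bin0 mul1r.
Qed.

(** The variance of a sum of [n] fair signs, before division by [2 ^ n]; each further sign adds
    1. *)
Lemma sum_bin_sqr n :
  \sum_(i < n.+1) 'C(n, i)%:R * (2 * i%:R - n%:R) ^+ 2 = n%:R * 2 ^+ n :> R.
Proof.
elim: n => [|n IH].
  by rewrite big_ord1 mulr0 subr0 expr0n/= mulr0 mul0r.
rewrite (@sum_bin_shift n (fun i => (2 * i%:R - n.+1%:R) ^+ 2)).
under eq_bigr => i _.
  have -> : 'C(n, i)%:R * ((2 * i%:R - n.+1%:R) ^+ 2 + (2 * i.+1%:R - n.+1%:R) ^+ 2) =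
     2 * ('C(n, i)%:R * (2 * i%:R - n%:R) ^+ 2) + 2 * 'C(n, i)%:R :> R.
    by rewrite -(natr1 i) -(natr1 n); ring.
  over.
rewrite big_split/= -!mulr_sumr IH sum_binR exprS -(natr1 n); ring.
Qed.

(* AM-GM with weight [x = sqrt n]: [2 |y| <= y^2 / x + x]. *)
Lemma sum_bin_abs n :
  \sum_(i < n.+1) 'C(n, i)%:R * `|2 * i%:R - n%:R| <= Num.sqrt n%:R * 2 ^+ n :> R.
Proof.
case: n => [|n]; first by rewrite big_ord1 mulr0 subr0 normr0 sqrtr0 mul0r mulr0.
set x : R := Num.sqrt n.+1%:R.
have x0 : 0 < x by rewrite sqrtr_gt0 ltr0n.
have xx : x ^+ 2 = n.+1%:R by rewrite sqr_sqrtr.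
rewrite -(ler_pM2l (mulr_gt0 (ltr0n R 2) x0)).
rewrite (@le_trans _ _ (\sum_(i < n.+2) ('C(n.+1, i)%:R * (2 * i%:R - n.+1%:R) ^+ 2 + n.+1%:R * 'C(n.+1, i)%:R)))//.
  rewrite mulr_sumr ler_sum// => i _.
  rewrite -(real_normK (num_real (2 * i%:R - n.+1%:R))).
  set y := `| _ |; have y0 : 0 <= y by exact: normr_ge0.
  have := ler0n R 'C(n.+1, i); move: ('C(n.+1, i)%:R : R) => c c0.
  rewrite -xx -subr_ge0.
  have -> : c * y ^+ 2 + x ^+ 2 * c - 2 * x * (c * y) = c * (y - x) ^+ 2 by ring.
  by rewrite mulr_ge0// sqr_ge0.
rewrite big_split/= sum_bin_sqr -mulr_sumr sum_binR.
by rewrite -xx; have -> : 2 * x * (x * 2 ^+ n.+1) = x ^+ 2 * 2 ^+ n.+1 + x ^+ 2 * 2 ^+ n.+1 by ring.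
Qed.

Lemma pnorm_halfB : pnorm halfB <= 1.
Proof.
rewrite /halfB pnormZ ger0_norm ?invr_ge0//.
have := pnorm_cons (1 : {poly R}) 1; rewrite mul1r pnorm1 normr1 => ->; lra.
Qed.

(** The coefficients of [D * ('X + 1) ^+ t] are differences of neighbouring binomial coefficients,
    that is ['C(t.+1, i) * (2 i - t.+1) / t.+1]. The norm is therefore a mean absolute deviation,
    bounded by the standard deviation through [sum_bin_abs]. *)
Lemma pnorm_DB t : pnorm (D * halfB ^+ t) <= 2 / Num.sqrt t.+1%:R.
Proof.
rewrite /halfB exprZn -scalerAr pnormZ ger0_norm ?exprn_ge0 ?invr_ge0//.
rewrite (@pnorm_widen _ _ t.+2); last first.
  have s0 : 'X + 1 != 0 :> {poly R} by rewrite -size_poly_eq0 -[1]opprK -polyC1 -polyCN size_XsubC.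
  have sX : size ('X + 1 : {poly R}) = 2%N by rewrite -[1]opprK -polyC1 -polyCN size_XsubC.
  rewrite (leq_trans (size_polyMleq _ _))// -polyC1 size_XsubC/= ltnS.
  rewrite (leq_trans (size_poly_exp_leq _ _))//.
  by rewrite polyC1 sX/= mul1n.
have E (i : 'I_t.+2) : t.+1%:R * (D * ('X + 1) ^+ t)`_i =
    'C(t.+1, i)%:R * (2 * i%:R - t.+1%:R) :> R.
  rewrite mulrBl mul1r coefB coefXM !coef_X1n.
  case: i => -[|i] hi /=; first by rewrite !bin0; ring.
  rewrite mulrBr -!natrM.
  have e1 : (t.+1 * 'C(t, i) = i.+1 * 'C(t.+1, i.+1))%N by rewrite mul_bin_diag.
  have e2 : (t.+1 * 'C(t, i.+1) = (t.+1 - i.+1) * 'C(t.+1, i.+1))%N.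
    by rewrite -mul_bin_down.
  by rewrite e1 e2 !natrM natrB//; ring.
set s : R := Num.sqrt t.+1%:R.
have s0 : 0 < s by rewrite sqrtr_gt0 ltr0n.
have ss : s ^+ 2 = t.+1%:R by rewrite sqr_sqrtr.
have /ler_wpM2l := sum_bin_abs t.+1.
move=> /(_ (t.+1%:R^-1 * 2^-1 ^+ t)) => H.
have h0 : 0 <= t.+1%:R^-1 * 2^-1 ^+ t :> R by rewrite mulr_ge0 ?exprn_ge0 ?invr_ge0.
have -> : 2 / s = t.+1%:R^-1 * 2^-1 ^+ t * (s * 2 ^+ t.+1).
  rewrite -ss [in RHS](exprS 2).
  have -> : (s ^+ 2)^-1 * 2^-1 ^+ t * (s * (2 * 2 ^+ t)) =
    (2^-1 * 2) ^+ t * ((s ^+ 2)^-1 * s * 2) by rewrite exprMn_comm; [ring|exact: mulrC].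
  have -> : 2^-1 * 2 = 1 :> R by rewrite mulVf.
  by rewrite expr1n; field; rewrite gt_eqF.
apply: le_trans (H h0); rewrite [leRHS]mulrAC [leRHS]mulrC.
rewrite ler_wpM2l ?exprn_ge0 ?invr_ge0//.
rewrite -ler_pdivrMl ?invr_gt0 ?ltr0n// invrK mulr_sumr ler_sum// => i _.
rewrite -[X in X * _](@ger0_norm R) ?ler0n// -normrM E normrM ger0_norm//.
Qed.

Lemma pnorm_DB_sqr t : pnorm (D * halfB ^+ t) ^+ 2 <= 4 / t.+1%:R.
Proof.
have -> : 4 / t.+1%:R = (2 / Num.sqrt t.+1%:R) ^+ 2 :> R.
  by rewrite expr_div_n sqr_sqrtr//; congr (_ / _); ring.
by rewrite ler_sqr ?nnegrE ?pnorm_ge0 ?divr_ge0 ?sqrtr_ge0// pnorm_DB.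
Qed.

(** The [s] coins are divided into [2 l] groups of [t = s %/ (2 l)], one for each difference;
    left-over coins have norm at most 1. The constant comes from [s + 1 <= 2 l (t + 1)]. *)
Lemma pnorm_DnB l s :
  pnorm (D ^+ (2 * l) * halfB ^+ s) <= (8 * l%:R) ^+ l / s.+1%:R ^+ l.
Proof.
case: l => [|l].
  rewrite muln0 !expr0 mul1r divr1.
  by have := pnormX_le s pnorm_halfB; rewrite expr1n.
set n := (2 * l.+1)%N; pose t := (s %/ n)%N.
have -> : D ^+ n * halfB ^+ s = (D * halfB ^+ t) ^+ n * halfB ^+ (s %% n).
  rewrite {1}(divn_eq s n) exprD exprM mulrA; congr (_ * _).
  by rewrite exprMn_comm//; exact: mulrC.
rewrite -[X in _ <= X]mulr1; apply: pnormM_le; last first.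
  by have := pnormX_le (s %% n) pnorm_halfB; rewrite expr1n.
apply: (le_trans (pnormX_le n (lexx _))).
rewrite /n exprM -expr_div_n.
apply: lerXn2r; rewrite ?nnegrE ?sqr_ge0 ?divr_ge0 ?mulr_ge0//.
apply: (le_trans (pnorm_DB_sqr t)).
rewrite ler_pdivrMr ?ltr0n// mulrAC ler_pdivlMr ?ltr0n//.
rewrite -!natrM ler_nat.
have := divn_eq s n; have : (s %% n < n)%N by rewrite ltn_mod.
rewrite -/t /n; nia.
Qed.

End Binomial.

(** * Smoothing by a random number of fair coins *)

Section Recursion.
Context {R : realType}.
Local Notation D := ('X - 1 : {poly R}).
Variable l : nat.

(* [smooth_rate v n s] dominates the mean of [1 / (1 + s + S) ^ l] for
   [S ~ Bin(n, v)], up to constants. *)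
Definition smooth_rate (v : R) (n s : nat) : R :=
  (8 * l%:R) ^+ l / (1 + s%:R + v * n%:R / l.+1%:R) ^+ l.

Lemma bernoulli_ineq (x : R) n : 0 <= x -> 1 + n%:R * x <= (1 + x) ^+ n.
Proof.
move=> x0; elim: n => [|n IH]; first by rewrite expr0 mul0r addr0.
rewrite exprS (@le_trans _ _ ((1 + x) * (1 + n%:R * x)))//.
  rewrite -natr1 -subr_ge0.
  have -> : (1 + x) * (1 + n%:R * x) - (1 + (n%:R + 1) * x) = n%:R * x ^+ 2 by ring.
  by rewrite mulr_ge0// sqr_ge0.
by rewrite ler_wpM2l// addr_ge0.
Qed.

Lemma bernoulli_ineqN (x : R) n : 0 <= x <= 1 -> 1 - n%:R * x <= (1 - x) ^+ n.
Proof.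
move=> /andP[x0 x1]; elim: n => [|n IH]; first by rewrite expr0 mul0r subr0.
rewrite exprS (@le_trans _ _ ((1 - x) * (1 - n%:R * x)))//.
  rewrite -natr1 -subr_ge0.
  have -> : (1 - x) * (1 - n%:R * x) - (1 - (n%:R + 1) * x) = n%:R * x ^+ 2 by ring.
  by rewrite mulr_ge0// sqr_ge0.
by rewrite ler_wpM2l// subr_ge0.
Qed.

(** By convexity, the mean of [1 / x ^ l] after a Bernoulli step of parameter [v] is at least its
    value at [x + v]. Advancing by [v / (l + 1)] only leaves room for this defect; both powers are
    linearised by Bernoulli's inequality. *)
Lemma inv_pow_step (x v : R) : 1 <= x -> 0 <= v <= 1 ->
  v / (x + 1) ^+ l + (1 - v) / x ^+ l <= 1 / (x + v / l.+1%:R) ^+ l.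
Proof.
move=> x1 /andP[v0 v1]; have x0 : 0 < x by lra.
set w := v / l.+1%:R; have w0 : 0 <= w by rewrite /w divr_ge0.
have vw : v = w * (1 + l%:R) by rewrite /w nat1r mulfVK// pnatr_eq0.
have L0 := ler0n R l.
have xl0 : 0 < x ^+ l by rewrite exprn_gt0.
have H1 : ((x + 1) ^+ l)^-1 <= x / (x + l%:R) * (x ^+ l)^-1.
  have -> : x + 1 = x * (1 + x^-1) by rewrite mulrDr mulr1 divff ?gt_eqF.
  rewrite exprMn_comm; last exact: mulrC.
  rewrite invfM mulrC ler_wpM2r ?invr_ge0 ?(ltW xl0)//.
  have -> : x / (x + l%:R) = (1 + l%:R * x^-1)^-1.
    by field; rewrite gt_eqF//= gt_eqF//; lra.
  rewrite lef_pV2 ?posrE; first by apply: bernoulli_ineq; rewrite invr_ge0 ltW.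
    by rewrite exprn_gt0// ltr_pwDl// invr_ge0 ltW.
  by rewrite ltr_pwDl// mulr_ge0// invr_ge0 ltW.
have H2 : (1 - l%:R * (w / x)) * (x ^+ l)^-1 <= ((x + w) ^+ l)^-1.
  have xw0 : 0 < x + w by lra.
  have -> : (x + w)^-l = (x / (x + w)) ^+ l * (x ^+ l)^-1.
    by rewrite expr_div_n mulrAC divff ?gt_eqF// mul1r.
  rewrite ler_wpM2r ?invr_ge0 ?(ltW xl0)//.
  have -> : x / (x + w) = 1 - w / (x + w) by field; rewrite gt_eqF.
  rewrite (@le_trans _ _ (1 - l%:R * (w / (x + w))))//.
    rewrite lerD2l lerN2 ler_wpM2l// ler_wpM2l// lef_pV2 ?posrE//; lra.
  apply: bernoulli_ineqN; rewrite divr_ge0 ?(ltW xw0)//=.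
  rewrite ler_pdivrMr//; lra.
rewrite div1r (le_trans _ H2)//.
rewrite (@le_trans _ _ ((v * (x / (x + l%:R)) + (1 - v)) * (x ^+ l)^-1))//.
  by rewrite [leRHS]mulrDl lerD2r -mulrA ler_wpM2l.
rewrite ler_wpM2r ?invr_ge0 ?(ltW xl0)//.
(* With [v = w * (1 + l)] the difference becomes an explicit nonnegative multiple of [x - 1], which
   is where [1 <= x] enters. *)
rewrite -subr_ge0 vw.
have -> : 1 - l%:R * (w / x) - (w * (1 + l%:R) * (x / (x + l%:R)) + (1 - w * (1 + l%:R))) =
  w * l%:R * l%:R * (x - 1) / (x * (x + l%:R)).
  by field; rewrite !gt_eqF//; lra.
rewrite divr_ge0 ?mulr_ge0//; lra.
Qed.

Lemma smooth_rate_step v n s : 0 <= v <= 1 ->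
  v * smooth_rate v n s.+1 + (1 - v) * smooth_rate v n s <= smooth_rate v n.+1 s.
Proof.
move=> v01; rewrite /smooth_rate.
set x := 1 + s%:R + v * n%:R / l.+1%:R.
have -> : 1 + s.+1%:R + v * n%:R / l.+1%:R = x + 1 by rewrite /x -natr1; ring.
have -> : 1 + s%:R + v * n.+1%:R / l.+1%:R = x + v / l.+1%:R.
  by rewrite /x -(natr1 n) mulrDr mulr1 mulrDl addrA.
have x1 : 1 <= x.
  rewrite /x -addrA lerDl addr_ge0// divr_ge0// mulr_ge0//.
  by case/andP: v01.
have := @inv_pow_step x v x1 v01; rewrite div1r => /(ler_wpM2l _) H.
have K0 : 0 <= (8 * l%:R) ^+ l :> R by rewrite exprn_ge0// mulr_ge0.
by have := H _ K0; congr (_ <= _); ring.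
Qed.

Lemma smooth_rate0 v s : (8 * l%:R) ^+ l / s.+1%:R ^+ l = smooth_rate v 0 s.
Proof. by rewrite /smooth_rate mulr0 mul0r addr0 nat1r. Qed.

Lemma smooth_rate_le v n s : 0 < v -> (0 < n)%N ->
  smooth_rate v n s <= (8 * l%:R * l.+1%:R / (v * n%:R)) ^+ l.
Proof.
move=> v0 n0; rewrite /smooth_rate.
have vn : 0 < v * n%:R by rewrite mulr_gt0// ltr0n.
have -> : 8 * l%:R * l.+1%:R / (v * n%:R) = 8 * l%:R / (v * n%:R / l.+1%:R).
  field; rewrite ?gt_eqF ?ltr0n//=; lra.
rewrite -expr_div_n lerXn2r ?nnegrE ?divr_ge0 ?mulr_ge0 ?(ltW v0)//.
  by rewrite !addr_ge0// divr_ge0// mulr_ge0// ltW.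
rewrite ler_wpM2l ?mulr_ge0// lef_pV2 ?posrE ?divr_gt0//.
  by rewrite lerDr addr_ge0.
by rewrite ltr_wpDl ?divr_gt0// addr_ge0.
Qed.

(* A Bernoulli factor with parameter [v / 2] is the mixture of [1] (weight
   [1 - v]) and of the symmetric factor [halfB] (weight [v]). *)
Lemma pnorm_bernoulli v n s : 0 <= v <= 1 ->
  pnorm (D ^+ (2 * l) * halfB ^+ s * ((1 - v)%:P + v *: halfB) ^+ n)
    <= smooth_rate v n s.
Proof.
move=> v01; elim: n s => [|n IH] s.
  by rewrite expr0 mulr1 -smooth_rate0; exact: pnorm_DnB.
apply: le_trans (smooth_rate_step n s v01); case/andP: v01 => v0 v1.
have -> : D ^+ (2 * l) * halfB ^+ s * ((1 - v)%:P + v *: halfB) ^+ n.+1 =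
  v *: (D ^+ (2 * l) * halfB ^+ s.+1 * ((1 - v)%:P + v *: halfB) ^+ n) +
  (1 - v) *: (D ^+ (2 * l) * halfB ^+ s * ((1 - v)%:P + v *: halfB) ^+ n).
  by rewrite -!mul_polyC !exprS; ring.
rewrite (le_trans (pnormD _ _))// !pnormZ !ger0_norm ?subr_ge0//.
by rewrite lerD// ler_wpM2l// subr_ge0.
Qed.

End Recursion.

(** * Poisson laws *)

Section PoissonSmooth.
Context {R : realType}.
Local Notation D := ('X - 1 : {poly R}).

Definition coefz (p : {poly R}) (j : int) : R := if (0 <= j)%R then p`_`|j|%N else 0.

(** Multiplication by ['X] moves coefficients to the right while its action moves a function to the
    left; this explains the sign and the shift by [m]. *)
Lemma act_DX_coefz p m j :
  act (D ^+ m) (coefz p) j = (-1) ^+ m * coefz (D ^+ m * p) (j + m%:Z).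
Proof.
elim: m j => [|m IH] j; first by rewrite !expr0 act1 !mul1r addr0.
rewrite exprS actM actB actX act1 !IH -mulrBr (exprSr (-1)) -mulrA.
congr (_ * _); rewrite -mulrA; set q := D ^+ m * p; rewrite mulN1r.
have -> : j + m.+1%:Z = (j + m%:Z) + 1 by rewrite -addrA [_ + 1]addrC -intS.
have -> : j + 1 + m%:Z = (j + m%:Z) + 1 by rewrite addrAC.
move: (j + m%:Z) => k; rewrite /coefz mulrBl mul1r.
case: k => [k|[|k]].
- by rewrite -PoszD /= coefB coefXM addn1/= opprB.
- by rewrite /= coefB coefXM/= sub0r opprK subr0.
- have -> : (Negz k.+1 + 1 = Negz k)%R by lia.
  by rewrite /= subrr oppr0.
Qed.

Lemma l1le_coefz p c : pnorm p <= c -> l1le (coefz p) c.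
Proof.
move=> pc; apply: l1le_le pc => s us.
have [n sn] : exists n : nat, forall j, j \in s -> (`|j| < n)%N.
  exists (\max_(j <- s) `|j|%N).+1 => j js; rewrite ltnS.
  by rewrite (big_rem j js)/= leq_maxl.
rewrite (@pnorm_widen _ p (maxn n (size p))) ?leq_maxr//.
rewrite -(big_mkord xpredT (fun i => `|p`_i|)).
pose t : seq int := [seq (i : nat)%:Z | i <- index_iota 0 (maxn n (size p))].
have -> : \sum_(0 <= i < maxn n (size p)) `|p`_i| = \sum_(j <- t) `|coefz p j|.
  by rewrite big_map.
rewrite [leLHS](bigID (fun j : int => 0 <= j)%R)/= [X in _ + X]big1 ?addr0; last first.
  by move=> j /negbTE j0; rewrite /coefz j0 normr0.
rewrite -big_filter; pose s' := [seq i <- s | (0 <= i)%R]; rewrite -/s'.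
apply: (@le_trans _ _ (\sum_(j <- t | j \in s') `|coefz p j|)); last first.
  by rewrite [leRHS](bigID (mem s'))/= lerDl sumr_ge0.
rewrite -[leRHS]big_filter (perm_big [seq j <- t | j \in s'])//=.
apply: uniq_perm; rewrite ?filter_uniq//.
  by rewrite /t map_inj_uniq ?iota_uniq// => x y [].
move=> j; rewrite [RHS]mem_filter andb_idr//.
rewrite mem_filter => /andP[j0 js]; apply/mapP; exists `|j|%N.
  by rewrite mem_index_iota/= leq_max sn.
by rewrite gez0_abs.
Qed.

(** Each instance of [l1le] involves finitely many points, so pointwise convergence suffices. *)
Lemma l1le_lim (F : nat -> int -> R) (f : int -> R) (c : R) :
  (forall j, F n j @[n --> \oo] --> f j) -> (\forall n \near \oo, l1le (F n) c) ->
  l1le f c.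
Proof.
move=> Ff Fc s us.
have H : (\sum_(j <- s) `|F n j|) @[n --> \oo] --> \sum_(j <- s) `|f j|.
  elim: s {us} => [|j s IH].
    under eq_fun do rewrite big_nil; rewrite big_nil; exact: cvg_cst.
  under eq_fun do rewrite big_cons.
  by rewrite big_cons; apply: cvgD => //; apply: cvg_norm.
rewrite -(cvg_lim _ H)//; apply: limr_le; first by apply/cvg_ex; eexists; exact: H.
near=> n; have Fn : l1le (F n) c by near: n; exact: Fc.
exact: Fn.
Unshelve. all: by end_near. Qed.

Lemma cvg_act p (F : nat -> int -> R) (f : int -> R) :
  (forall j, F n j @[n --> \oo] --> f j) ->
  forall j, act p (F n) j @[n --> \oo] --> act p f j.
Proof.
move=> Ff j; rewrite /act; elim: (size p) => [|n IH].
  under eq_fun do rewrite big_ord0; rewrite big_ord0; exact: cvg_cst.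
under eq_fun do rewrite big_ord_recr/=.
by rewrite big_ord_recr/=; apply: cvgD => //; apply: cvgMr.
Qed.

(** With [y = x / n.+1], the powers of [1 - y] and [expR (- y)] have bases in [[0, 1]] at distance
    at most [y ^ 2], so they differ by at most [n.+1 * y ^ 2], which is [x ^ 2 / n.+1]. *)
Lemma exp_lim (x : R) : 0 <= x ->
  (1 - x / n.+1%:R) ^+ n.+1 @[n --> \oo] --> expR (- x).
Proof.
move=> x0; apply/subr_cvg0.
apply: (@squeeze_cvgr _ _ _ _ (fun n => - (x ^+ 2 * harmonic n)) (fun n => x ^+ 2 * harmonic n)); last 2 first.
- by rewrite -[0]oppr0; apply: cvgN; rewrite -[0](mulr0 (x ^+ 2)); apply: cvgMr; exact: cvg_harmonic.
- by rewrite -[0](mulr0 (x ^+ 2)); apply: cvgMr; exact: cvg_harmonic.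
have [N Nx] : exists N : nat, x <= N%:R.
  by exists (Num.bound x); rewrite ltW// archi_boundP.
near=> n.
have xn : x / n.+1%:R <= 1.
  rewrite ler_pdivrMr ?ltr0n// mul1r (le_trans Nx)// ler_nat.
  by rewrite ltnW// ltnS; near: n; exact: nbhs_infty_ge.
have y0 : 0 <= x / n.+1%:R by rewrite divr_ge0.
rewrite -ler_norml; set y := x / n.+1%:R in xn y0 *.
have -> : - x = n.+1%:R * (- y) by rewrite /y mulrN mulrC mulfVK ?pnatr_eq0.
rewrite expRM_natl; set a := expR _; set b := 1 - y.
have a01 : 0 <= a <= 1 by rewrite expR_ge0/= expR_le1 oppr_le0.
have b01 : 0 <= b <= 1 by rewrite subr_ge0 xn/= gerBl.
have ab : `|b - a| <= y ^+ 2.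
  have h1 : b <= a by exact: expR_ge1Dx.
  rewrite ler0_norm ?subr_le0// opprB.
  have h2 : a <= (1 + y)^-1.
    rewrite /a expRN lef_pV2 ?posrE ?expR_gt0//; last by rewrite ltr_pwDl.
    exact: expR_ge1Dx.
  have : (1 + y)^-1 <= 1 - y + y ^+ 2.
    rewrite -div1r ler_pdivrMr; last by rewrite ltr_pwDl.
    rewrite -subr_ge0; have -> : (1 - y + y ^+ 2) * (1 + y) - 1 = y ^+ 3 by ring.
    by rewrite exprn_ge0.
  rewrite /b; lra.
rewrite subrXX normrM.
apply: (@le_trans _ _ (y ^+ 2 * n.+1%:R)).
  apply: ler_pM => //; rewrite (le_trans (ler_norm_sum _ _ _))//.
  rewrite -[n.+1 in leRHS]card_ord -sumr_const ler_sum// => i _.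
  rewrite normrM !normrX !ger0_norm; try by case/andP: a01; case/andP: b01.
  by rewrite mulr_ile1 ?exprn_ge0 ?exprn_ile1//; case/andP: a01; case/andP: b01.
rewrite /y /harmonic/=; set N' := n.+1%:R.
have -> : (x / N') ^+ 2 * N' = x ^+ 2 * N'^-1 by field; rewrite /N' -?(nat1r n) ?nat1r pnatr_eq0.
exact: lexx.
Unshelve. all: by end_near. Qed.

(** Generating polynomial of the binomial law with parameters [n] and [lam / n]. *)
Definition binpoly (lam : R) (n : nat) : {poly R} :=
  (((1 - lam / n%:R)%:P + (lam / n%:R) *: 'X)) ^+ n.

Lemma coef_binpoly lam n i : (binpoly lam n)`_i =
  'C(n, i)%:R * (lam / n%:R) ^+ i * (1 - lam / n%:R) ^+ (n - i).
Proof.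
rewrite /binpoly; set b := lam / _; set a := 1 - b.
rewrite exprDn coef_sum.
transitivity (\sum_(k < n.+1) (if (k : nat) == i then a ^+ (n - k) * b ^+ k *+ 'C(n, k) else 0)).
  apply: eq_bigr => k _; rewrite coefMn -polyC_exp exprZn -mul_polyC mulrA -polyCM.
  rewrite coefCM coefXn eq_sym; case: eqP => _; first by rewrite mulr1.
  by rewrite mulr0 mul0rn.
have [ilen|nlti] := ltnP i n.+1.
  rewrite (bigD1 (Ordinal ilen))//= eqxx big1 ?addr0; last first.
    by move=> k /eqP ki; case: eqP => // ki'; case: ki; apply/val_inj.
  by rewrite -mulr_natl; ring.
rewrite big1 ?bin_small ?mul0r// => k _; case: eqP => // ki.
by have := ltn_ord k; rewrite ki; lia.
Qed.

(** Poisson's limit theorem, by induction on [i] through the ratio of consecutive binomial weights;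
    [exp_lim] is the base case. *)
Lemma cvg_coef_binpoly lam i : 0 <= lam ->
  (binpoly lam n.+1)`_i @[n --> \oo] --> expR (- lam) * lam ^+ i / i`!%:R.
Proof.
move=> l0; elim: i => [|i IH].
  under eq_fun do rewrite coef_binpoly bin0 mul1r expr0 mul1r subn0.
  by rewrite expr0 mulr1 fact0 divr1; exact: exp_lim.
have h0 : (lam * harmonic n) @[n --> \oo] --> (0 : R).
  by rewrite -[X in _ --> X](mulr0 lam); apply: cvgMr; exact: cvg_harmonic.
have h1 : (1 - lam * harmonic n) @[n --> \oo] --> (1 : R).
  by rewrite -[X in _ --> X](subr0 1); apply: cvgB => //; exact: cvg_cst.
have h2 : (1 - i%:R * harmonic n) @[n --> \oo] --> (1 : R).
  rewrite -[X in _ --> X](subr0 1); apply: cvgB; first exact: cvg_cst.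
  by rewrite -[X in _ --> X](mulr0 i%:R); apply: cvgMr; exact: cvg_harmonic.
have -> : expR (- lam) * lam ^+ i.+1 / (i.+1)`!%:R =
    expR (- lam) * lam ^+ i / i`!%:R * (1 * lam / i.+1%:R * 1^-1).
  rewrite factS natrM exprSr; field.
  by rewrite nat1r !pnatr_eq0 -!lt0n fact_gt0.
have H : ((binpoly lam n.+1)`_i * ((1 - i%:R * harmonic n) * lam * i.+1%:R^-1 *
    (1 - lam * harmonic n)^-1)) @[n --> \oo] -->
    (expR (- lam) * lam ^+ i / i`!%:R * (1 * lam / i.+1%:R * 1^-1)).
  apply: cvgM => //; apply: cvgM; last exact: cvgV (oner_neq0 _) h1.
  by apply: cvgM; [apply: cvgM => //; exact: cvg_cst|exact: cvg_cst].
apply: (cvg_trans _ H); apply: near_eq_cvg; near=> n.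
have n1 : n.+1%:R != 0 :> R by rewrite pnatr_eq0.
have in_ : (i <= n)%N by near: n; exact: nbhs_infty_ge.
have lamn : lam < n.+1%:R.
  rewrite (@lt_le_trans _ _ (Num.bound lam)%:R) ?archi_boundP// ler_nat.
  by rewrite leqW//; near: n; exact: nbhs_infty_ge.
rewrite !coef_binpoly /harmonic/= subSn//.
set h := lam / n.+1%:R.
have h1' : 1 - h != 0.
  by rewrite subr_eq0 eq_sym lt_eqF// /h ltr_pdivrMr ?ltr0n// mul1r.
have e1 : i.+1%:R * 'C(n.+1, i.+1)%:R = (n.+1%:R - i%:R) * 'C(n.+1, i)%:R :> R.
  rewrite -natrB; last by rewrite leqW.
  by rewrite -!natrM mul_bin_left.
have -> : 'C(n.+1, i.+1)%:R = (n.+1%:R - i%:R) * 'C(n.+1, i)%:R / i.+1%:R :> R.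
  by rewrite -e1 mulrAC divff ?mul1r// pnatr_eq0.
rewrite subSS (exprS (1 - h)) (exprS h) -/h {1}/h.
have i1 : i.+1%:R != 0 :> R by rewrite pnatr_eq0.
have -> : (1 - i%:R / n.+1%:R) * lam = (n.+1%:R - i%:R) * h.
  by rewrite /h; move: n1; move: (n.+1%:R : R) => N n1; field.
rewrite -/h; move: (h ^+ i) ((1 - h) ^+ (n - i)) => X Y.
by move: i1; move: (i.+1%:R : R) => I i1; field; rewrite h1' i1.
Unshelve. all: by end_near. Qed.

(** A Bernoulli variable of parameter [lam / n] tosses a fair coin with probability [2 * lam / n];
    in this form [pnorm_bernoulli] applies. *)
Lemma binpolyE lam n : binpoly lam n =
  ((1 - 2 * lam / n%:R)%:P + (2 * lam / n%:R) *: halfB) ^+ n.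
Proof.
rewrite /binpoly /halfB; congr (_ ^+ _).
rewrite scalerA scalerDr addrA.
have -> : 2 * lam / n%:R / 2 = lam / n%:R.
  by rewrite mulrAC [2 * lam / 2]mulrAC divff ?mul1r.
rewrite alg_polyC addrAC -polyCD; congr (_%:P + _).
have -> : 2 * lam / n%:R = 2 * (lam / n%:R) by rewrite mulrA.
ring.
Qed.

(** With coin weight [v = 2 * lam / n] the product [v * n] is constant, so the binomial bound is
    uniform in [n] and survives the limit. *)
Lemma poisson_smooth l (lam : R) : 0 < lam ->
  l1le (act (D ^+ (2 * l)) (@poisson_int R lam)) ((8 * l%:R * l.+1%:R / lam) ^+ l).
Proof.
move=> l0.
have H j : coefz (binpoly lam n.+1) j @[n --> \oo] --> poisson_int lam j.
  rewrite /coefz /poisson_int; case: ifP => _; last exact: cvg_cst.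
  exact: cvg_coef_binpoly (ltW l0).
apply: (@l1le_lim (fun n => act (D ^+ (2 * l)) (coefz (binpoly lam n.+1)))).
  exact: cvg_act.
near=> n.
have v01 : 0 <= 2 * lam / n.+1%:R <= 1.
  rewrite divr_ge0 ?mulr_ge0 ?(ltW l0)//= ler_pdivrMr ?ltr0n// mul1r.
  rewrite ltW// (@lt_le_trans _ _ (Num.bound (2 * lam))%:R) ?archi_boundP ?mulr_ge0 ?(ltW l0)//.
  by rewrite ler_nat leqW//; near: n; exact: nbhs_infty_ge.
have v0 : 0 < 2 * lam / n.+1%:R by rewrite divr_gt0 ?mulr_gt0.
apply: (@l1le_ext _ (fun j => coefz (D ^+ (2 * l) * binpoly lam n.+1) (j + (2 * l)%N%:Z))).
  by move=> j; rewrite act_DX_coefz [(-1) ^+ (2 * l)]exprM sqrrN !expr1n mul1r.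
apply: l1le_shift; apply: l1le_coefz.
rewrite binpolyE.
have := @pnorm_bernoulli R l _ n.+1 0 v01; rewrite expr0 mulr1 => /le_trans; apply.
apply: (le_trans (smooth_rate_le _ _ v0 _)) => //.
have -> : 2 * lam / n.+1%:R * n.+1%:R = 2 * lam by rewrite mulfVK// pnatr_eq0.
apply: lerXn2r; rewrite ?nnegrE ?divr_ge0 ?mulr_ge0 ?(ltW l0)//.
by rewrite ler_wpM2l ?mulr_ge0// lef_pV2 ?posrE ?mulr_gt0//; lra.
Unshelve. all: by end_near. Qed.

End PoissonSmooth.

(** * Convolution of laws on the integers *)

Section IntSums.
Context {R : realType}.
Local Open Scope ereal_scope.
Implicit Types (a b g : int -> \bar R).

(** An enumeration of the integers, even numbers giving the nonnegative ones; sums over [int] become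
    series, which can be exchanged with integrals. *)
Definition int_of_nat (n : nat) : int := if odd n then Negz n./2 else Posz n./2.

Lemma int_of_nat_bij : set_bij [set: nat] [set: int] int_of_nat.
Proof.
split=> //.
- move=> m n _ _; rewrite /int_of_nat.
  move: (odd_double_half m) (odd_double_half n).
  case: (odd m); case: (odd n) => //= hm hn [h]; by rewrite -hm -hn h.
- move=> [k|k] _; [exists k.*2|exists k.*2.+1] => //; rewrite /int_of_nat/=.
    by rewrite odd_double doubleK.
  by rewrite odd_double/= uphalf_double.
Qed.

Lemma esum_int_series a : (forall z, 0 <= a z) ->
  \esum_(z in [set: int]) a z = \sum_(n <oo) a (int_of_nat n).
Proof.
by move=> a0; rewrite (@reindex_esum R _ _ _ _ _ a int_of_nat_bij)// nneseries_esumT.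
Qed.

Lemma esum_shift a (k : int) :
  \esum_(z in [set: int]) a (z + k)%R = \esum_(z in [set: int]) a z.
Proof.
rewrite [RHS](@reindex_esum _ _ _ [set: int] [set: int] (fun z => z + k)%R)//.
split=> //; first by move=> x y _ _ /addIr.
by move=> z _; exists (z - k)%R => //; rewrite subrK.
Qed.

Lemma esumZl a (c : R) : (0 <= c)%R -> (forall z, 0 <= a z) ->
  \esum_(z in [set: int]) (c%:E * a z) = c%:E * \esum_(z in [set: int]) a z.
Proof.
move=> c0 a0; rewrite !esum_int_series//; last by move=> z; exact: mule_ge0.
by rewrite nneseriesZl.
Qed.

Lemma esum_swap (a : int -> int -> \bar R) : (forall x y, 0 <= a x y) ->
  \esum_(x in [set: int]) \esum_(y in [set: int]) a x y =
  \esum_(y in [set: int]) \esum_(x in [set: int]) a x y.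
Proof.
move=> a0; rewrite !esum_esum//.
rewrite (@reindex_esum _ _ _ ([set: int] `*`` fun=> [set: int]) ([set: int] `*`` fun=> [set: int]) (fun x => (x.2, x.1)))//.
split=> //=; first by move=> -[x1 x2] [y1 y2] _ _ /= [-> ->].
by move=> [x y] _; exists (y, x).
Qed.

Lemma esum_ub a z : (forall z, 0 <= a z) -> a z <= \esum_(z in [set: int]) a z.
Proof.
move=> a0; apply: esum_ge; exists [set z]; first by split.
by rewrite fsbig_set1.
Qed.

Lemma l1leP (f : int -> R) (c : R) :
  l1le f c <-> norm1 f <= c%:E.
Proof.
split=> [fc|fc s us].
  apply: ge_ereal_sup => _ [A [finA _] <-]; rewrite fsbig_finite//=.
  by rewrite sumEFin lee_fin fc// finmap.fset_uniq.
rewrite -lee_fin -sumEFin (le_trans _ fc)//; apply: esum_ge.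
exists [set` s]; first by split => //; exact: finite_seq.
by rewrite fsbig_seq.
Qed.

Lemma l1le_fine g : (forall z, 0 <= g z) -> \esum_(z in [set: int]) g z < +oo ->
  l1le (fine \o g) (fine (\esum_(z in [set: int]) g z)).
Proof.
move=> g0 goo; apply/l1leP.
have g0' : 0 <= \esum_(z in [set: int]) g z by exact: esum_ge0.
rewrite fineK; last by rewrite ge0_fin_numE.
apply: le_esum => z _ /=; rewrite ger0_norm ?fine_ge0// fineK// ge0_fin_numE//.
exact: le_lt_trans (esum_ub z g0) goo.
Qed.

End IntSums.

Section Convolution.
Context {R : realType}.
Local Open Scope ereal_scope.
Implicit Types (g h : int -> \bar R) (q r p : int -> R).

Definition mass g := \esum_(z in [set: int]) g z.

(** The accumulated factor [g] takes extended real values, so iterated convolutions are formed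
    without finiteness side conditions. *)
Definition zconv g q : int -> \bar R :=
  fun j => \esum_(z in [set: int]) (g (j - z)%R * (q z)%:E).

Definition nneg g := forall j, 0 <= g j.

Lemma zconv_ge0 g q : nneg g -> nneg (EFin \o q) -> nneg (zconv g q).
Proof. by move=> g0 q0 j; apply: esum_ge0 => z _; exact: mule_ge0 (q0 z). Qed.

Lemma mass_zconv g q (G : R) : nneg g -> nneg (EFin \o q) -> mass g = G%:E ->
  mass (zconv g q) = G%:E * mass (EFin \o q).
Proof.
move=> g0 q0 gG; rewrite /mass /zconv esum_swap; last first.
  by move=> x y; exact: mule_ge0 (q0 y).
rewrite -esumZl//; last by rewrite -lee_fin -gG; exact: esum_ge0.
apply: eq_esum => z _ /=.
under eq_esum do rewrite muleC.
rewrite esumZl//; last by rewrite -lee_fin; exact: q0.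
by rewrite muleC (esum_shift g (- z)%R) -gG.
Qed.

Lemma zconvDr g q r : nneg g -> nneg (EFin \o q) -> nneg (EFin \o r) ->
  zconv g (fun z => q z + r z)%R = (fun j => zconv g q j + zconv g r j).
Proof.
move=> g0 q0 r0; apply/funext => j; rewrite /zconv -esumD; last 2 first.
- by move=> z _; exact: mule_ge0 (q0 z).
- by move=> z _; exact: mule_ge0 (r0 z).
by apply: eq_esum => z _; rewrite EFinD ge0_muleDr//; [exact: q0|exact: r0].
Qed.

Lemma zconvDl g h q : nneg g -> nneg h -> nneg (EFin \o q) ->
  zconv (fun j => g j + h j) q = (fun j => zconv g q j + zconv h q j).
Proof.
move=> g0 h0 q0; apply/funext => j; rewrite /zconv -esumD; last 2 first.
- by move=> z _; exact: mule_ge0 (q0 z).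
- by move=> z _; exact: mule_ge0 (q0 z).
by apply: eq_esum => z _; rewrite ge0_muleDl.
Qed.

Lemma zconv_shiftl g q (k : int) :
  zconv (fun j => g (j + k)%R) q = (fun j => zconv g q (j + k)%R).
Proof. by apply/funext => j; apply: eq_esum => z _; rewrite addrAC. Qed.

Lemma zconv_shiftr g q (k : int) :
  zconv g (fun z => q (z + k)%R) = (fun j => zconv g q (j + k)%R).
Proof.
apply/funext => j; rewrite /zconv.
rewrite -[RHS](esum_shift _ k); apply: eq_esum => z _.
by rewrite opprD addrACA subrr addr0.
Qed.

Definition chain g (ps : seq (int -> R)) := foldl zconv g ps.

Definition all_nneg (ps : seq (int -> R)) := forall i, (i < size ps)%N ->
  nneg (EFin \o nth (fun=> 0%R) ps i).

Lemma all_nneg_cons p ps : all_nneg (p :: ps) -> nneg (EFin \o p) /\ all_nneg ps.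
Proof. by move=> H; split; [exact: (H 0%N)|move=> i ip; exact: (H i.+1)]. Qed.

Lemma chain_ge0 g ps : nneg g -> all_nneg ps -> nneg (chain g ps).
Proof.
elim: ps g => //= p ps IH g g0 /all_nneg_cons[p0 ps0].
by apply: IH => //; exact: zconv_ge0.
Qed.

Lemma chainD g h ps : nneg g -> nneg h -> all_nneg ps ->
  chain (fun j => g j + h j) ps = (fun j => chain g ps j + chain h ps j).
Proof.
elim: ps g h => //= p ps IH g h g0 h0 /all_nneg_cons[p0 ps0].
by rewrite zconvDl// IH//; exact: zconv_ge0.
Qed.

Lemma chain_shift g ps (k : int) :
  chain (fun j => g (j + k)%R) ps = (fun j => chain g ps (j + k)%R).
Proof. by elim: ps g => //= p ps IH g; rewrite zconv_shiftl IH. Qed.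

Lemma mass_chain g ps (G : R) : nneg g -> all_nneg ps -> mass g = G%:E ->
  (forall i, (i < size ps)%N -> mass (EFin \o nth (fun=> 0%R) ps i) = 1) ->
  mass (chain g ps) = G%:E.
Proof.
elim: ps g => //= p ps IH g g0 /all_nneg_cons[p0 ps0] gG p1.
apply: IH => //; first exact: zconv_ge0.
  by rewrite (mass_zconv _ _ gG)// (p1 0%N)// mule1.
by move=> i ip; exact: (p1 i.+1).
Qed.

(** With weight [v] the law is that of an integer variable plus an independent fair coin with values
    in [{-1, 0}]; [r] is the rest. In operator form the coin part is [2 * act halfB m]. *)
Definition splits (v : R) p := exists m r : int -> R,
  [/\ nneg (EFin \o m), nneg (EFin \o r), mass (EFin \o m) = (v / 2)%:E,
      mass (EFin \o r) = (1 - v)%:E &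
      p = (fun j => m j + m (j + 1) + r j)%R].

Local Notation D := ('X - 1 : {poly R})%R.

(** The induction of [pnorm_bernoulli], now for convolutions: each factor either supplies a coin
    ([s] grows by one, twice mass [v / 2]) or falls into the rest (mass [1 - v]). Shifts commute
    with the remaining convolutions, so collected coins can be moved to the polynomial side, and
    [smooth_rate_step] closes the recursion. *)
Lemma chain_smooth (v G : R) l ps g s : (0 <= v <= 1)%R ->
  nneg g -> all_nneg ps -> mass g = G%:E ->
  (forall i, (i < size ps)%N -> mass (EFin \o nth (fun=> 0%R) ps i) = 1) ->
  (forall i, (i < size ps)%N -> splits v (nth (fun=> 0%R) ps i)) ->
  l1le (act (D ^+ (2 * l) * halfB ^+ s) (fine \o chain g ps))
       (smooth_rate l v (size ps) s * G)%R.
Proof.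
move=> v01; elim: ps g s G => [|p ps IH] g s G g0 ps0 gG ps1 psv.
  rewrite /= -smooth_rate0; apply: l1le_act; first exact: pnorm_DnB.
  have := @l1le_fine R g g0; rewrite -/(mass g) gG => /(_ (ltry _)).
  exact.
have [p0 ps0'] := all_nneg_cons ps0.
have [m [r [m0 r0 mt rt pE]]] := psv 0%N isT.
have ps1' i : (i < size ps)%N -> mass (EFin \o nth (fun=> 0%R) ps i) = 1.
  by move=> ip; exact: (ps1 i.+1).
have psv' i : (i < size ps)%N -> splits v (nth (fun=> 0%R) ps i).
  by move=> ip; exact: (psv i.+1).
have m0' : nneg (EFin \o (fun z => m (z + 1)%R)) by move=> z; exact: m0.
have mm0 : nneg (EFin \o (fun z => m z + m (z + 1))%R).
  by move=> z; rewrite /= EFinD adde_ge0//; [exact: m0|exact: (m0 (z + 1)%R)].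
have gm0 : nneg (zconv g m) by exact: zconv_ge0.
have gr0 : nneg (zconv g r) by exact: zconv_ge0.
have tm : mass (zconv g m) = (G * (v / 2))%:E by rewrite (mass_zconv _ _ gG)// mt.
have tr : mass (zconv g r) = (G * (1 - v))%:E by rewrite (mass_zconv _ _ gG)// rt.
have fin h : nneg h -> forall c : R, mass h = c%:E -> forall j, chain h ps j \is a fin_num.
  move=> h0 c hc j; rewrite ge0_fin_numE; last exact: chain_ge0.
  apply: (@le_lt_trans _ _ (mass (chain h ps))); first exact/esum_ub/chain_ge0.
  by rewrite (mass_chain _ _ hc)// ltry.
set c1 := fine \o chain (zconv g m) ps; set c2 := fine \o chain (zconv g r) ps.
have E j : (fine \o chain g (p :: ps)) j = (2 * act halfB c1 j + c2 j)%R.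
  rewrite /= -[p]/(nth (fun=> 0%R) (p :: ps) 0) pE zconvDr// zconvDr// zconv_shiftr.
  rewrite chainD//; last first.
    by move=> z; exact: adde_ge0.
  rewrite chainD//.
  rewrite chain_shift fineD; last 2 first.
  - by rewrite fin_numD !(fin _ gm0 _ tm).
  - exact: fin gr0 _ tr _.
  rewrite fineD ?(fin _ gm0 _ tm)// /halfB actZ actD actX act1 mulrA divff// mul1r.
  by rewrite addrC [in RHS]addrC [(_ + c1 j)%R]addrC.
apply: (@l1le_ext _ (fun j => 2 * act (D ^+ (2 * l) * halfB ^+ s.+1) c1 j +
    act (D ^+ (2 * l) * halfB ^+ s) c2 j)%R).
  move=> j; rewrite (eq_act _ E) act_fD act_fZ exprSr mulrA; congr (2 * _ + _)%R.
  by rewrite actM.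
have H1 := IH (zconv g m) s.+1 _ gm0 ps0' tm ps1' psv'.
have H2 := IH (zconv g r) s _ gr0 ps0' tr ps1' psv'.
have G0 : (0 <= G)%R by rewrite -lee_fin -gG; exact: esum_ge0.
apply: (l1le_le (l1leD (l1leZ 2 H1) H2)).
have := ler_wpM2r G0 (smooth_rate_step l (size ps) s v01).
rewrite /= ger0_norm// => H; rewrite (le_trans _ H)// le_eqVlt; apply/orP; left.
by apply/eqP; field.
Qed.

Lemma pmf_fin_num p (A : set int) : is_pmf p -> \esum_(i in A) (p i)%:E \is a fin_num.
Proof.
move=> [p0 p1].
rewrite ge0_fin_numE; last by apply: esum_ge0 => z _; rewrite lee_fin.
apply: (@le_lt_trans _ _ 1); last exact: ltry.
rewrite -p1 esum_mkcond; apply: le_esum => z _; case: ifP => // _.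
by rewrite lee_fin.
Qed.

Lemma Dif_cdf_pmf p j : is_pmf p -> Dif (cdf_pmf p) j = p (j + 1)%R.
Proof.
move=> pp; have [p0 p1] := pp; have fin := pmf_fin_num _ pp.
rewrite /Dif /cdf_pmf.
rewrite (esumID [set j + 1]%R [set i | i <= j + 1]%R); last first.
  by move=> i _; rewrite lee_fin.
have -> : [set i | i <= j + 1]%R `&` [set (j + 1)%R] = [set (j + 1)%R].
  by apply/seteqP; split => [i []//|i /= ->].
have -> : [set i | i <= j + 1]%R `&` ~` [set (j + 1)%R] = [set i | i <= j]%R.
  apply/seteqP; split => [i /= [h1 /eqP h2]|i /= h].
    by move: h1 h2; lia.
  by split; [lia|apply/eqP; lia].
by rewrite esum_set1 ?lee_fin// -(fineK (fin [set i | i <= j]%R)) -EFinD /= addrK.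
Qed.

Lemma D1E p : is_pmf p ->
  D1 p = \esum_(j in [set: int]) (`|p (j + 1) - p j|)%:E.
Proof.
move=> pp.
rewrite /D1 /norm1 -[RHS](esum_shift _ 1); apply: eq_esum => j _.
by rewrite -!(Dif_cdf_pmf _ pp).
Qed.

(** The overlap [min (p j) (p (j - 1))] has mass [1 - D1 p / 2], since a minimum is half of the sum
    minus half of the absolute difference. A rescaled overlap serves as [m]. *)
Lemma pmf_splits p (u : R) : is_pmf p -> (0 < u)%R ->
  u%:E <= 1 - (2^-1)%:E * D1 p -> splits (Num.min u 1)%R p.
Proof.
move=> pp u0; have [p0 p1] := pp; rewrite (D1E pp) => uD.
pose mn j : R := Num.min (p j) (p (j - 1)%R).
have mn0 j : (0 <= mn j)%R by rewrite le_min !p0.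
set S := \esum_(j in _) _ in uD.
have S0 : 0 <= S by apply: esum_ge0 => j _; rewrite lee_fin.
have E : mass (EFin \o mn) + (2^-1)%:E * S = 1.
  rewrite /S -(esum_shift _ (-1)%R) -esumZl//.
  rewrite /mass -esumD; last 2 first.
  - by move=> z _; rewrite lee_fin.
  - by move=> z _; rewrite lee_fin.
  pose h z : \bar R := (2^-1 * p z)%:E.
  have h0 z : 0 <= h z by rewrite lee_fin mulr_ge0.
  have hz : \esum_(z in [set: int]) h z = (2^-1)%:E.
    rewrite /h; under eq_esum do rewrite EFinM.
    by rewrite esumZl ?p1 ?mule1// => z; rewrite lee_fin.
  transitivity (\esum_(z in [set: int]) (h z + h (z - 1)%R)).
    apply: eq_esum => z _ /=; rewrite /h -EFinM -!EFinD subrK; congr (_%:E).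
    rewrite /mn; case: (leP (p z) (p (z - 1)%R)) => pz.
      by rewrite ler0_norm ?subr_le0//; field.
    by rewrite ger0_norm ?subr_ge0 1?ltW//; field.
  rewrite esumD// (esum_shift h) hz -EFinD; congr (_%:E); by field.
have Tfin : mass (EFin \o mn) \is a fin_num.
  rewrite ge0_fin_numE; last by apply: esum_ge0 => z _; rewrite lee_fin.
  apply: (@le_lt_trans _ _ 1); last exact: ltry.
  by rewrite -E leeDl// mule_ge0.
have Sfin : (2^-1)%:E * S \is a fin_num.
  rewrite ge0_fin_numE ?mule_ge0//.
  apply: (@le_lt_trans _ _ 1); last exact: ltry.
  by rewrite -E leeDr// esum_ge0// => z _; rewrite lee_fin.
move: uD E; rewrite -(fineK Tfin) -(fineK Sfin); set t := fine (mass _).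
set S' := fine _ => uD [E]; move: uD; rewrite -EFinB lee_fin => uD.
have ut : (u <= t)%R by lra.
have t0 : (0 < t)%R by lra.
set v := Num.min u 1%R.
have vu : (v <= u)%R by rewrite /v ge_min lexx.
have v1 : (v <= 1)%R by rewrite /v ge_min lexx orbT.
have v0 : (0 < v)%R by rewrite /v lt_min u0 ltr01.
(* Rescales the overlap to mass exactly [v / 2]. As [v <= u <= t], the factor is at most one half,
   so [m j + m (j + 1)] stays below [p j]. *)
pose c := (v / 2 / t)%R.
have c0 : (0 <= c)%R by rewrite !divr_ge0// ltW.
have c2 : (c <= 2^-1)%R.
  by rewrite /c ler_pdivrMr// mulrC ler_wpM2l//; lra.
pose m j := (c * mn j)%R.
have m0 : nneg (EFin \o m) by move=> j; rewrite lee_fin mulr_ge0.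
have mt : mass (EFin \o m) = (v / 2)%:E.
  rewrite /mass /m/=; under eq_esum do rewrite EFinM.
  rewrite esumZl ?lee_fin//.
  rewrite -/(mass (EFin \o mn)) -(fineK Tfin) -/t -EFinM; congr (_%:E).
  by rewrite /c divfK// gt_eqF.
pose r j := (p j - (m j + m (j + 1)))%R.
have r0 : nneg (EFin \o r).
  move=> j; rewrite lee_fin subr_ge0 /m.
  have h1 : (mn j <= p j)%R by rewrite /mn ge_min lexx.
  have h2 : (mn (j + 1) <= p j)%R by rewrite /mn addrK ge_min lexx orbT.
  have := ler_pM c0 (mn0 j) c2 h1; have := ler_pM c0 (mn0 (j + 1)%R) c2 h2; lra.
exists m, r; split => //; last by apply/funext => j; rewrite /r addrC subrK.
have : mass (EFin \o r) + ((v / 2)%:E + (v / 2)%:E) = 1.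
  have -> : (v / 2)%:E + (v / 2)%:E =
      mass (EFin \o m) + \esum_(z in [set: int]) (EFin \o m) (z + 1)%R.
    by rewrite (esum_shift (EFin \o m) 1) -/(mass _) mt.
  rewrite /mass -!esumD//.
    by rewrite -p1; apply: eq_esum => z _; rewrite /= -!EFinD /r subrK.
  by move=> z _; apply: adde_ge0; exact: m0.
rewrite -EFinD -splitr => H.
have : mass (EFin \o r) = 1 - v%:E by rewrite -H addeK.
by rewrite -EFinB.
Qed.

End Convolution.

(** * Random sums *)

Section RandomSum.
Context {d : measure_display} {T : measurableType d} {R : realType}.
Variable P : probability T R.
Variables (N : T -> nat) (Y : T -> int) (Z : nat -> T -> int) (W : T -> int).
Variables (kY : T -> int -> R) (kZ : nat -> T -> int -> R).
Hypothesis mN : forall n, measurable [set w | N w = n].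
Hypothesis mY : int_rv Y.
Hypothesis mW : int_rv W.
Hypothesis mZ : forall i, int_rv (Z i).
Hypothesis pY : forall w, is_pmf (kY w).
Hypothesis pZ : forall i w, is_pmf (kZ i w).
Hypothesis mkY : forall j, measurable_fun setT (fun w => kY w j).
Hypothesis mkZ : forall i j, measurable_fun setT (fun w => kZ i w j).
Hypothesis WE : forall w, W w = (Y w + \sum_(1 <= i < (N w).+1) Z i w)%R.
Hypothesis joint : forall (n : nat) (y : int) (z : nat -> int),
  P [set w | N w = n /\ Y w = y /\ forall i, (1 <= i <= n)%N -> Z i w = z i] =
  (\int[P]_(w in [set w | N w = n])
    (kY w y * \prod_(1 <= i < n.+1) kZ i w (z i))%:E)%E.

(** Built from the kernels alone, this is the candidate for the conditional mass function of
    [Y + Z_1 + ... + Z_i]. *)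
Definition cond_chain i w := chain (EFin \o kY w) [seq kZ l w | l <- iota 1 i].

Lemma cond_chainS i w : cond_chain i.+1 w = zconv (cond_chain i w) (kZ i.+1 w).
Proof.
by rewrite /cond_chain -(addn1 i) iotaD map_cat /chain foldl_cat/= ?add1n ?addn1.
Qed.

Lemma cond_chain_all_nneg i w : all_nneg [seq kZ l w | l <- iota 1 i].
Proof.
move=> l; rewrite size_map size_iota => li z.
rewrite (nth_map 0%N) ?size_iota// lee_fin; exact: (pZ _ _).1.
Qed.

Lemma cond_chain_ge0 i w j : (0 <= cond_chain i w j)%E.
Proof.
apply: chain_ge0; last exact: cond_chain_all_nneg.
by move=> z; rewrite lee_fin; exact: (pY _).1.
Qed.

Lemma cond_chain_mass i w : mass (cond_chain i w) = 1%E.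
Proof.
apply: mass_chain.
- by move=> z; rewrite lee_fin; exact: (pY _).1.
- exact: cond_chain_all_nneg.
- exact: (pY w).2.
- move=> l; rewrite size_map size_iota => li.
  by rewrite (nth_map 0%N) ?size_iota//; exact: (pZ _ _).2.
Qed.

Lemma cond_chain_le1 i w j : (cond_chain i w j <= 1)%E.
Proof.
rewrite -(cond_chain_mass i w) /mass.
by apply: esum_ub => z; exact: cond_chain_ge0.
Qed.

Lemma measurable_cond_chain i j : measurable_fun setT (fun w => cond_chain i w j).
Proof.
elim: i j => [|i IH] j; first by apply/measurable_EFinP; exact: mkY.
pose h m w := (cond_chain i w (j - int_of_nat m) * (kZ i.+1 w (int_of_nat m))%:E)%E.
have h0 m w : (0 <= h m w)%E.
  rewrite mule_ge0 ?cond_chain_ge0// lee_fin; exact: (pZ _ _).1.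
rewrite (_ : (fun w => cond_chain i.+1 w j) =
    (fun w => \sum_(m <oo | m \in xpredT) h m w)%E); last first.
  apply/funext => w; rewrite cond_chainS /zconv esum_int_series// => z.
  rewrite mule_ge0 ?cond_chain_ge0// lee_fin; exact: (pZ _ _).1.
apply: ge0_emeasurable_sum => // m _; apply: emeasurable_funM; first exact: IH.
by apply/measurable_EFinP; exact: mkZ.
Qed.

Section FixedN.
Variable n : nat.

(** Interpolates between the event of the hypothesis [joint] ([i = 0], all values prescribed) and
    the event [N = n], [W = j] ([i = n], only the sum prescribed). *)
Let B i (j : int) (z : nat -> int) := [set w | N w = n /\
  (Y w + \sum_(1 <= l < i.+1) Z l w)%R = j /\
  forall l, (i < l <= n)%N -> Z l w = z l].

Let upd (z : nat -> int) (a : nat) (t : int) := fun l => if l == a then t else z l.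

Let B_bigcup i j z : (i < n)%N ->
  B i.+1 j z = \bigcup_m B i (j - int_of_nat m) (upd z i.+1 (int_of_nat m)).
Proof.
move=> in_; apply/seteqP; split => w.
  move=> [Nw [Sw Zw]].
  have [_ _ surj] := int_of_nat_bij.
  have [m _ mZ'] := surj (Z i.+1 w) I.
  exists m => //; split => //; split.
    by rewrite -Sw mZ' [in RHS]big_nat_recr//= addrA addrK.
  move=> l; rewrite /upd; case: eqP => [-> _|/eqP li /andP[il ln]]; first by rewrite mZ'.
  by apply: Zw; rewrite ln andbT; lia.
move=> [m _ [Nw [Sw Zw]]].
have Zi : Z i.+1 w = int_of_nat m by rewrite Zw ?ltnSn// /upd eqxx.
split => //; split; first by rewrite big_nat_recr//= Zi addrA Sw subrK.
move=> l /andP[il ln]; rewrite Zw ?ln ?andbT; last by lia.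
by rewrite /upd; case: eqP => // li; move: il; rewrite li ltnn.
Qed.

Let mB i j z : (i <= n)%N -> measurable (B i j z).
Proof.
elim: i j z => [|i IH] j z in_; last first.
  rewrite B_bigcup//; apply: bigcupT_measurable => m; apply: IH; exact: ltnW.
rewrite /B; have -> : [set w | N w = n /\
    (Y w + \sum_(1 <= l < 1) Z l w)%R = j /\
    forall l, (0 < l <= n)%N -> Z l w = z l] =
  [set w | N w = n] `&` ([set w | Y w = j] `&`
    \bigcap_(l in [set l | (0 < l <= n)%N]) [set w | Z l w = z l]).
  by apply/seteqP; split => w /=; rewrite big_geq// addr0.
apply: measurableI => //; apply: measurableI; first exact: mY.
by apply: bigcap_measurableType => l _; exact: mZ.
Qed.

(** Summing over the values of [Z i.+1] converts one factor of the conditional product into one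
    convolution. Monotone convergence exchanges the sum with the integral. *)
Let prob_B i j z : (i <= n)%N -> P (B i j z) =
  (\int[P]_(w in [set w | N w = n])
    (cond_chain i w j * (\prod_(i.+1 <= l < n.+1) kZ l w (z l))%:E))%E.
Proof.
elim: i j z => [|i IH] j z in_.
  transitivity (P [set w | N w = n /\ Y w = j /\
      forall i, (1 <= i <= n)%N -> Z i w = z i]).
    by rewrite /B; congr (P _); apply/seteqP; split => w /=; rewrite big_geq// addr0.
  by rewrite joint; apply: eq_integral => w _; rewrite EFinM.
rewrite B_bigcup// measure_semi_bigcup; first last.
- by apply: bigcupT_measurable => m; apply: mB; exact: ltnW.
- apply/trivIsetP => m1 m2 _ _ /eqP m12; apply/seteqP; split => // w [[_ [_ h1]] [_ [_ h2]]].
  apply: m12; have [_ inj _] := int_of_nat_bij.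
  apply: inj; rewrite ?inE//.
  have := h1 i.+1; have := h2 i.+1; rewrite /upd eqxx ltnSn in_/=.
  by move=> <-// <-.
- by move=> m; apply: mB; exact: ltnW.
transitivity (\sum_(m <oo) \int[P]_(w in [set w | N w = n])
    (cond_chain i w (j - int_of_nat m) *
     (\prod_(i.+1 <= l < n.+1) kZ l w (upd z i.+1 (int_of_nat m) l))%:E))%E.
  by apply: eq_eseriesr => m _; exact: IH (ltnW in_).
rewrite -integral_nneseries//; last 2 first.
- move=> m; apply: measurable_funTS; apply: emeasurable_funM.
    exact: measurable_cond_chain.
  by apply/measurable_EFinP; apply: measurable_prod => l _; exact: mkZ.
- move=> m w _; rewrite mule_ge0 ?cond_chain_ge0// lee_fin prodr_ge0// => l _.
  exact: (pZ _ _).1.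
apply: eq_integral => w _.
rewrite cond_chainS /zconv esum_int_series; last first.
  move=> t; rewrite mule_ge0 ?cond_chain_ge0// lee_fin; exact: (pZ _ _).1.
set c := (\prod_(i.+2 <= l < n.+1) kZ l w (z l))%R.
rewrite muleC -nneseriesZl; last first.
  move=> m _; rewrite mule_ge0 ?cond_chain_ge0// lee_fin; exact: (pZ _ _).1.
apply: eq_eseriesr => m _.
rewrite big_ltn// /upd eqxx.
have -> : (\prod_(i.+2 <= l < n.+1) kZ l w (if l == i.+1 then int_of_nat m else z l))%R = c.
  by apply: eq_big_nat => l /andP[il _]; case: eqP => // li; move: il; rewrite li ltnn.
by rewrite EFinM muleA muleC.
Qed.

Let NW_B j : [set w | N w = n /\ W w = j] = B n j (fun=> 0).
Proof.
apply/seteqP; split => w; rewrite /B /= WE.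
move=> [Nw]; rewrite Nw => Sw; split => //; split => // l /andP[h1 h2].
by move: (leq_trans h1 h2); rewrite ltnn.
by move=> [Nw [Sw _]]; rewrite Nw.
Qed.

Lemma measurable_NW j : measurable [set w | N w = n /\ W w = j].
Proof.
by rewrite NW_B; exact: mB.
Qed.

Lemma prob_NW j : P [set w | N w = n /\ W w = j] =
  (\int[P]_(w in [set w | N w = n]) cond_chain n w j)%E.
Proof.
by rewrite NW_B prob_B//; apply: eq_integral => w _; rewrite big_geq// mule1.
Qed.

End FixedN.

Variable Q : pred nat.
Let A := [set w | Q (N w)].
Let Fn n := if Q n then [set w | N w = n] else set0.

Let A_bigcup : A = \bigcup_n Fn n.
Proof.
apply/seteqP; split => w /=.
  by move=> Qw; exists (N w) => //; rewrite /Fn Qw.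
by move=> [n _]; rewrite /Fn; case: ifP => // Qn /= Nw; rewrite /A /= Nw.
Qed.

Let mFn n : measurable (Fn n).
Proof. by rewrite /Fn; case: ifP. Qed.

Lemma measurable_A : measurable A.
Proof. by rewrite A_bigcup; exact: bigcupT_measurable. Qed.

Let tFn : trivIset setT Fn.
Proof.
apply/trivIsetP => m n _ _ /eqP mn; apply/seteqP; split => // w [].
rewrite /Fn; case: ifP => // _; case: ifP => // _ /= h1 h2.
by apply: mn; rewrite -h1.
Qed.

Let mcN j : measurable_fun A (fun w => cond_chain (N w) w j).
Proof.
rewrite A_bigcup; apply/measurable_fun_bigcup => // n.
rewrite /Fn; case: ifP => _; last exact: measurable_fun_set0.
apply: (@eq_measurable_fun _ _ _ _ _ (fun w => cond_chain n w j)).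
  by move=> w; rewrite inE /= => ->.
by apply: measurable_funTS; exact: measurable_cond_chain.
Qed.

Lemma prob_QW j : P [set w | Q (N w) /\ W w = j] =
  (\int[P]_(w in A) cond_chain (N w) w j)%E.
Proof.
rewrite A_bigcup ge0_integral_bigcup//; last 2 first.
- by rewrite -A_bigcup.
- by move=> w _; exact: cond_chain_ge0.
have -> : [set w | Q (N w) /\ W w = j] = \bigcup_n (Fn n `&` [set w | W w = j]).
  rewrite -setI_bigcupl -A_bigcup; apply/seteqP; split => w //=.
have E n : Fn n `&` [set w | W w = j] =
    if Q n then [set w | N w = n /\ W w = j] else set0.
  by rewrite /Fn; case: ifP => // _; rewrite set0I.
have mE n : measurable (Fn n `&` [set w | W w = j]).
  by rewrite E; case: ifP => // _; exact: measurable_NW.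
rewrite measure_semi_bigcup//.
- apply: eq_eseriesr => n _; rewrite E /Fn; case: ifP => _.
    transitivity (\int[P]_(w in [set w | N w = n]) cond_chain n w j)%E.
      exact: prob_NW.
    by apply: eq_integral => w; rewrite inE /= => ->.
  by rewrite measure0 integral_set0.
- apply/trivIsetP => m n _ _ mn.
  have /trivIsetP/(_ m n I I mn) := tFn => h.
  by rewrite setIACA h set0I.
- exact: bigcupT_measurable.
Qed.

Let f w j := fine (cond_chain (N w) w j).
Let p1 j := fine (P [set w | Q (N w) /\ W w = j]).

Let fin_c i w j : cond_chain i w j \is a fin_num.
Proof.
rewrite ge0_fin_numE ?cond_chain_ge0//.
by rewrite (le_lt_trans (cond_chain_le1 i w j))// ltry.
Qed.

Let mf j : measurable_fun A (EFin \o f ^~ j).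
Proof.
apply: (@eq_measurable_fun _ _ _ _ _ (fun w => cond_chain (N w) w j)) => //.
by move=> w _; rewrite /= /f fineK.
Qed.

Let PA : (P A <= 1)%E. Proof. exact: probability_le1 measurable_A. Qed.

Let intf j : P.-integrable A (EFin \o f ^~ j).
Proof.
apply: (@le_integrable _ _ _ P A measurable_A _ (EFin \o cst 1)) => //.
  move=> w _ /=; rewrite lee_fin normr1 ger0_norm; last first.
    by rewrite fine_ge0// cond_chain_ge0.
  by rewrite -lee_fin fineK// cond_chain_le1.
apply: finite_measure_integrable_cst; exact: measurable_A.
Qed.

Let act_int (p : {poly R}) j :
  P.-integrable A (EFin \o (fun w => act p (f w) j)) /\
  (\int[P]_(w in A) (act p (f w) j)%:E)%E = (act p p1 j)%:E.
Proof.
elim/poly_ind: p j => [|p c IH] j.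
  split.
    rewrite (_ : _ \o _ = cst 0%E); first exact: integrable0.
    by apply/funext => w /=; rewrite act0.
  by rewrite act0; under eq_integral do rewrite act0; rewrite integral0.
have [IH1 IH2] := IH (j + 1).
have int2 : P.-integrable A (fun w => (c%:E * (f w j)%:E)%E).
  by apply: integrableZl; [exact: measurable_A|exact: intf].
have E : EFin \o (fun w => act (p * 'X + c%:P) (f w) j) =
    (fun w => (act p (f w) (j + 1))%:E + c%:E * (f w j)%:E)%E.
  by apply/funext => w /=; rewrite act_cons EFinD EFinM.
split; first by rewrite E; apply: integrableD => //; exact: measurable_A.
under eq_integral do rewrite act_cons EFinD EFinM.
rewrite integralD//; last exact: measurable_A.
rewrite IH2 integralZl; [|exact: measurable_A|exact: intf].
rewrite act_cons EFinD EFinM; congr (_ + _ * _)%E.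
rewrite /p1 fineK; last first.
  by apply: fin_num_measure; exact: (measurableI _ _ measurable_A (mW j)).
rewrite prob_QW; apply: eq_integral => w _; by rewrite /f fineK.
Qed.

(** On [A] the mass function of [W] is an integral of conditional mass functions, and [act p] is
    linear, so a bound holding almost surely survives integration over a set of probability at most
    1. *)
Lemma l1le_prob_QW (p : {poly R}) (K : R) : 0 <= K ->
  {ae P, forall w, Q (N w) -> l1le (act p (f w)) K} ->
  l1le (act p p1) K.
Proof.
move=> K0 ae s us; rewrite -lee_fin -sumEFin.
apply: (@le_trans _ _ (\sum_(j <- s) \int[P]_(w in A) (`|act p (f w) j|)%:E)%E).
  apply: lee_sum => j _; have [i1 i2] := act_int p j.
  rewrite -abse_EFin -i2; apply: le_abse_integral; first exact: measurable_A.
  by case/integrableP: i1.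
have mact j : measurable_fun A (fun w => (`|act p (f w) j|)%:E).
  have [/integrableP[m1 _] _] := act_int p j.
  by apply/measurable_EFinP/measurableT_comp => //; apply/measurable_EFinP.
rewrite -ge0_integral_sum//; last exact: measurable_A.
apply: (@le_trans _ _ (\int[P]_(w in A) K%:E)%E).
  apply: ae_ge0_le_integral => //.
  - exact: measurable_A.
  - by move=> w _; rewrite sume_ge0.
  - exact: emeasurable_sum.
  - apply: filterS ae => w Kw Aw.
    by rewrite sumEFin lee_fin; apply: Kw.
rewrite integral_cst; last exact: measurable_A.
by rewrite -[leRHS]mule1 lee_wpmul2l.
Qed.

End RandomSum.

Lemma model_smooth {d : measure_display} {T : measurableType d} {R : realType}
    (P : probability T R) F N Y Z W (u beta k Ct sigma : R) (l : nat) :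
  0 < u -> 0 < beta -> 0 < sigma -> model_hyp P F N Y Z W u beta k Ct sigma ->
  l1le (act (('X - 1) ^+ (2 * l))
    (fun j => fine (P [set w | beta * sigma ^+ 2 <= (N w)%:R /\ W w = j])))
  ((8 * l%:R * l.+1%:R / (Num.min u 1 * (beta * sigma ^+ 2))) ^+ l).
Proof.
move=> u0 b0 s0 [[sF Fm] [FN [[mY [mZ mW]] [WE [[kY [kZ [cY cZ joint ae]]] _]]]]].
have mF (g : T -> R) : F_measurable_R F g -> measurable_fun setT g.
  by move=> mg _ B mB; rewrite setTI; exact/Fm/mg.
have [pY mkY _] := cY.
have pZ i w : is_pmf (kZ i w) by have [] := cZ i.
have mkZ i j : measurable_fun setT (fun w => kZ i w j) by have [_ /(_ j)/mF] := cZ i.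
have FT : F setT by have [h0 hC _] := sF; rewrite -(setD0 setT); exact: hC.
have bs0 : 0 < beta * sigma ^+ 2 by rewrite mulr_gt0// exprn_gt0.
(* The cap gives [v <= 1] without inspecting any summand. *)
set v := Num.min u 1.
have v0 : 0 < v by rewrite lt_min u0 ltr01.
have v01 : 0 <= v <= 1 by rewrite (ltW v0)/= ge_min lexx orbT.
apply: (@l1le_prob_QW _ _ _ P N Y Z W kY kZ _ mY mW mZ pY pZ _ mkZ WE _
    (fun n : nat => beta * sigma ^+ 2 <= n%:R)).
- by move=> n; exact/Fm/FN.
- by move=> j; exact: mF.
- by move=> n y z; have := joint setT n y z FT; rewrite !setTI.
- by rewrite exprn_ge0// divr_ge0// mulr_ge0 ?(ltW v0) ?(ltW bs0).
(* Countability of the indices yields a single null set for all summands. *)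
have : {ae P, forall w, forall i, (1 <= i)%N -> (i <= N w)%N ->
    (u%:E <= 1 - (2^-1)%:E * D1 (kZ i w))%E}.
  apply: ae_foralln => i; case: i => [|i]; first exact: aeW.
  by apply: filterS (ae i.+1 isT) => w.
apply: filterS => w uw bN.
have N0 : (0 < N w)%N by rewrite -(ltr0n R); exact: lt_le_trans bN.
have := @chain_smooth R v 1 l [seq kZ i w | i <- iota 1 (N w)] (EFin \o kY w) 0 v01.
rewrite expr0 mulr1 size_map size_iota mulr1 => H.
apply: l1le_le; first apply: H.
- by move=> z; rewrite lee_fin; exact: (pY w).1.
- exact: cond_chain_all_nneg.
- exact: (pY w).2.
- move=> i iN; rewrite (nth_map 0%N) ?size_iota//; exact: (pZ _ _).2.
- move=> i iN; rewrite (nth_map 0%N) ?size_iota// nth_iota//.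
  by apply: pmf_splits => //; apply: uw.
apply: (le_trans (smooth_rate_le _ _ v0 N0)).
have vb : 0 < v * (beta * sigma ^+ 2) by rewrite mulr_gt0.
have vN : 0 < v * (N w)%:R by rewrite mulr_gt0// ltr0n.
apply: lerXn2r; rewrite ?nnegrE ?divr_ge0 ?mulr_ge0 ?(ltW v0) ?(ltW bs0) ?(ltW b0) ?(ltW s0)//.
by rewrite ler_wpM2l ?mulr_ge0// lef_pV2 ?posrE// ler_wpM2l// ltW.
Qed.

(** * The normal distribution function *)

Section NormalCdf.
Context {R : realType}.
Implicit Types (x y : R).
Notation leb := (@lebesgue_measure R).

Definition gpeak : R := normal_peak 1.

Lemma gpeak_gt0 : 0 < gpeak.
Proof. by apply: normal_peak_gt0; rewrite oner_eq0. Qed.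

Lemma normal01E x : normal_pdf 0 1 x = gpeak * expR (- x ^+ 2 / 2).
Proof.
by rewrite normal_pdfE ?oner_eq0// /normal_fun subr0 expr1n -mulr_natr mul1r.
Qed.

Lemma measurable_normal01 (A : set R) : measurable_fun A (EFin \o normal_pdf (0 : R) 1).
Proof. by apply/measurable_EFinP/measurable_funTS; exact: measurable_normal_pdf. Qed.

Lemma PhiE x : (Phi x)%:E = normal_prob 0 1 `]-oo, x].
Proof.
rewrite /Phi -/(normal_prob 0 1 _) fineK//.
by apply: fin_num_measure.
Qed.

Lemma Phi_ge0 x : 0 <= Phi x.
Proof. by rewrite -lee_fin PhiE. Qed.

Lemma Phi_le1 x : Phi x <= 1.
Proof. by rewrite -lee_fin PhiE; exact: probability_le1. Qed.

Lemma PhiB x y : x <= y ->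
  (Phi y - Phi x)%:E = (\int[leb]_(t in `]x, y]) (normal_pdf 0 1 t)%:E)%E.
Proof.
move=> xy; rewrite -/(normal_prob 0 1 _).
have : (Phi y)%:E = ((Phi x)%:E + normal_prob 0 1 `]x, y])%E.
  rewrite !PhiE (_ : `]-oo, y]%classic = `]-oo, x] `|` `]x, y]); last first.
    apply/seteqP; split => t /=; rewrite !in_itv/=; last by case; lra.
    by move=> ty; case: (leP t x); [left|right].
  apply: measureU => //.
  by apply/seteqP; split => t //= []; rewrite !in_itv/=; lra.
by rewrite EFinB => ->; rewrite addeAC subee// add0e.
Qed.

Lemma normal01_ge_unit x : -1 <= x <= 1 ->
  (gpeak : R) * expR (- 2^-1) <= normal_pdf 0 1 x.
Proof.
move=> t1; rewrite normal01E ler_wpM2l ?(ltW gpeak_gt0)// ler_expR.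
have : x ^+ 2 <= 1 by nra.
lra.
Qed.

Lemma measurable_normalE (a : R) (A : set R) :
  measurable_fun A (fun t => (normal_pdf a 1 t)%:E).
Proof. by apply/measurable_EFinP/measurable_funTS; exact: measurable_normal_pdf. Qed.

Lemma Phi_incr_ge x y (m : R) : x <= y -> 0 <= m ->
  (forall t, x <= t <= y -> m <= normal_pdf 0 1 t) -> (y - x) * m <= Phi y - Phi x.
Proof.
move=> xy m0 mt; rewrite -lee_fin PhiB//.
have -> : ((y - x) * m)%:E = (\int[leb]_(t in `]x, y]) m%:E)%E.
  rewrite integral_cst//= lebesgue_measure_itv/= lte_fin.
  case: ltP => [_|yx]; first by rewrite -EFinB -EFinM mulrC.
  have -> : y = x by apply/eqP; rewrite eq_le yx xy.
  by rewrite subrr mul0r mule0.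
apply: ge0_le_integral => //.
- exact: measurable_normal01.
- by move=> t; rewrite /= in_itv/= lee_fin => /andP[h1 h2]; apply: mt; rewrite h2 ltW.
Qed.

Lemma Phi_incr_le x y (M : R) : x <= y ->
  (forall t, x <= t <= y -> normal_pdf 0 1 t <= M) -> Phi y - Phi x <= (y - x) * M.
Proof.
move=> xy mt; rewrite -lee_fin PhiB//.
have M0 : 0 <= M by rewrite (le_trans (normal_pdf_ge0 0 1 x))// mt// lexx.
have -> : ((y - x) * M)%:E = (\int[leb]_(t in `]x, y]) M%:E)%E.
  rewrite integral_cst//= lebesgue_measure_itv/= lte_fin.
  case: ltP => [_|yx]; first by rewrite -EFinB -EFinM mulrC.
  have -> : y = x by apply/eqP; rewrite eq_le yx xy.
  by rewrite subrr mul0r mule0.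
apply: ge0_le_integral => //.
- by move=> t _; rewrite lee_fin normal_pdf_ge0.
- exact: measurable_normal01.
- by move=> t; rewrite /= in_itv/= lee_fin => /andP[h1 h2]; apply: mt; rewrite h2 ltW.
Qed.

Lemma Phi_nd x y : x <= y -> Phi x <= Phi y.
Proof.
move=> xy; rewrite -subr_ge0 (le_trans _ (Phi_incr_ge xy (lexx 0) _))//.
  by rewrite mulr0.
by move=> t _; exact: normal_pdf_ge0.
Qed.

Lemma normal01_tilt (a x : R) :
  normal_pdf 0 1 x * expR (a * x) = expR (a ^+ 2 / 2) * normal_pdf a 1 x.
Proof.
rewrite !normal_pdfE ?oner_eq0// /normal_fun !expr1n.
rewrite [RHS]mulrCA -[LHS]mulrA -!expRD; congr (_ * expR _).
by rewrite -mulr_natr; field.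
Qed.

(* Exponential tilting by [expR (a * t)] turns the standard normal density into
   the one of mean [a]. *)
Lemma normal_tail (A : set R) (a x : R) : measurable A ->
  (forall t, A t -> 0 <= a * (t - x)) ->
  (normal_prob 0 1 A <= (expR (a ^+ 2 / 2) * expR (- a * x))%:E)%E.
Proof.
move=> mA At.
apply: (@le_trans _ _ (\int[leb]_(t in A)
   ((expR (a ^+ 2 / 2) * expR (- a * x))%:E * (normal_pdf a 1 t)%:E))%E).
  apply: ge0_le_integral => //.
  - by move=> t _; rewrite lee_fin normal_pdf_ge0.
  - exact: measurable_normal01.
  - by apply: measurable_funeM; exact: measurable_normalE.
  - move=> t /At at0; rewrite -EFinM lee_fin mulrAC -normal01_tilt -mulrA -expRD.
    rewrite ler_peMr ?normal_pdf_ge0// -expR0 ler_expR.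
    by move: at0; rewrite mulrBr mulNr.
rewrite ge0_integralZl//; last 2 first.
- exact: measurable_normalE.
- by move=> t _; rewrite lee_fin normal_pdf_ge0.
rewrite -[leRHS]mule1 lee_wpmul2l//.
exact: (probability_le1 (normal_prob a 1) mA).
Qed.

(** Tilt [a = -1]. An exponential tail is enough, and it has the same shape as the Chernoff bound
    used for the Poisson law. *)
Lemma Phi_tail_left x : Phi x <= expR (2^-1) * expR x.
Proof.
rewrite -lee_fin PhiE.
have := @normal_tail `]-oo, x]%classic (-1) x.
rewrite sqrrN expr1n mul1r opprK mul1r; apply => //.
by move=> t /=; rewrite in_itv/= => tx; lra.
Qed.

Lemma Phi_tail_right x : 1 - Phi x <= expR (2^-1) * expR (- x).
Proof.
have -> : 1 - Phi x = fine (normal_prob 0 1 `]x, +oo[).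
  apply/EFin_inj; rewrite fineK; last by apply: fin_num_measure.
  rewrite -[`]x, +oo[%classic]setCitvl probability_setC// EFinB PhiE; congr (_ - _)%E.
rewrite -lee_fin fineK; last by apply: fin_num_measure.
have := @normal_tail `]x, +oo[%classic 1 x.
rewrite expr1n mul1r mulN1r; apply => //.
by move=> t /=; rewrite in_itv/= andbT => tx; lra.
Qed.

End NormalCdf.

Lemma sum_increments {R : realType} (g : int -> R) (s : seq int) :
  {homo g : i j / i <= j} -> (forall j, 0 <= g j <= 1) -> uniq s ->
  \sum_(j <- s) (g (j + 1) - g j) <= 1.
Proof.
move=> gm g01 us.
have [n sn] : exists n : nat, forall j, j \in s -> (`|j| < n)%N.
  exists (\max_(j <- s) `|j|%N).+1 => j js; rewrite ltnS.
  by rewrite (big_rem j js)/= leq_maxl.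
pose t := [seq (i : nat)%:Z - n%:Z | i <- iota 0 (2 * n)].
have ut : uniq t by rewrite map_inj_uniq ?iota_uniq// => x y /addIr [].
have d0 j : 0 <= g (j + 1) - g j by rewrite subr_ge0 gm// lerDl.
apply: (@le_trans _ _ (\sum_(j <- t) (g (j + 1) - g j))).
  apply: (@le_trans _ _ (\sum_(j <- t | j \in s) (g (j + 1) - g j))); last first.
    by rewrite [leRHS](bigID (mem s))/= lerDl sumr_ge0.
  rewrite -[leRHS]big_filter (perm_big [seq j <- t | j \in s])//=.
  apply: uniq_perm; rewrite ?filter_uniq// => j.
  rewrite mem_filter andb_idr// => js; apply/mapP; exists `|(j + n%:Z)%R|%N.
    by rewrite mem_iota/=; have := sn _ js; lia.
  by have := sn _ js; lia.
have -> : \sum_(j <- t) (g (j + 1) - g j) = g (- n%:Z + (2 * n)%N%:Z) - g (- n%:Z).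
  rewrite /t big_map; elim: (2 * n)%N => [|k IH].
    by rewrite big_nil addr0 subrr.
  rewrite -addn1 iotaD big_cat/= IH big_seq1 add0n PoszD [- n%:Z + (_ + _)]addrA.
  rewrite [k%:Z - _]addrC; ring.
have := g01 (- n%:Z + (2 * n)%N%:Z); have := g01 (- n%:Z); lra.
Qed.

(** * Lattice distribution functions against the normal one, cell by cell *)

Section Cells.
Context {R : realType}.
Notation leb := (@lebesgue_measure R).
Variables (mu sigma : R) (s0 : 0 < sigma) (F : int -> R) (H : R -> R).

Definition cellx (j : int) : R := (j%:~R - mu) / sigma.

Hypothesis HF : forall j x, cellx j <= x < cellx (j + 1) -> H x = F j.
Hypothesis H_nd : nondecreasing_fun H.

Lemma cellxS j : cellx (j + 1) = cellx j + sigma^-1.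
Proof. by rewrite /cellx intrD -[X in _ = _ + X]div1r -mulrDl addrAC. Qed.

Lemma cellx_le i j : i <= j -> cellx i <= cellx j.
Proof.
by move=> ij; rewrite /cellx ler_wpM2r ?invr_ge0 ?(ltW s0)// lerD2r ler_int.
Qed.

Lemma measurable_HPhi (A : set R) : measurable A ->
  measurable_fun A (fun x => (`|H x - Phi x|)%:E).
Proof.
move=> mA; apply/measurable_EFinP; apply: measurableT_comp => //.
apply: measurable_funB; apply: nondecreasing_measurable => //.
by move=> x y; exact: Phi_nd.
Qed.

Definition cell j : set R := `[cellx j, cellx (j + 1)[.

Lemma cell_sum (s : seq int) : uniq s ->
  (\sum_(j <- s) \int[leb]_(x in cell j) (`|H x - Phi x|)%:E <= dW H Phi)%E.
Proof.
move=> us; rewrite -ge0_integral_bigsetU//.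
- apply: ge0_subset_integral => //; last exact: measurable_HPhi.
  by apply: bigsetU_measurable => j _; exact: measurable_itv.
- by move=> j; exact: measurable_itv.
- apply/trivIsetP => i j _ _ ij; apply/seteqP; split => // x [].
  rewrite /cell/= !in_itv/= => /andP[h1 h2] /andP[h3 h4].
  have [ij'|ij'] : i + 1 <= j \/ j + 1 <= i by move: ij => /eqP; lia.
    by have := cellx_le ij'; lra.
  by have := cellx_le ij'; lra.
- apply: measurable_HPhi; apply: bigsetU_measurable => j _; exact: measurable_itv.
Qed.

Lemma cell_ge j (x y B : R) : cellx j <= x -> x <= y -> y <= cellx (j + 1) -> 0 <= B ->
  (forall t, x <= t < y -> B <= `|F j - Phi t|) ->
  (((y - x) * B)%:E <= \int[leb]_(x in cell j) (`|H x - Phi x|)%:E)%E.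
Proof.
move=> jx xy yj B0 HB.
apply: (@le_trans _ _ (\int[leb]_(x in `[x, y[) (`|H x - Phi x|)%:E)%E); last first.
  apply: ge0_subset_integral => //; [exact: measurable_itv|by apply: measurable_HPhi; exact: measurable_itv|].
  by move=> t; rewrite /cell /= !in_itv/= => /andP[h1 h2]; apply/andP; split; lra.
have -> : ((y - x) * B)%:E = (\int[leb]_(t in `[x, y[) B%:E)%E.
  rewrite integral_cst//= lebesgue_measure_itv/= lte_fin.
  case: ltP => [_|yx]; first by rewrite -EFinB -EFinM mulrC.
  have -> : y = x by apply/eqP; rewrite eq_le yx xy.
  by rewrite subrr mul0r mule0.
apply: ge0_le_integral => //; first exact: measurable_HPhi.
move=> t; rewrite /= in_itv/= lee_fin => txy; rewrite (HF (j := j)); first exact: HB.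
by case/andP: txy => h1 h2; apply/andP; split; lra.
Qed.

(** On a cell [H] is constant, and [Phi] departs from its value at the left end by at most its
    increment. *)
Lemma cell_ge_center j : ((sigma^-1 * (`|F j - Phi (cellx j)| -
    (Phi (cellx (j + 1)) - Phi (cellx j))))%:E <=
  \int[leb]_(x in cell j) (`|H x - Phi x|)%:E)%E.
Proof.
set B := `|_| - _.
have [B0|B0] := leP 0 B; last first.
  apply: (@le_trans _ _ 0%E); last exact: integral_ge0.
  by rewrite lee_fin mulr_ge0_le0 ?invr_ge0// ltW.
have -> : sigma^-1 = cellx (j + 1) - cellx j by rewrite cellxS addrC addKr.
apply: cell_ge => //; first by apply: cellx_le; lia.
move=> t /andP[h1 h2]; rewrite /B.
have p1 := Phi_nd h1; have p2 := Phi_nd (ltW h2).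
have := ler_normD (F j - Phi t) (Phi t - Phi (cellx j)).
rewrite addrA subrK (ger0_norm (_ : 0 <= Phi t - _)) ?subr_ge0//; lra.
Qed.

Let h := sigma^-1.
Let m0 := gpeak * expR (- 2^-1) : R.

Let h_gt0 : 0 < h. Proof. by rewrite invr_gt0. Qed.
Let m0_gt0 : 0 < m0. Proof. by rewrite mulr_gt0 ?gpeak_gt0 ?expR_gt0. Qed.

(** A constant cannot follow [Phi] over a whole cell. If [F j] lies above [Phi] at the midpoint they
    differ by [h / 4 * m0] on the first quarter, otherwise on the last one; [m0] is the least normal
    density on [[-1, 1]]. *)
Lemma cell_ge_lattice j : -1 <= cellx j -> cellx (j + 1) <= 1 ->
  ((h ^+ 2 / 16 * m0)%:E <= \int[leb]_(x in cell j) (`|H x - Phi x|)%:E)%E.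
Proof.
move=> j1 j2; have xS := cellxS j; rewrite -/h in xS.
set x := cellx j in j1 xS *.
have h0 := h_gt0.
have inc a b : x <= a -> a <= b -> b <= x + h -> (b - a) * m0 <= Phi b - Phi a.
  move=> xa ab bx; apply: Phi_incr_ge => //; first exact: ltW.
  by move=> t t1; apply: normal01_ge_unit; lra.
have B0 : 0 <= h / 4 * m0 by rewrite mulr_ge0 ?divr_ge0 ?(ltW m0_gt0) ?(ltW h_gt0).
have [ha|ha] := leP (Phi (x + h / 2)) (F j).
  have -> : h ^+ 2 / 16 * m0 = (x + h / 4 - x) * (h / 4 * m0) by field.
  apply: cell_ge => //; rewrite -?/x; try lra.
  move=> t tx; have := inc t (x + h / 2).
  have := @Phi_nd R t (x + h / 4); rewrite ger0_norm; last first.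
    by rewrite subr_ge0 (le_trans _ ha)//; apply: Phi_nd; lra.
  have := inc (x + h / 4) (x + h / 2).
  have -> : x + h / 2 - (x + h / 4) = h / 4 by field.
  lra.
have -> : h ^+ 2 / 16 * m0 = (x + h - (x + h * (3 / 4))) * (h / 4 * m0) by field.
apply: cell_ge => //; rewrite -?/x; try lra.
move=> t tx; rewrite distrC.
have := @Phi_nd R (x + h * (3 / 4)) t; rewrite ger0_norm; last first.
  by rewrite subr_ge0 ltW// (lt_le_trans ha)//; apply: Phi_nd; lra.
have := inc (x + h / 2) (x + h * (3 / 4)).
have -> : x + h * (3 / 4) - (x + h / 2) = h / 4 by field.
lra.
Qed.

Lemma dW_ge_lattice : 4 <= sigma -> ((m0 / 16 / sigma)%:E <= dW H Phi)%E.
Proof.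
move=> s4.
(* The cells start at the first lattice point after [mu - sigma]. There are more than [sigma] of
   them, and [4 <= sigma] keeps them all inside [[-1, 1]]. *)
pose a : int := Num.floor (mu - sigma) + 1.
pose n := `|(Num.floor sigma + 1)%R|%N.
have nE : n%:Z = Num.floor sigma + 1.
  by rewrite gez0_abs// addr_ge0// floor_ge0; lra.
have nR : (n%:R : R) = (Num.floor sigma + 1)%:~R by rewrite -nE.
have n1 : (n%:R : R) <= sigma + 1.
  by rewrite nR intrD lerD2r floor_le.
have n2 : sigma < (n%:R : R) by rewrite nR floorD1_gt.
have a1 : mu - sigma < a%:~R by exact: floorD1_gt.
have a2 : (a%:~R : R) <= mu - sigma + 1 by rewrite intrD lerD2r floor_le.
pose s := [seq a + (i : nat)%:Z | i <- iota 0 n].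
have us : uniq s by rewrite map_inj_uniq ?iota_uniq// => x y /addrI [].
apply: le_trans (cell_sum us).
apply: (@le_trans _ _ (\sum_(j <- s) (h ^+ 2 / 16 * m0)%:E)%E).
  rewrite sumEFin lee_fin big_const_seq count_predT size_map size_iota iter_addr addr0.
  rewrite -[_ *+ n]mulr_natr.
  have -> : m0 / 16 / sigma = h ^+ 2 / 16 * m0 * sigma by rewrite /h; field; rewrite gt_eqF.
  rewrite ler_wpM2l//; last exact: ltW.
  by rewrite mulr_ge0 ?(ltW m0_gt0)// divr_ge0// sqr_ge0.
rewrite big_seq [leRHS]big_seq; apply: lee_sum => j /mapP[i]; rewrite mem_iota add0n/= => lin ->.
have : (i.+1%:R : R) <= n%:R by rewrite ler_nat.
rewrite -natr1 => i1; have i0 := ler0n R i.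
apply: cell_ge_lattice; rewrite /cellx.
  rewrite ler_pdivlMr// intrD -[i%:Z%:~R]/(i%:R); lra.
rewrite ler_pdivrMr//.
have -> : (a + i%:Z + 1)%:~R = a%:~R + i%:R + 1 :> R by rewrite !intrD.
lra.
Qed.

(** A Riemann sum comparison; the extra 1 bounds the total increment of [Phi]. *)
Lemma l1le_cells (w : R) : dW H Phi = w%:E ->
  l1le (fun j => F j - Phi (cellx j)) (sigma * w + 1).
Proof.
move=> Hw s us.
have H1 : \sum_(j <- s) (Phi (cellx (j + 1)) - Phi (cellx j)) <= 1.
  apply: sum_increments => //; first by move=> i j ij; apply: Phi_nd; exact: cellx_le.
  by move=> j; rewrite Phi_ge0 Phi_le1.
have H2 : \sum_(j <- s) h * (`|F j - Phi (cellx j)| -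
    (Phi (cellx (j + 1)) - Phi (cellx j))) <= w.
  rewrite -lee_fin -Hw -sumEFin; apply: le_trans (cell_sum us).
  by apply: lee_sum => j _; exact: cell_ge_center.
move: H2; rewrite -mulr_sumr sumrB /h mulrC ler_pdivrMr// mulrC; lra.
Qed.

Lemma dK_cell (j : int) (k : R) : dK H Phi = k%:E -> `|F j - Phi (cellx j)| <= k.
Proof.
move=> Hk; rewrite -lee_fin -Hk; apply: ereal_sup_ubound; exists (cellx j) => //.
by rewrite (HF (j := j))// lexx cellxS ltrDl invr_gt0.
Qed.

(** [H] takes the same value at the left end and at the midpoint of a cell near 0, while [Phi] grows
    by at least [h / 2 * m0]. The right end is avoided because [H] may jump there. *)
Lemma dK_ge_lattice (k : R) : 4 <= sigma -> dK H Phi = k%:E -> m0 / 4 / sigma <= k.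
Proof.
move=> s4 Hk; pose j := Num.floor mu.
have j1 : (j%:~R : R) <= mu by exact: floor_le.
have j2 : mu < j%:~R + 1 by have := floorD1_gt mu; rewrite intrD.
have hs : h * sigma = 1 by rewrite /h mulVf// gt_eqF.
have h4 : h <= 4^-1 by rewrite /h lef_pV2 ?posrE//; lra.
have x1 : cellx j <= 0 by rewrite /cellx ler_pdivrMr// mul0r; lra.
have x2 : - h <= cellx j by rewrite /cellx ler_pdivlMr// mulNr hs; lra.
have k1 := dK_cell j Hk.
have k2 : `|F j - Phi (cellx j + h / 2)| <= k.
  rewrite -lee_fin -Hk; apply: ereal_sup_ubound; exists (cellx j + h / 2) => //.
  rewrite (HF (j := j))// cellxS -/h; have := h_gt0; lra.
have inc : (h / 2) * m0 <= Phi (cellx j + h / 2) - Phi (cellx j).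
  have h0 := h_gt0.
  have {1}-> : h / 2 = cellx j + h / 2 - cellx j by ring.
  apply: Phi_incr_ge; [lra|exact: ltW|move=> t t1; apply: normal01_ge_unit; lra].
have := ler_normB (F j - Phi (cellx j)) (F j - Phi (cellx j + h / 2)).
have -> : F j - Phi (cellx j) - (F j - Phi (cellx j + h / 2)) =
  Phi (cellx j + h / 2) - Phi (cellx j) by ring.
rewrite ger0_norm; last by rewrite (le_trans _ inc)// mulr_ge0 ?(ltW m0_gt0) ?divr_ge0 ?(ltW h_gt0).
rewrite -/h; have -> : m0 / 4 * sigma^-1 = (h / 2 * m0) / 2 by rewrite /h; field; rewrite gt_eqF.
lra.
Qed.

End Cells.

(** * The translated Poisson law *)

Section PmfCdf.
Context {R : realType}.
Variables (p : int -> R) (pp : is_pmf p).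
Let G := cdf_pmf p.

Lemma cdf_pmf_ge0 j : 0 <= G j.
Proof. by apply/fine_ge0/esum_ge0 => i _; rewrite lee_fin pp.1. Qed.

Lemma cdf_pmfE j : (G j)%:E = \esum_(i in [set i | (i <= j)%R]) (p i)%:E.
Proof. by rewrite fineK//; exact: pmf_fin_num. Qed.

Lemma cdf_pmfC j : (1 - G j)%:E = \esum_(i in [set i | (j < i)%R]) (p i)%:E.
Proof.
rewrite EFinB cdf_pmfE -pp.2 (@esumID R _ [set i | (i <= j)%R] [set: int]); last first.
  by move=> i _; rewrite lee_fin pp.1.
rewrite !setTI (_ : ~` _ = [set i | (j < i)%R]); last first.
  by apply/seteqP; split => i /=; rewrite ltNge => /negP.
by rewrite addeAC subee ?add0e//; exact: pmf_fin_num.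
Qed.

Lemma cdf_pmf_le1 j : G j <= 1.
Proof.
rewrite -subr_ge0 -lee_fin cdf_pmfC; apply: esum_ge0 => i _.
by rewrite lee_fin pp.1.
Qed.

Lemma cdf_pmfS j : G (j + 1) - G j = p (j + 1).
Proof. exact: Dif_cdf_pmf. Qed.

Lemma esum_tail_le (A : set int) (f : int -> R) (c : R) :
  (forall i, 0 <= f i) -> (forall i, A i -> p i <= f i) ->
  \esum_(i in [set: int]) (f i)%:E = c%:E -> (\esum_(i in A) (p i)%:E <= c%:E)%E.
Proof.
move=> f0 pf <-; rewrite esum_mkcond; apply: le_esum => i _.
case: ifPn => [|_]; first by rewrite inE => /pf; rewrite lee_fin.
by rewrite lee_fin.
Qed.

End PmfCdf.

Lemma expR_le_quad {R : realType} (s : R) : `|s| <= 2^-1 -> expR s - 1 - s <= 2 * s ^+ 2.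
Proof.
rewrite ler_norml => /andP[s1 s2].
have h : expR s <= (1 - s)^-1.
  rewrite -[s in X in X <= _]opprK expRN lef_pV2 ?posrE ?expR_gt0//; last by lra.
  exact: expR_ge1Dx.
have : (1 - s)^-1 <= 1 + s + 2 * s ^+ 2.
  rewrite -div1r ler_pdivrMr; last by lra.
  rewrite -subr_ge0.
  have -> : (1 + s + 2 * s ^+ 2) * (1 - s) - 1 = s ^+ 2 * (1 - 2 * s) by ring.
  by rewrite mulr_ge0 ?sqr_ge0//; lra.
lra.
Qed.

Section Poisson.
Context {R : realType}.
Implicit Types lam t : R.

Lemma poisson_int_ge0 lam m : 0 <= lam -> 0 <= poisson_int lam m.
Proof.
move=> l0; rewrite /poisson_int; case: ifP => // _.
by rewrite divr_ge0// mulr_ge0 ?expR_ge0// exprn_ge0.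
Qed.

Lemma poisson_int_mass lam : 0 < lam ->
  \esum_(m in [set: int]) (poisson_int lam m)%:E = 1%E.
Proof.
move=> l0.
have H : \esum_(m in [set: nat]) (poisson_pmf lam m)%:E = 1%E.
  have : (poisson_prob lam 0 : probability _ _) [set: nat] = 1%E.
    exact: probability_setT.
  by rewrite /= /poisson_prob l0.
rewrite -H.
rewrite (_ : \esum_(m in [set: int]) (poisson_int lam m)%:E =
    \esum_(m in [set m : int | (0 <= m)%R]) (poisson_int lam m)%:E); last first.
  rewrite [RHS]esum_mkcond; apply: eq_esum => m _; rewrite /poisson_int.
  case: (boolP (0 <= m)) => m0; first by rewrite mem_set.
  by rewrite memNset//=; exact/negP.
rewrite (@reindex_esum R _ _ [set: nat] _ Posz); last first.
  split => //; first by move=> x y _ _ [].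
  by move=> [m|m]//= _; exists m.
by apply: eq_esum => m _; rewrite /poisson_int /poisson_pmf/= l0; congr (_%:E); ring.
Qed.

Lemma poisson_int_mgf lam t : 0 < lam ->
  \esum_(m in [set: int]) (poisson_int lam m * expR (t * m%:~R))%:E =
  (expR (lam * (expR t - 1)))%:E.
Proof.
move=> l0.
have le0 : 0 < lam * expR t by rewrite mulr_gt0 ?expR_gt0.
have E m : (poisson_int lam m * expR (t * m%:~R))%:E =
    ((expR (lam * (expR t - 1)))%:E * (poisson_int (lam * expR t) m)%:E)%E.
  rewrite -EFinM; congr EFin; rewrite /poisson_int; case: ifPn => m0; last by rewrite mulr0 mul0r.
  case: m m0 => m _ //=.
  rewrite -[m%:Z%:~R]/(m%:R) expRM_natr exprMn.
  rewrite !mulrA -expRD; have -> : lam * (expR t - 1) - lam * expR t = - lam by ring.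
  by rewrite mulrAC.
under eq_esum do rewrite E.
rewrite esumZl ?expR_ge0//; last by move=> z; rewrite lee_fin poisson_int_ge0// ltW.
by rewrite poisson_int_mass// mule1.
Qed.

End Poisson.

Section TranslatedPoisson.
Context {R : realType}.
Variables (mu sigma : R) (s2 : 2 <= sigma).

Definition tp_shift : int := Num.floor (mu - sigma ^+ 2).
Definition tp_rate : R := sigma ^+ 2 + (mu - sigma ^+ 2 - tp_shift%:~R).
Let a := tp_shift.
Let lam := tp_rate.
Let q := TP_pmf mu (sigma ^+ 2).

Let s0 : 0 < sigma. Proof. by rewrite (lt_le_trans _ s2). Qed.
Let ss0 : 0 < sigma ^+ 2. Proof. by rewrite exprn_gt0. Qed.

Lemma tp_rate_bounds : sigma ^+ 2 <= lam <= sigma ^+ 2 + 1.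
Proof.
rewrite /lam /tp_rate /tp_shift.
have h1 := floor_le (mu - sigma ^+ 2); have := floorD1_gt (mu - sigma ^+ 2).
rewrite intrD => h2; apply/andP; split; lra.
Qed.

Let lam0 : 0 < lam. Proof. by have /andP[h _] := tp_rate_bounds; exact: lt_le_trans h. Qed.

Lemma tp_mean : a%:~R + lam = mu.
Proof. by rewrite /lam /tp_rate -/a; ring. Qed.

Lemma TP_pmfE j : q j = poisson_int lam (j - a).
Proof. by []. Qed.

Lemma TP_is_pmf : is_pmf q.
Proof.
split; first by move=> j; rewrite TP_pmfE poisson_int_ge0// ltW.
under eq_esum do rewrite TP_pmfE.
by rewrite (esum_shift (fun z => (poisson_int lam z)%:E) (- a)) poisson_int_mass.
Qed.

Lemma TP_mgf (t : R) :
  \esum_(j in [set: int]) (q j * expR (t * (j%:~R - mu)))%:E =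
  (expR (lam * (expR t - 1 - t)))%:E.
Proof.
transitivity (\esum_(j in [set: int]) ((expR (- t * lam))%:E *
   (poisson_int lam (j - a) * expR (t * (j - a)%:~R))%:E)%E).
  apply: eq_esum => j _; rewrite TP_pmfE -EFinM mulrCA -expRD.
  by congr (_ * expR _)%:E; rewrite intrB -[in LHS]tp_mean; ring.
rewrite esumZl ?expR_ge0//; last first.
  by move=> z; rewrite lee_fin mulr_ge0 ?expR_ge0// poisson_int_ge0// ltW.
rewrite (esum_shift (fun z => (poisson_int lam z * expR (t * z%:~R))%:E) (- a)).
by rewrite poisson_int_mgf// -EFinM -expRD; congr (expR _)%:E; ring.
Qed.

Let h := sigma^-1.
Let h0 : 0 < h. Proof. by rewrite invr_gt0. Qed.
Let hh : h <= 2^-1. Proof. by rewrite /h lef_pV2 ?posrE. Qed.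

(** At tilt [1 / sigma] the exponent is bounded: it is at most
    [(sigma ^ 2 + 1) * 2 / sigma ^ 2 <= 4]. *)
Lemma TP_mgf_le (t : R) : `|t| = h -> expR (lam * (expR t - 1 - t)) <= expR 4.
Proof.
move=> th; rewrite ler_expR.
have := @expR_le_quad _ t; rewrite th => /(_ hh).
have -> : t ^+ 2 = h ^+ 2 by rewrite -th real_normK// num_real.
move=> q1; have /andP[_ l1] := tp_rate_bounds.
apply: (le_trans (ler_wpM2l (ltW lam0) q1)).
apply: (@le_trans _ _ ((sigma ^+ 2 + 1) * (2 * h ^+ 2))).
  by rewrite ler_wpM2r// mulr_ge0// sqr_ge0.
have sh : sigma ^+ 2 * h ^+ 2 = 1 by rewrite /h -exprMn divff ?expr1n// gt_eqF.
have h1 : h <= 1 by rewrite (le_trans hh)// invf_le1// ler1n.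
have := exprn_ile1 2 (ltW h0) h1.
rewrite mulrDl mul1r mulrCA sh; move: (h ^+ 2) => u u1; lra.
Qed.

(** Chernoff's bound with tilt [- h]; on the normalised scale it decays like
    [expR (cellx mu sigma j)]. *)
Lemma TP_tail_left j :
  cdf_pmf q j <= expR 4 * expR (h * (j%:~R - mu)).
Proof.
rewrite -lee_fin cdf_pmfE; last exact: TP_is_pmf.
apply: (@le_trans _ _ (expR (h * (j%:~R - mu)) * expR (lam * (expR (- h) - 1 - (- h))))%:E); last first.
  rewrite lee_fin mulrC ler_wpM2r ?expR_ge0// TP_mgf_le// normrN gtr0_norm//.
apply: (@esum_tail_le _ q _ (fun i => expR (h * (j%:~R - mu)) * (q i * expR (- h * (i%:~R - mu))))).
- by move=> i; rewrite !mulr_ge0 ?expR_ge0// TP_is_pmf.1.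
- move=> i /= ij; rewrite mulrCA -expRD ler_peMr ?TP_is_pmf.1//.
  rewrite (le_trans _ (expR_ge1Dx _))// lerDl; have -> : h * (j%:~R - mu) + - h * (i%:~R - mu) = h * (j%:~R - i%:~R) by ring.
  by rewrite mulr_ge0 ?(ltW h0)// subr_ge0 ler_int.
- under eq_esum do rewrite EFinM.
  rewrite esumZl ?expR_ge0//; last first.
    by move=> z; rewrite lee_fin mulr_ge0 ?expR_ge0// TP_is_pmf.1.
  by rewrite TP_mgf EFinM.
Qed.

Lemma TP_tail_right j :
  1 - cdf_pmf q j <= expR 4 * expR (- h * (j%:~R - mu)).
Proof.
rewrite -lee_fin cdf_pmfC; last exact: TP_is_pmf.
apply: (@le_trans _ _ (expR (- h * (j%:~R - mu)) * expR (lam * (expR h - 1 - h)))%:E); last first.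
  by rewrite lee_fin mulrC ler_wpM2r ?expR_ge0// TP_mgf_le// gtr0_norm.
apply: (@esum_tail_le _ q _ (fun i => expR (- h * (j%:~R - mu)) * (q i * expR (h * (i%:~R - mu))))).
- by move=> i; rewrite !mulr_ge0 ?expR_ge0// TP_is_pmf.1.
- move=> i /= ij; rewrite mulrCA -expRD ler_peMr ?TP_is_pmf.1//.
  rewrite (le_trans _ (expR_ge1Dx _))// lerDl; have -> : - h * (j%:~R - mu) + h * (i%:~R - mu) = h * (i%:~R - j%:~R) by ring.
  by rewrite mulr_ge0 ?(ltW h0)// subr_ge0 ler_int ltW.
- under eq_esum do rewrite EFinM.
  rewrite esumZl ?expR_ge0//; last first.
    by move=> z; rewrite lee_fin mulr_ge0 ?expR_ge0// TP_is_pmf.1.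
  by rewrite TP_mgf EFinM.
Qed.

Lemma TP_smooth l :
  l1le (act (('X - 1) ^+ (2 * l)) q) ((8 * l%:R * l.+1%:R / sigma ^+ 2) ^+ l).
Proof.
apply: (@l1le_ext _ (fun j => act (('X - 1) ^+ (2 * l)) (poisson_int lam) (j - a))).
  by move=> j; rewrite -act_shift.
apply: l1le_shift; apply: (l1le_le (poisson_smooth l lam0)).
have /andP[h1 _] := tp_rate_bounds.
apply: lerXn2r; rewrite ?nnegrE ?divr_ge0 ?mulr_ge0 ?(ltW lam0) ?(ltW s0)//.
by rewrite ler_wpM2l ?mulr_ge0// lef_pV2 ?posrE.
Qed.

(** The Poisson recursion between consecutive masses, recentred at [mu] by [tp_mean]. *)
Lemma TP_step j : (0 <= j - a)%R -> q (j + 1) * (j%:~R + 1 - mu + lam) = lam * q j.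
Proof.
move=> ja; have -> : j%:~R + 1 - mu + lam = (j - a)%:~R + 1 :> R.
  by rewrite intrB -[in LHS]tp_mean; ring.
rewrite !TP_pmfE addrAC; case: (j - a) ja => // m _.
rewrite /poisson_int/= -[m%:Z%:~R]/(m%:R) natr1 addn1 factS natrM exprS.
by field; rewrite nat1r !pnatr_eq0 -!lt0n fact_gt0.
Qed.

End TranslatedPoisson.

(** * Normal approximation of the translated Poisson law *)

Section RatioComparison.
Context {R : realFieldType}.

Lemma ratio_chain (f : nat -> R) (n : nat) (E : R) : 1 <= E -> (forall i, 0 <= f i) ->
  (forall i, (i < n)%N -> f i.+1 <= E * f i /\ f i <= E * f i.+1) ->
  forall i k, (i <= n)%N -> (k <= n)%N -> f i <= E ^+ n * f k.
Proof.
move=> E1 f0 H.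
have E0 : 0 <= E by exact: le_trans E1.
have up d i : (i + d <= n)%N -> f (i + d)%N <= E ^+ d * f i /\ f i <= E ^+ d * f (i + d)%N.
  elim: d => [|d IH] idn; first by rewrite addn0 expr0 !mul1r.
  have idn' : (i + d < n)%N by rewrite -addnS.
  have [h1 h2] := IH (ltnW idn').
  rewrite addnS; have [h3 h4] := H (i + d)%N idn'; split.
    by rewrite exprS -mulrA (le_trans h3)// ler_wpM2l.
  by rewrite exprSr -mulrA (le_trans h2)// ler_wpM2l// exprn_ge0.
move=> i k in_ kn.
have fin d g : (d <= n)%N -> 0 <= g -> E ^+ d * g <= E ^+ n * g.
  by move=> dn g0; rewrite ler_wpM2r// ler_weXn2l.
have [ik|ki] := leqP i k.
  have := (up (k - i)%N i); rewrite subnKC// => /(_ kn)[_ h2].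
  by rewrite (le_trans h2)// fin//; lia.
have := (up (i - k)%N k); rewrite subnKC ?(ltnW ki)// => /(_ in_)[h2 _].
by rewrite (le_trans h2)// fin//; lia.
Qed.

(** Summing the cross-multiplied inequality over [i < m] and [k < n] compares partial sums directly.
    Only ratios of masses are needed, because both totals over the window lie within [2 * tau] of
    1. *)
Lemma ratio_cdf_close (u v : nat -> R) (n : nat) (E U V tau : R) :
  1 <= E -> 0 <= U <= tau -> 0 <= V <= tau ->
  (forall i, 0 <= u i) -> (forall i, 0 <= v i) ->
  U + \sum_(i < n) u i <= 1 -> V + \sum_(i < n) v i <= 1 ->
  1 - tau <= U + \sum_(i < n) u i -> 1 - tau <= V + \sum_(i < n) v i ->
  (forall i k, (i < n)%N -> (k < n)%N -> u i * v k <= E * (u k * v i)) ->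
  forall m, (m <= n)%N ->
  U + \sum_(i < m) u i <= V + \sum_(i < m) v i + (E - 1) + 3 * tau.
Proof.
move=> E1 /andP[U0 Ut] /andP[V0 Vt] u0 v0 u1 v1 ut vt uv m mn.
pose Su := \sum_(i < n) u i; pose Sv := \sum_(i < n) v i.
have su0 : 0 <= \sum_(i < m) u i by exact: sumr_ge0.
have sv0 : 0 <= \sum_(i < m) v i by exact: sumr_ge0.
have part (f : nat -> R) : (forall i, 0 <= f i) -> \sum_(i < m) f i <= \sum_(i < n) f i.
  move=> f0; rewrite (big_ord_widen n f)// big_mkcond/= ler_sum// => i _.
  by case: ifP.
have H : (\sum_(i < m) u i) * Sv <= E * (Su * \sum_(i < m) v i).
  rewrite mulr_suml !mulr_sumr ler_sum// => i _.
  have im : (i < n)%N := leq_trans (ltn_ord i) mn.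
  rewrite /Sv /Su mulr_sumr mulr_suml mulr_sumr ler_sum// => k _.
  by apply: uv.
have Su1 : Su <= 1 by rewrite /Su; lra.
have Sv1 : Sv <= 1 by rewrite /Sv; lra.
have Svt : 1 - 2 * tau <= Sv by rewrite /Sv; lra.
have sum1 : \sum_(i < m) u i <= 1 by have := part u u0; rewrite -/Su; lra.
have svm1 : \sum_(i < m) v i <= 1 by have := part v v0; rewrite -/Sv; lra.
have tau0 : 0 <= tau by lra.
have H1 : E * (Su * \sum_(i < m) v i) <= \sum_(i < m) v i + (E - 1).
  move: (\sum_(i < m) v i) sv0 svm1 => x x0 x1.
  have : Su * x <= x by rewrite ler_piMl.
  move=> /(ler_wpM2l (ltW (lt_le_trans ltr01 E1))) /le_trans; apply.
  rewrite -subr_ge0; have -> : x + (E - 1) - E * x = (E - 1) * (1 - x) by ring.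
  by rewrite mulr_ge0// subr_ge0.
have H2 : (\sum_(i < m) u i) - 2 * tau <= (\sum_(i < m) u i) * Sv.
  move: (\sum_(i < m) u i) su0 sum1 => x x0 x1.
  apply: (@le_trans _ _ (x * (1 - 2 * tau))); last by rewrite ler_wpM2l.
  rewrite -subr_ge0; have -> : x * (1 - 2 * tau) - (x - 2 * tau) = 2 * tau * (1 - x) by ring.
  by rewrite !mulr_ge0// subr_ge0.
lra.
Qed.

End RatioComparison.

(** * Ratios of Poisson masses against the Gaussian profile *)

Section LocalRatio.
Context {R : realType}.
Variables (mu sigma rr : R).
Hypotheses (s2 : 2 <= sigma) (r1 : 1 <= rr) (rs : rr <= sigma ^+ 2 / 2).

Let h := sigma^-1.
Let q := TP_pmf mu (sigma ^+ 2).
Let lam := tp_rate mu sigma.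
Let y (j : int) : R := j%:~R - mu.
Let x j := cellx mu sigma j.

Let s0 : 0 < sigma. Proof. by rewrite (lt_le_trans _ s2). Qed.
Let h0 : 0 < h. Proof. by rewrite invr_gt0. Qed.

(** The three terms bound the discrepancy between [1 / lam] and [1 / sigma ^ 2], the half-step in
    the increment of the square, and the second-order term of the logarithm. *)
Definition step_err : R := rr * h ^+ 4 + h ^+ 2 / 2 + 2 * rr ^+ 2 * h ^+ 4.

(** The mass divided by the Gaussian profile, up to a constant; it is nearly constant near [mu]. *)
Definition tilted (j : int) : R := q j * expR (x j ^+ 2 / 2).

Lemma log1p_bounds (t : R) : `|t| <= 2^-1 ->
  (1 + t)^-1 <= expR (- t + 2 * t ^+ 2) /\ 1 + t <= expR t.
Proof.
rewrite ler_norml => /andP[t1 t2]; split; last exact: expR_ge1Dx.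
have p0 : 0 < 1 + t by lra.
rewrite -div1r ler_pdivrMr// (@le_trans _ _ ((1 + (- t + 2 * t ^+ 2)) * (1 + t)))//.
  rewrite -subr_ge0.
  have -> : (1 + (- t + 2 * t ^+ 2)) * (1 + t) - 1 = t ^+ 2 * (1 + 2 * t) by ring.
  by rewrite mulr_ge0 ?sqr_ge0//; lra.
by rewrite ler_wpM2r ?(ltW p0)// expR_ge1Dx.
Qed.

(** The masses satisfy [q (j + 1) = q j / (1 + t)] with [t = y (j + 1) / lam]. To first order the
    logarithm of this ratio, [- t], cancels the increment [c] of the Gaussian exponent. *)
Lemma tilted_step j : `|y j| <= rr -> `|y (j + 1)| <= rr ->
  tilted (j + 1) <= expR step_err * tilted j /\
  tilted j <= expR step_err * tilted (j + 1).
Proof.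
move=> yj yj1; have rs' := rs; have r1' := r1.
have /andP[l1 l2] := @tp_rate_bounds R mu sigma; rewrite -/lam in l1 l2.
have ss4 : 4 <= sigma ^+ 2 by rewrite (_ : 4 = 2 ^+ 2); [rewrite ler_sqr ?nnegrE// ltW|ring].
have lam0 : 0 < lam by lra.
have yS : y (j + 1) = y j + 1 by rewrite /y intrD; ring.
pose t := y (j + 1) / lam.
have tl : `|t| <= rr / sigma ^+ 2.
  rewrite /t normrM normfV (gtr0_norm lam0); apply: ler_pM => //; first by rewrite invr_ge0 ltW.
  by rewrite lef_pV2 ?posrE//; lra.
have rsq : rr / sigma ^+ 2 <= 2^-1.
  by rewrite ler_pdivrMr ?exprn_gt0//; lra.
have [b1 b2] := log1p_bounds (le_trans tl rsq).
have t1 : 0 < 1 + t.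
  by have := le_trans tl rsq; rewrite ler_norml => /andP[]; lra.
have qS : q (j + 1) * (1 + t) = q j.
  (* The window stays inside the support, since [rr <= sigma ^ 2 / 2] is below [lam]. *)
  have ja : (0 <= j - tp_shift mu sigma)%R.
    rewrite -(ler_int R) intrB.
    have := tp_mean mu sigma; rewrite -/lam.
    by move: yj; rewrite ler_norml /y => /andP[]; lra.
  have := TP_step ja; rewrite -/lam -/q.
  have -> : j%:~R + 1 - mu + lam = lam * (1 + t).
    by rewrite /t yS /y; field; rewrite gt_eqF.
  by rewrite mulrCA => /(mulfI (lt0r_neq0 lam0)).
have q0 i : 0 <= q i by have [] := @TP_is_pmf R mu sigma s2.
have xS : x (j + 1) = x j + h by exact: cellxS.
have xE : x j = y j * h by [].
pose c := (2 * y j + 1) * h ^+ 2 / 2.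
have eS : expR (x (j + 1) ^+ 2 / 2) = expR (x j ^+ 2 / 2) * expR c.
  by rewrite -expRD; congr expR; rewrite xS xE /c; field.
have h2 : h ^+ 2 = (sigma ^+ 2)^-1 by rewrite /h exprVn.
have gap0 : 0 <= h ^+ 2 - lam^-1.
  by rewrite h2 subr_ge0 lef_pV2 ?posrE//; lra.
have gap1 : h ^+ 2 - lam^-1 <= h ^+ 4.
  have -> : h ^+ 2 - lam^-1 = h ^+ 2 * ((lam - sigma ^+ 2) / lam).
    by rewrite h2; field; rewrite !gt_eqF//; lra.
  rewrite (_ : h ^+ 4 = h ^+ 2 * h ^+ 2); last by ring.
  rewrite ler_wpM2l ?sqr_ge0// h2; apply: (@le_trans _ _ (1 / lam)).
    by rewrite ler_wpM2r ?invr_ge0 ?(ltW lam0)//; lra.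
  by rewrite div1r lef_pV2 ?posrE//; lra.
have tt : t ^+ 2 <= rr ^+ 2 * h ^+ 4.
  rewrite -(real_normK (num_real t)).
  have -> : rr ^+ 2 * h ^+ 4 = (rr / sigma ^+ 2) ^+ 2.
    by rewrite -h2 exprMn -exprM.
  by rewrite ler_sqr ?nnegrE// (le_trans _ tl).
have cE : c - t = y (j + 1) * (h ^+ 2 - lam^-1) - h ^+ 2 / 2.
  by rewrite /c /t yS; field; rewrite gt_eqF.
have ct : `|y (j + 1) * (h ^+ 2 - lam^-1)| <= rr * h ^+ 4.
  by rewrite normrM ler_pM// ger0_norm.
move: ct; rewrite ler_norml => /andP[ct1 ct2].
have hh0 : 0 <= h ^+ 2 by exact: sqr_ge0.
have rh0 : 0 <= rr ^+ 2 * h ^+ 4 by rewrite mulr_ge0// exprn_ge0// ?ltW//; lra.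
rewrite /tilted eS; split.
  have -> : q (j + 1) = q j * (1 + t)^-1 by rewrite -qS mulfK// gt_eqF.
  have -> : q j * (1 + t)^-1 * (expR (x j ^+ 2 / 2) * expR c) =
    ((1 + t)^-1 * expR c) * (q j * expR (x j ^+ 2 / 2)) by ring.
  rewrite ler_wpM2r ?mulr_ge0 ?expR_ge0//.
  apply: (le_trans (ler_wpM2r (expR_ge0 c) b1)).
  rewrite -expRD ler_expR /step_err; move: cE ct2 tt hh0; move: (h ^+ 2) (h ^+ 4) => A B.
  lra.
rewrite -qS.
have -> : q (j + 1) * (1 + t) * expR (x j ^+ 2 / 2) =
  (1 + t) * expR (- c) * (q (j + 1) * (expR (x j ^+ 2 / 2) * expR c)).
  have : expR (- c) * expR c = 1 by rewrite -expRD addNr expR0.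
  move: (expR (- c)) (expR c) (expR (x j ^+ 2 / 2)) => C B A AB.
  have -> : (1 + t) * C * (q (j + 1) * (A * B)) = q (j + 1) * (1 + t) * A * (C * B) by ring.
  by rewrite AB mulr1.
rewrite ler_wpM2r ?mulr_ge0 ?expR_ge0//.
apply: (le_trans (ler_wpM2r (expR_ge0 _) b2)).
rewrite -expRD ler_expR /step_err; move: cE ct1 tt hh0 rh0; move: (h ^+ 2) (h ^+ 4) => A B.
lra.
Qed.

(** Half of a bound on the variation of the square over one cell, hence on the logarithmic variation
    of the normal density there. *)
Definition cell_err : R := (2 * rr + 1) * h ^+ 2 / 2.

Lemma Phi_cell_bounds j : `|y (j + 1)| <= rr ->
  let w := h * gpeak * expR (- (x (j + 1) ^+ 2 / 2)) in
  w <= expR cell_err * (Phi (x (j + 1)) - Phi (x j)) /\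
  Phi (x (j + 1)) - Phi (x j) <= expR cell_err * w.
Proof.
move=> yj w.
have xS : x (j + 1) = x j + h by exact: cellxS.
have xE : x (j + 1) = y (j + 1) * h by [].
have le : x j <= x (j + 1) by rewrite xS lerDl ltW.
have dE : x (j + 1) - x j = h by rewrite xS addrC addKr.
have bd u : x j <= u <= x (j + 1) -> `|u ^+ 2 - x (j + 1) ^+ 2| <= 2 * cell_err.
  move=> /andP[u1 u2]; rewrite subr_sqr normrM.
  have xr : `|x (j + 1)| <= rr * h.
    by rewrite xE normrM (gtr0_norm h0) ler_wpM2r// ltW.
  have n1 : `|u - x (j + 1)| <= h by rewrite ler0_norm; lra.
  have n2 : `|u + x (j + 1)| <= 2 * (rr * h) + h.
    have -> : u + x (j + 1) = (u - x (j + 1)) + 2 * x (j + 1) by ring.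
    rewrite (le_trans (ler_normD _ _))// [leRHS]addrC lerD// normrM ger0_norm//.
    by rewrite ler_wpM2l.
  have -> : 2 * cell_err = h * (2 * (rr * h) + h) by rewrite /cell_err; field.
  exact: ler_pM.
have g0 := @gpeak_gt0 R.
split.
  have H := @Phi_incr_ge R (x j) (x (j + 1)) (gpeak * expR (- (x (j + 1) ^+ 2 / 2) - cell_err)) le.
  have : (x (j + 1) - x j) * (gpeak * expR (- (x (j + 1) ^+ 2 / 2) - cell_err)) <= Phi (x (j + 1)) - Phi (x j).
    apply: H; first by rewrite mulr_ge0 ?expR_ge0 ?(ltW g0).
    move=> u /bd; rewrite ler_norml => /andP[_ u2].
    by rewrite normal01E ler_wpM2l ?(ltW g0)// ler_expR mulNr; lra.
  move=> /(ler_wpM2l (expR_ge0 cell_err)); apply: le_trans.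
  rewrite dE /w expRB.
  have e0 : expR cell_err != 0 by rewrite expR_eq0.
  by rewrite le_eqVlt; apply/orP; left; apply/eqP; field.
have := @Phi_incr_le R (x j) (x (j + 1)) (gpeak * expR (- (x (j + 1) ^+ 2 / 2) + cell_err)) le.
rewrite dE expRD /w.
have -> : expR cell_err * (h * gpeak * expR (- (x (j + 1) ^+ 2 / 2))) =
  h * (gpeak * (expR (- (x (j + 1) ^+ 2 / 2)) * expR cell_err)) by ring.
apply => u /bd; rewrite ler_norml => /andP[u1 _].
by rewrite normal01E ler_wpM2l ?(ltW g0)// -expRD ler_expR mulNr; lra.
Qed.

Variables (j0 : int) (n : nat).
Hypothesis win : forall i : nat, (i < n)%N -> `|y (j0 + i%:Z + 1)| <= rr.

(** The two [cell_err] replace the [Phi] increments of both cells by density values; at most [n]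
    steps of [tilted] lead from one cell to the other. *)
Lemma window_ratio i k : (i < n)%N -> (k < n)%N ->
  q (j0 + i%:Z + 1) * (Phi (x (j0 + k%:Z + 1)) - Phi (x (j0 + k%:Z))) <=
  expR (2 * cell_err + n%:R * step_err) *
  (q (j0 + k%:Z + 1) * (Phi (x (j0 + i%:Z + 1)) - Phi (x (j0 + i%:Z)))).
Proof.
move=> in_ kn.
have q0 i' : 0 <= q i' by have [] := @TP_is_pmf R mu sigma s2.
have se0 : 0 <= step_err.
  have rr0 : 0 <= rr := le_trans ler01 r1.
  by rewrite /step_err !addr_ge0 ?divr_ge0 ?mulr_ge0 ?sqr_ge0 ?exprn_ge0 ?(ltW h0) ?(ltW s0)//.
have t0 j : 0 <= tilted j by rewrite mulr_ge0 ?expR_ge0.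
have T : tilted (j0 + i%:Z + 1) <= expR (n%:R * step_err) * tilted (j0 + k%:Z + 1).
  rewrite expRM_natl.
  have E1 : 1 <= expR step_err by rewrite (le_trans _ (expR_ge1Dx _))// lerDl.
  apply: le_trans (_ : expR step_err ^+ n.-1 * tilted (j0 + k%:Z + 1) <= _); last first.
    by rewrite ler_wpM2r// ler_weXn2l// leq_pred.
  apply: (@ratio_chain R (fun i : nat => tilted (j0 + i%:Z + 1)) n.-1) => //; try lia.
  move=> l ln; have -> : j0 + l.+1%:Z + 1 = j0 + l%:Z + 1 + 1.
    by rewrite -addn1 PoszD !addrA.
  apply: tilted_step; first by apply: win; lia.
  have -> : j0 + l%:Z + 1 + 1 = j0 + l.+1%:Z + 1 by rewrite -addn1 PoszD !addrA.
  by apply: win; lia.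
have [_ P1] := Phi_cell_bounds (win kn).
have [P2 _] := Phi_cell_bounds (win in_).
move: P1 P2 T; rewrite /tilted.
set ji := j0 + i%:Z + 1; set jk := j0 + k%:Z + 1.
set vi := Phi (x ji) - _; set vk := Phi (x jk) - _.
set wi := expR (- (x ji ^+ 2 / 2)); set wk := expR (- (x jk ^+ 2 / 2)) => P1 P2 T.
have ei : expR (x ji ^+ 2 / 2) * wi = 1 by rewrite -expRD addrN expR0.
have ek : expR (x jk ^+ 2 / 2) * wk = 1 by rewrite -expRD addrN expR0.
have wi0 : 0 <= wi := expR_ge0 _; have wk0 : 0 <= wk := expR_ge0 _.
have hg0 : 0 <= h * gpeak by rewrite mulr_ge0 ?(ltW h0) ?(ltW (gpeak_gt0)).
apply: (le_trans (ler_wpM2l (q0 _) P1)).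
have -> : expR (2 * cell_err + n%:R * step_err) =
  expR cell_err * expR (n%:R * step_err) * expR cell_err.
  by rewrite -!expRD; congr expR; ring.
have qi : q ji = q ji * expR (x ji ^+ 2 / 2) * wi by rewrite -mulrA ei mulr1.
rewrite qi.
apply: (@le_trans _ _ (expR cell_err * wk * wi * (h * gpeak) *
   (expR (n%:R * step_err) * (q jk * expR (x jk ^+ 2 / 2))))).
  have -> : q ji * expR (x ji ^+ 2 / 2) * wi * (expR cell_err * (h * gpeak * wk)) =
    expR cell_err * wk * wi * (h * gpeak) * (q ji * expR (x ji ^+ 2 / 2)) by ring.
  rewrite ler_wpM2l//; apply: mulr_ge0 => //.
  by apply: mulr_ge0 => //; apply: mulr_ge0 => //; exact: expR_ge0.
have -> : expR cell_err * wk * wi * (h * gpeak) *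
   (expR (n%:R * step_err) * (q jk * expR (x jk ^+ 2 / 2))) =
   expR cell_err * expR (n%:R * step_err) * q jk * (expR (x jk ^+ 2 / 2) * wk) * (h * gpeak * wi) by ring.
rewrite ek mulr1.
have -> : expR cell_err * expR (n%:R * step_err) * expR cell_err * (q jk * vi) =
  expR cell_err * expR (n%:R * step_err) * q jk * (expR cell_err * vi) by ring.
by rewrite ler_wpM2l// !mulr_ge0 ?expR_ge0.
Qed.

End LocalRatio.

Section WindowComparison.
Context {R : realFieldType}.

Lemma telescope_int (f : int -> R) (j0 : int) (m : nat) :
  f j0 + \sum_(i < m) (f (j0 + (i : nat)%:Z + 1) - f (j0 + (i : nat)%:Z)) = f (j0 + m%:Z).
Proof.
elim: m => [|m IH]; first by rewrite big_ord0 !addr0.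
rewrite big_ord_recr/= addrA IH addrC subrK; congr f.
by rewrite -addrA [_ + 1]addrC -intS.
Qed.

Lemma cdf_window_close (u v : int -> R) (j0 : int) (n : nat) (E tau : R) :
  1 <= E -> {homo u : i j / i <= j} -> {homo v : i j / i <= j} ->
  (forall i, 0 <= u i <= 1) -> (forall i, 0 <= v i <= 1) ->
  u j0 <= tau -> v j0 <= tau -> 1 - u (j0 + n%:Z) <= tau -> 1 - v (j0 + n%:Z) <= tau ->
  (forall i k : nat, (i < n)%N -> (k < n)%N ->
    (u (j0 + i%:Z + 1) - u (j0 + i%:Z)) * (v (j0 + k%:Z + 1) - v (j0 + k%:Z)) <=
    E * ((u (j0 + k%:Z + 1) - u (j0 + k%:Z)) * (v (j0 + i%:Z + 1) - v (j0 + i%:Z)))) ->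
  forall j, u j - v j <= (E - 1) + 3 * tau.
Proof.
move=> E1 und vnd u01 v01 uj0 vj0 uj1 vj1 rat j.
have /andP[u00 _] := u01 j0; have /andP[v00 _] := v01 j0.
have [jj0|jj0] := leP j j0.
  have /andP[v0 _] := v01 j; have := und _ _ jj0; lra.
have [jj1|jj1] := leP (j0 + n%:Z) j.
  have /andP[_ u1] := u01 j; have := vnd _ _ jj1; lra.
have [m mE mn] : exists2 m : nat, j0 + m%:Z = j & (m <= n)%N.
  by exists `|(j - j0)%R|%N; move: jj0 jj1; clear; lia.
have := @ratio_cdf_close R (fun i : nat => u (j0 + i%:Z + 1) - u (j0 + i%:Z))
  (fun i : nat => v (j0 + i%:Z + 1) - v (j0 + i%:Z)) n E (u j0) (v j0) tau E1.
rewrite !telescope_int => K.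
have /andP[_ u11] := u01 (j0 + n%:Z); have /andP[_ v11] := v01 (j0 + n%:Z).
have K1 i : 0 <= u (j0 + i%:Z + 1) - u (j0 + i%:Z) by rewrite subr_ge0 und// lerDl.
have K2 i : 0 <= v (j0 + i%:Z + 1) - v (j0 + i%:Z) by rewrite subr_ge0 vnd// lerDl.
have h1 : 1 - tau <= u (j0 + n%:Z) by lra.
have h2 : 1 - tau <= v (j0 + n%:Z) by lra.
have := K _ _ (fun i : nat => K1 i) (fun i : nat => K2 i) u11 v11 h1 h2 rat m mn.
rewrite !telescope_int mE u00 v00 uj0 vj0 => /(_ isT isT).
lra.
Qed.

End WindowComparison.

(** * Sup and summed distance of the translated Poisson law to the normal one *)

Section TPNormal.
Context {R : realType}.
Variables (mu sigma : R).
Hypothesis s2 : 2 <= sigma.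

Let h := sigma^-1.
Let q := TP_pmf mu (sigma ^+ 2).
Let G := cdf_pmf q.
Let x j := cellx mu sigma j.

Let s0 : 0 < sigma. Proof. exact: lt_le_trans s2. Qed.
Let h0 : 0 < h. Proof. by rewrite invr_gt0. Qed.
Let qp : is_pmf q. Proof. exact: TP_is_pmf. Qed.

Let xE (j : int) : x j = h * (j%:~R - mu).
Proof. by rewrite /x /cellx mulrC. Qed.

Let half4 : expR (2^-1) <= expR 4 :> R. Proof. by rewrite ler_expR; lra. Qed.

Lemma TP_Phi_tail j : `|G j - Phi (x j)| <= expR 4 * expR (- `|x j|).
Proof.
have [xj|xj] := leP (x j) 0.
  rewrite (ler0_norm xj) opprK ler_norml.
  have g1 := TP_tail_left mu s2 j; rewrite -/q -/G -/h -xE in g1.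
  have p1 := Phi_tail_left (x j).
  have p2 := ler_wpM2r (expR_ge0 (x j)) half4.
  have g0 := cdf_pmf_ge0 qp j; have p0 := Phi_ge0 (x j).
  by apply/andP; split; rewrite -/G in g0; lra.
rewrite (ger0_norm (ltW xj)) ler_norml.
have g1 := TP_tail_right mu s2 j; rewrite -/q -/G -/h mulNr -xE in g1.
have p1 := Phi_tail_right (x j).
have p2 := ler_wpM2r (expR_ge0 (- x j)) half4.
have g0 := cdf_pmf_le1 qp j; have p0 := Phi_le1 (x j).
by apply/andP; split; rewrite -/G in g0; lra.
Qed.

Let G_nd : {homo G : i j / i <= j}.
Proof.
move=> i j ij; have -> : j = i + `|(j - i)%R|%N%:Z by lia.
elim: `|_|%N => [|k IH]; first by rewrite addr0.
apply: (le_trans IH); rewrite -addn1 PoszD addrA -subr_ge0 cdf_pmfS//.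
exact: qp.1.
Qed.

Let Phi_x_nd : {homo (Phi \o x) : i j / i <= j}.
Proof. by move=> i j ij; apply: Phi_nd; exact: cellx_le. Qed.

Lemma expR_le_lin (H : R) : 0 <= H <= 2^-1 -> expR H - 1 <= 2 * H.
Proof.
move=> /andP[H0 H1].
have := @expR_le_quad R H; rewrite ger0_norm// => /(_ H1).
have : H ^+ 2 <= H * 2^-1 by rewrite expr2 ler_wpM2l.
lra.
Qed.

(** The cubic order comes from [n] steps of quadratic error, [n] being of order [sigma * rho].
    Bounding the lower powers of [rho] by [rho ^ 3] and [h ^ 2] by [h] gives
    [10 = 3 + 4 + 1 + 2]. *)
Lemma window_err_bounds (rho : R) (n : nat) : 1 <= rho -> n%:R <= 2 * (sigma * rho) ->
  0 <= 2 * cell_err sigma (sigma * rho) + n%:R * step_err sigma (sigma * rho)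
    <= 10 * rho ^+ 3 / sigma.
Proof.
move=> rho1 nrr.
have h0' := ltW h0; have rho0 : 0 <= rho by exact: le_trans rho1.
have hh : h <= 1 by rewrite /h invf_le1// (le_trans _ s2)// ler1n.
have rr0 : 0 <= sigma * rho by rewrite mulr_ge0// ltW.
have ce0 : 0 <= step_err sigma (sigma * rho).
  rewrite /step_err -/h; do 2?apply: addr_ge0; do ?apply: mulr_ge0 => //; exact: exprn_ge0.
have ke0 : 0 <= cell_err sigma (sigma * rho).
  rewrite /cell_err -/h; do 2?apply: mulr_ge0 => //; last exact: exprn_ge0.
  by apply: addr_ge0 => //; exact: mulr_ge0.
apply/andP; split; first by apply: addr_ge0; exact: mulr_ge0.
apply: (@le_trans _ _ (2 * cell_err sigma (sigma * rho) +
    2 * (sigma * rho) * step_err sigma (sigma * rho))).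
  by rewrite lerD2l ler_wpM2r.
rewrite /cell_err /step_err -/h.
have -> : 2 * ((2 * (sigma * rho) + 1) * h ^+ 2 / 2) +
    2 * (sigma * rho) * (sigma * rho * h ^+ 4 + h ^+ 2 / 2 + 2 * (sigma * rho) ^+ 2 * h ^+ 4) =
    (3 * rho + 4 * rho ^+ 3) * h + (1 + 2 * rho ^+ 2) * h ^+ 2.
  by rewrite /h; field; rewrite gt_eqF.
rewrite -/h.
have rho3 : rho <= rho ^+ 3 by rewrite -[X in X <= _]expr1 ler_weXn2l.
have r23 : rho ^+ 2 <= rho ^+ 3 by rewrite ler_weXn2l.
have hh2 : h ^+ 2 <= h by rewrite expr2 ler_piMl.
have q1 : (1 + 2 * rho ^+ 2) * h ^+ 2 <= (1 + 2 * rho ^+ 2) * h.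
  by rewrite ler_wpM2l// addr_ge0// mulr_ge0// sqr_ge0.
have q2 : (3 * rho + 4 * rho ^+ 3 + (1 + 2 * rho ^+ 2)) * h <= 10 * rho ^+ 3 * h.
  by rewrite ler_wpM2r//; lra.
by move: q1 q2; rewrite mulrDl; lra.
Qed.

Lemma TP_Phi_sup_rho (rho : R) : 1 <= rho -> 10 * rho ^+ 3 / sigma <= 2^-1 ->
  forall j, `|G j - Phi (x j)| <= 20 * rho ^+ 3 / sigma + 3 * (expR 5 * expR (- rho)).
Proof.
move=> rho1 rhos j; have s2' := s2.
have s0' := s0; have h0' := h0.
have hs : h * sigma = 1 by rewrite /h mulVf// gt_eqF.
pose rr := sigma * rho.
have rr1 : 2 <= rr by rewrite /rr -[2]mulr1 ler_pM.
have rho3 : rho <= rho ^+ 3 by rewrite -[X in X <= _]expr1 ler_weXn2l.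
have rrs : rr <= sigma ^+ 2 / 2.
  have : 10 * rho / sigma <= 2^-1.
    apply: le_trans rhos; rewrite ler_wpM2r ?invr_ge0 ?(ltW s0)//; lra.
  rewrite ler_pdivrMr// => H.
  have : rho <= sigma / 2 by lra.
  by move=> /(ler_wpM2l (ltW s0')); rewrite -/rr expr2 -mulrA.
(* The margin of 1 keeps the lattice points of the window within [rr] of [mu] after rounding. It
   costs a factor [expR h] in the tails, hence [expR 5] instead of [expR 4]. *)
pose j0 : int := Num.floor (mu - (rr - 1)).
pose j1 : int := Num.floor (mu + (rr - 1)) + 1.
have a1 : (j0%:~R : R) <= mu - (rr - 1) by exact: floor_le.
have a2 : mu - (rr - 1) < j0%:~R + 1 by have := floorD1_gt (mu - (rr - 1)); rewrite intrD.
have b1 : (j1%:~R : R) <= mu + (rr - 1) + 1 by rewrite intrD lerD2r floor_le.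
have b2 : mu + (rr - 1) < j1%:~R by exact: floorD1_gt.
have j01 : j0 <= j1 by rewrite -(ler_int R); lra.
pose n := `|(j1 - j0)%R|%N.
have nE : j0 + n%:Z = j1 by rewrite /n gez0_abs ?subr_ge0// addrC subrK.
have nR : (n%:R : R) = j1%:~R - j0%:~R by rewrite -nE intrD addrC addKr.
have win i : (i < n)%N -> `|(j0 + i%:Z + 1)%:~R - mu| <= rr.
  move=> in_; have : (i.+1%:R : R) <= n%:R by rewrite ler_nat.
  have := ler0n R i.
  have -> : (j0 + i%:Z + 1)%:~R = j0%:~R + i%:R + 1 :> R by rewrite !intrD.
  by rewrite ler_norml -natr1 => i0 i1; apply/andP; split; lra.
pose tau := expR 5 * expR (- rho).
have tau0 : 0 <= tau by rewrite mulr_ge0 ?expR_ge0.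
have tail (z : R) : `|z| >= rr - 1 -> expR 4 * expR (- `|h * z|) <= tau.
  move=> zr; rewrite /tau -!expRD ler_expR normrM (gtr0_norm h0).
  have : h * (rr - 1) <= h * `|z| by rewrite ler_wpM2l// ltW.
  have -> : h * (rr - 1) = rho - h by rewrite mulrBr mulr1 /rr mulrA hs mul1r.
  have : h <= 1 by rewrite /h invf_le1//; lra.
  lra.
have tl : G j0 <= tau /\ Phi (x j0) <= tau.
  have z1 : j0%:~R - mu <= - (rr - 1) by lra.
  have := tail (j0%:~R - mu); rewrite -xE.
  have x0 : x j0 <= 0 by rewrite xE mulr_ge0_le0 ?(ltW h0)//; lra.
  rewrite (ler0_norm x0) opprK ler0_norm; last by lra.
  move=> /(_ ltac:(lra)) H.
  have g1 := TP_tail_left mu s2 j0; rewrite -/q -/G -/h -xE in g1.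
  have p1 := Phi_tail_left (x j0).
  have p2 := ler_wpM2r (expR_ge0 (x j0)) half4.
  by split; lra.
have tr : 1 - G j1 <= tau /\ 1 - Phi (x j1) <= tau.
  have z1 : rr - 1 <= j1%:~R - mu by lra.
  have := tail (j1%:~R - mu); rewrite -xE.
  have x0 : 0 <= x j1 by rewrite xE mulr_ge0 ?(ltW h0)//; lra.
  rewrite (ger0_norm x0) ger0_norm; last by lra.
  move=> /(_ ltac:(lra)) H.
  have g1 := TP_tail_right mu s2 j1; rewrite -/q -/G -/h mulNr -xE in g1.
  have p1 := Phi_tail_right (x j1).
  have p2 := ler_wpM2r (expR_ge0 (- x j1)) half4.
  by split; lra.
pose H := 2 * cell_err sigma rr + n%:R * step_err sigma rr.
have H1 : 0 <= H <= 10 * rho ^+ 3 / sigma.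
  by apply: window_err_bounds => //; rewrite nR -/rr; lra.
have /andP[H0 H2] := H1.
have EH : expR H - 1 <= 20 * rho ^+ 3 / sigma.
  have : expR H - 1 <= 2 * H by apply: expR_le_lin; rewrite H0 (le_trans H2).
  have -> : 20 * rho ^+ 3 / sigma = 2 * (10 * rho ^+ 3 / sigma) by ring.
  lra.
have E1 : 1 <= expR H by rewrite (le_trans _ (expR_ge1Dx _))// lerDl.
have ratio := @window_ratio R mu sigma rr s2 ltac:(lra) rrs j0 n win.
rewrite -/H in ratio.
have G0 i : 0 <= G i by exact: cdf_pmf_ge0.
have G1 i : G i <= 1 by exact: cdf_pmf_le1.
have [t1 t2] := tl; have [t3 t4] := tr.
have P01 i : 0 <= (Phi \o x) i <= 1 by rewrite Phi_ge0 Phi_le1.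
have G01 i : 0 <= G i <= 1 by rewrite G0 G1.
rewrite -nE in t3 t4.
(* The comparison is one-sided, so it is applied a second time with the two laws exchanged. *)
have c1 := @cdf_window_close R G (Phi \o x) j0 n _ _ E1 G_nd Phi_x_nd G01 P01 t1 t2 t3 t4.
have c2 := @cdf_window_close R (Phi \o x) G j0 n _ _ E1 Phi_x_nd G_nd P01 G01 t2 t1 t4 t3.
rewrite ler_norml; apply/andP; split.
  have : Phi (x j) - G j <= expR H - 1 + 3 * tau.
    apply: c2 => i k in_ kn; rewrite !cdf_pmfS//=.
    by have := ratio k i kn in_; rewrite -/q mulrC [X in _ <= _ * X]mulrC.
  rewrite -/tau; lra.
have : G j - Phi (x j) <= expR H - 1 + 3 * tau.
  by apply: c1 => i k in_ kn; rewrite !cdf_pmfS//=; exact: ratio.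
rewrite -/tau; lra.
Qed.

(** The increments of the logistic function [g] dominate [c / 8] times the summands on both sides of
    [mu], and they add up to at most 1. *)
Lemma sum_exp_dist (c : R) : 0 < c <= 1 ->
  l1le (fun j : int => expR (- (c * `|j%:~R - mu|))) (8 / c).
Proof.
move=> /andP[c0 c1] s us.
pose g (j : int) : R := (1 + expR (- (c * (j%:~R - mu))))^-1.
pose k := expR (- c) : R.
have k0 : 0 < k := expR_gt0 _.
have e0 (j : int) : 0 < expR (- (c * (j%:~R - mu))) := expR_gt0 _.
have k1 : k <= 1 - c / 2.
  have : k <= (1 + c)^-1.
    rewrite /k expRN lef_pV2 ?posrE ?expR_gt0//; [exact: expR_ge1Dx|lra].
  move=> /le_trans; apply; rewrite -div1r ler_pdivrMr; last by lra.
  rewrite -subr_ge0; have -> : (1 - c / 2) * (1 + c) - 1 = c / 2 * (1 - c) by field.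
  by rewrite mulr_ge0 ?divr_ge0 ?(ltW c0)// subr_ge0.
have gnd : {homo g : i j / i <= j}.
  move=> i j ij; rewrite /g lef_pV2 ?posrE ?ltr_pwDl ?expR_ge0//.
  by rewrite lerD2l ler_expR lerN2 ler_wpM2l ?(ltW c0)// lerD2r ler_int.
have g01 j : 0 <= g j <= 1.
  rewrite /g invr_ge0 addr_ge0 ?expR_ge0//= invf_le1 ?ltr_pwDl ?expR_ge0//.
  by rewrite lerDl expR_ge0.
have step (j : int) : c / 8 * expR (- (c * `|j%:~R - mu|)) <= g (j + 1) - g j.
  rewrite /g; set E := expR (- (c * (j%:~R - mu))).
  have E0 : 0 < E := expR_gt0 _.
  have -> : expR (- (c * ((j + 1)%:~R - mu))) = k * E.
    by rewrite /k /E -expRD; congr expR; rewrite intrD; ring.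
  have -> : (1 + k * E)^-1 - (1 + E)^-1 = E * (1 - k) / ((1 + k * E) * (1 + E)).
    field; rewrite !gt_eqF// ?ltr_pwDl ?ltW//; exact: mulr_gt0.
  have kE : k * E <= E by rewrite ler_piMl ?(ltW E0)//; lra.
  have kE0 : 0 < k * E by exact: mulr_gt0.
  have D0 : 0 < (1 + k * E) * (1 + E) by rewrite mulr_gt0//; lra.
  rewrite ler_pdivlMr//.
  have [yj|yj] := leP 0 (j%:~R - mu).
    rewrite (ger0_norm yj) -/E.
    have E1 : E <= 1.
      by rewrite /E expR_le1 oppr_le0 mulr_ge0// ltW.
    have : (1 + k * E) * (1 + E) <= 2 * 2 by rewrite ler_pM//; lra.
    have cE : 0 <= c / 8 * E by rewrite mulr_ge0 ?divr_ge0 ?(ltW c0) ?(ltW E0).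
    move=> /(ler_wpM2l cE) /le_trans; apply.
    have : E * (c / 2) <= E * (1 - k) by rewrite ler_wpM2l ?(ltW E0)//; lra.
    lra.
  rewrite (ltr0_norm yj) mulrN opprK.
  have EI : expR (c * (j%:~R - mu)) = E^-1 by rewrite /E expRN invrK.
  rewrite EI.
  have E1 : 1 <= E.
    by rewrite /E (le_trans _ (expR_ge1Dx _))// lerDl oppr_ge0 mulr_ge0_le0 ?(ltW c0)// ltW.
  have : (1 + k * E) * (1 + E) <= (2 * E) * (2 * E) by rewrite ler_pM//; lra.
  have cE : 0 <= c / 8 * E^-1 by rewrite mulr_ge0 ?divr_ge0 ?invr_ge0 ?(ltW c0) ?(ltW E0).
  move=> /(ler_wpM2l cE) /le_trans; apply.
  have -> : c / 8 * E^-1 * (2 * E * (2 * E)) = E * (c / 2) by field; rewrite gt_eqF.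
  by rewrite ler_wpM2l ?(ltW E0)//; lra.
have : \sum_(j <- s) (c / 8 * expR (- (c * `|j%:~R - mu|))) <= 1.
  by apply: le_trans (sum_increments gnd g01 us); apply: ler_sum => j _; exact: step.
rewrite -mulr_sumr => H.
under eq_bigr do rewrite ger0_norm ?expR_ge0//.
have -> : 8 / c = (c / 8)^-1 by field; rewrite gt_eqF.
by rewrite -[X in _ <= X]mulr1 ler_pdivlMl// divr_gt0.
Qed.

End TPNormal.

Section TPNormalRates.
Context {R : realType}.
Implicit Types (mu sigma delta : R).

(** Window radius [rho = sigma ^ (delta / 3)]: then [rho ^ 3 = sigma ^ delta], while the tail
    [expR (- rho)] is smaller than any power of [sigma]. *)
Lemma TP_Phi_sup delta : 0 < delta <= 2^-1 -> exists C : R, 0 <= C /\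
  forall mu sigma, 400 <= sigma -> forall j,
  `|cdf_pmf (TP_pmf mu (sigma ^+ 2)) j - Phi (cellx mu sigma j)| <=
    C * sigma `^ (delta - 1).
Proof.
move=> /andP[d0 d1].
(* Makes [rho ^ (m + 1) >= sigma], so one term of the exponential series gives a tail of order
   [1 / sigma]. *)
have [m md] : exists m : nat, 3 / delta < m%:R.
  by exists (Num.bound (3 / delta)); rewrite archi_boundP// divr_ge0// ltW.
exists (20 + 3 * (expR 5 * m.+1`!%:R)); split.
  by rewrite addr_ge0// !mulr_ge0// expR_ge0.
move=> mu sigma s400 j.
have s0 : 0 < sigma by lra.
have s1 : 1 <= sigma by lra.
pose rho := sigma `^ (delta / 3).
have rho1 : 1 <= rho by rewrite -(powRr0 sigma) ler_powR// divr_ge0// ltW.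
have rho3 : rho ^+ 3 = sigma `^ delta.
  by rewrite -powR_mulrn ?powR_ge0// -powRrM; congr powR; field.
have pB : sigma `^ (delta - 1) = sigma `^ delta / sigma.
  by rewrite powRB ?powRr1 ?(ltW s0)// (gt_eqF s0) implybT.
(* Origin of the threshold 400: the small parameter is at most [10 / sqrt sigma], which must not
   exceed one half. *)
have sq : 20 <= Num.sqrt sigma.
  rewrite -(ler_sqr (_ : 20 \is Num.nneg)) ?nnegrE ?sqrtr_ge0// sqr_sqrtr ?(ltW s0)//.
  by rewrite (_ : 20 ^+ 2 = 400); [|ring].
have small : 10 * rho ^+ 3 / sigma <= 2^-1.
  rewrite rho3 -mulrA -pB.
  have : sigma `^ (delta - 1) <= sigma `^ (- 2^-1) by rewrite ler_powR//; lra.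
  rewrite powRN powR12_sqrt ?(ltW s0)//.
  have : (Num.sqrt sigma)^-1 <= 20^-1 by rewrite lef_pV2 ?posrE//; lra.
  lra.
have s2 : 2 <= sigma by lra.
apply: (le_trans (TP_Phi_sup_rho mu s2 rho1 small j)).
have e1 : expR (- rho) <= m.+1`!%:R * sigma `^ (delta - 1).
  have H := @expR_ge1Dxn R rho m (le_trans ler01 rho1).
  have f0 : 0 < m.+1`!%:R :> R by rewrite ltr0n fact_gt0.
  have sm : sigma <= rho ^+ m.+1.
    rewrite -powR_mulrn ?powR_ge0// -powRrM -[X in X <= _]powRr1 ?(ltW s0)//.
    apply: ler_powR => //; rewrite -(natr1 m) mulrDr mulr1.
    have : 1 <= delta / 3 * m%:R.
      move: md; rewrite ltr_pdivrMr// => md.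
      by rewrite mulrAC ler_pdivlMr//; lra.
    have : 0 <= delta / 3 by rewrite divr_ge0// ltW.
    lra.
  have E : sigma / m.+1`!%:R <= expR rho.
    have : sigma / m.+1`!%:R <= rho ^+ m.+1 / m.+1`!%:R by rewrite ler_wpM2r// invr_ge0 ltW.
    lra.
  rewrite expRN (@le_trans _ _ (m.+1`!%:R / sigma))//.
    rewrite -[leRHS]invrK invf_div lef_pV2 ?posrE ?expR_gt0//.
    exact: divr_gt0.
  rewrite ler_wpM2l ?(ltW f0)// pB -[X in X <= _]mul1r ler_wpM2r ?invr_ge0 ?(ltW s0)//.
  by rewrite -(powRr0 sigma) ler_powR// ltW.
have := ler_wpM2l (expR_ge0 5) e1.
rewrite rho3 (_ : 20 * _ / sigma = 20 * sigma `^ (delta - 1)); last by rewrite pB mulrA.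
rewrite mulrA; lra.
Qed.

(** Interpolation: the sup bound raised to [1 - e] carries the rate, the exponential tail raised to
    [e] makes the sum finite at the price [8 * sigma / e]. With [e = delta / 2] the power of [sigma]
    is [2 * e - e ^ 2 <= delta]. *)
Lemma TP_Phi_l1 delta : 0 < delta <= 2^-1 -> exists C : R, 0 <= C /\
  forall mu sigma, 400 <= sigma ->
  l1le (fun j => cdf_pmf (TP_pmf mu (sigma ^+ 2)) j - Phi (cellx mu sigma j))
    (C * sigma `^ delta).
Proof.
move=> /andP[d0 d1]; pose e := delta / 2.
have e0 : 0 < e by rewrite divr_gt0.
have e1 : 0 < e <= 2^-1 by rewrite e0 /e; lra.
have [C [C0 HC]] := TP_Phi_sup e1.
pose K : R := expR 4.
exists (C `^ (1 - e) * K `^ e * (8 / e)); split.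
  by rewrite !mulr_ge0 ?powR_ge0 ?invr_ge0 ?(ltW e0).
move=> mu sigma s400.
have s0 : 0 < sigma by lra.
have s2 : 2 <= sigma by lra.
have s1 : 1 <= sigma by lra.
set D := fun j => _ - _.
pose A := (C * sigma `^ (e - 1)) `^ (1 - e).
have A0 : 0 <= A by exact: powR_ge0.
have c1 : 0 < e / sigma <= 1.
  rewrite divr_gt0//= ler_pdivrMr// mul1r.
  by move: e1 => /andP[_]; lra.
have pt j : `|D j| <= A * K `^ e * expR (- (e / sigma * `|j%:~R - mu|)).
  have h1 := HC mu sigma s400 j; rewrite -/(D j) in h1.
  have h2 := TP_Phi_tail mu s2 j; rewrite -/(D j) in h2.
  have -> : `|D j| = `|D j| `^ (1 - e) * `|D j| `^ e.
    rewrite -powRD ?subrK ?powRr1//.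
    by rewrite oner_eq0.
  have e1' : 0 <= 1 - e by move: e1 => /andP[_]; lra.
  have -> : A * K `^ e * expR (- (e / sigma * `|j%:~R - mu|)) =
      A * (expR 4 * expR (- `|cellx mu sigma j|)) `^ e.
    rewrite powRM ?expR_ge0// mulrA; congr (_ * _).
    rewrite -expRM; congr expR; rewrite /cellx normrM normfV (gtr0_norm s0).
    by ring.
  apply: ler_pM; rewrite ?powR_ge0//.
    by apply: ge0_ler_powR; rewrite ?nnegrE// mulr_ge0// powR_ge0.
  by apply: ge0_ler_powR; rewrite ?nnegrE ?(ltW e0)// mulr_ge0// expR_ge0.
have AK0 : 0 <= A * K `^ e by rewrite mulr_ge0// powR_ge0.
apply: (@l1le_le _ _ (A * K `^ e * (8 / (e / sigma)))).
  move=> s us; have := sum_exp_dist mu c1 us.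
  move=> /(ler_wpM2l AK0); apply: le_trans; rewrite mulr_sumr; apply: ler_sum => j _.
  by rewrite (ger0_norm (expR_ge0 _)).
have AE : A = C `^ (1 - e) * sigma `^ ((e - 1) * (1 - e)).
  by rewrite /A powRM ?powR_ge0// -powRrM.
have -> : A * K `^ e * (8 / (e / sigma)) =
  C `^ (1 - e) * K `^ e * (8 / e) * (sigma `^ ((e - 1) * (1 - e)) * sigma `^ 1).
  by rewrite AE powRr1 ?(ltW s0)//; field; rewrite !gt_eqF.
rewrite ler_wpM2l//; first by rewrite !mulr_ge0 ?powR_ge0 ?invr_ge0 ?(ltW e0).
rewrite -powRD; last by rewrite (gt_eqF s0) implybT.
rewrite ler_powR// -subr_ge0.
have -> : delta - ((e - 1) * (1 - e) + 1) = e ^+ 2 by rewrite /e; field.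
exact: sqr_ge0.
Qed.

End TPNormalRates.

(** * The law of [W], split according to the size of [N] *)

Section ModelFacts.
Context {d : measure_display} {T : measurableType d} {R : realType}.
Variables (P : probability T R) (W : T -> int) (N : T -> nat).
Hypothesis mW : int_rv W.
Hypothesis mN : forall n, measurable [set w | N w = n].

Let F := cdf_int P W.

Lemma measurable_int_preimage (A : set int) : measurable (W @^-1` A).
Proof.
have -> : W @^-1` A = \bigcup_n
    (if `[< A (int_of_nat n) >] then [set w | W w = int_of_nat n] else set0).
  apply/seteqP; split => w /=.
    have [_ _ surj] := int_of_nat_bij.
    have [n _ nE] := surj (W w) I; move=> AW; exists n => //.
    by rewrite nE; case: asboolP.
  by move=> [n _]; case: asboolP => // An /= ->.
by apply: bigcupT_measurable => n; case: ifP => // _; exact: mW.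
Qed.

Lemma measurable_nat_preimage (A : set nat) : measurable (N @^-1` A).
Proof.
have -> : N @^-1` A = \bigcup_n (if `[< A n >] then [set w | N w = n] else set0).
  apply/seteqP; split => w /=.
    by move=> AW; exists (N w) => //; case: asboolP.
  by move=> [n _]; case: asboolP => // An /= ->.
by apply: bigcupT_measurable => n; case: ifP => // _; exact: mN.
Qed.

Let mle j : measurable [set w | W w <= j].
Proof. exact: (measurable_int_preimage [set i | (i <= j)%R]). Qed.

Let fine01 (A : set T) : measurable A -> 0 <= fine (P A) <= 1.
Proof.
move=> mA; rewrite fine_ge0//= -lee_fin fineK ?probability_le1//.
exact: fin_num_measure.
Qed.

Variables (beta sigma : R).

Definition p_main (j : int) := fine (P [set w | beta * sigma ^+ 2 <= (N w)%:R /\ W w = j]).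
Definition p_rest (j : int) := fine (P [set w | (N w)%:R < beta * sigma ^+ 2 /\ W w = j]).

Let mbig : measurable [set w | beta * sigma ^+ 2 <= (N w)%:R].
Proof. exact: (measurable_nat_preimage [set n | beta * sigma ^+ 2 <= n%:R]). Qed.

Let msmall : measurable [set w | (N w)%:R < beta * sigma ^+ 2].
Proof. exact: (measurable_nat_preimage [set n | n%:R < beta * sigma ^+ 2]). Qed.

Lemma cdf_int_split j : F (j + 1) - F j = p_main (j + 1) + p_rest (j + 1).
Proof.
have fin (A : set T) : measurable A -> P A \is a fin_num by move=> ?; exact: fin_num_measure.
have mj : measurable [set w | W w = j + 1] by exact: mW.
have m1 : measurable [set w | beta * sigma ^+ 2 <= (N w)%:R /\ W w = j + 1].
  exact: (measurableI _ _ mbig mj).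
have m2 : measurable [set w | (N w)%:R < beta * sigma ^+ 2 /\ W w = j + 1].
  exact: (measurableI _ _ msmall mj).
have E1 : P [set w | W w <= j + 1] = (P [set w | (W w <= j)%R] + P [set w | W w = (j + 1)%R])%E.
  rewrite -measureU//; last first.
    by apply/seteqP; split => // w [/= h1 h2]; move: h1; rewrite h2; lia.
  congr (P _); apply/seteqP; split => w /=.
    by move=> h1; have [h|h] := leP (W w) j; [left|right; lia].
  by case; lia.
have E2 : P [set w | W w = j + 1] =
   (P [set w | (beta * sigma ^+ 2 <= (N w)%:R)%R /\ W w = (j + 1)%R] +
    P [set w | ((N w)%:R < beta * sigma ^+ 2)%R /\ W w = (j + 1)%R])%E.
  rewrite -measureU//; last first.
    by apply/seteqP; split => // w [/= [h1 _] [h2 _]]; move: h1; rewrite leNgt h2.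
  congr (P _); apply/seteqP; split => w /=.
    by move=> h1; have [h|h] := leP (beta * sigma ^+ 2) (N w)%:R; [left|right].
  by case=> [[]|[]].
rewrite /F /cdf_int E1 fineD ?fin// addrAC subrr add0r E2 fineD ?fin//.
Qed.

Lemma l1le_joint (A : set T) (c : R) : measurable A -> (P A <= c%:E)%E ->
  l1le (fun j => fine (P (A `&` [set w | W w = j]))) c.
Proof.
move=> mA PAc s us; rewrite -lee_fin; apply: le_trans PAc.
have mAj j : measurable (A `&` [set w | W w = j]) by apply: measurableI => //; exact: mW.
rewrite -sumEFin.
have -> : (\sum_(j <- s) (`|fine (P (A `&` [set w | W w = j]))|)%:E)%E =
    (\sum_(j <- s) P (A `&` [set w | W w = j]))%E.
  apply: eq_bigr => j _; rewrite ger0_norm ?fine_ge0// fineK//.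
  exact: fin_num_measure.
rewrite fsbig_seq// -measure_fin_bigcup//; last first.
  apply/trivIsetP => i j _ _ /eqP ij; apply/seteqP; split => // w [[_ /= h1] [_ /= h2]].
  by apply: ij; rewrite -h1 -h2.
apply: le_measure; rewrite ?inE//.
  by apply: fin_bigcup_measurable => // j _; exact: mAj.
by move=> w [j _ []].
Qed.

Lemma l1le_p_rest (eps : R) :
  (P [set w | ((N w)%:R < beta * sigma ^+ 2)%R] <= eps%:E)%E -> l1le p_rest eps.
Proof. exact: l1le_joint. Qed.

Lemma l1le_p_main : l1le p_main 1.
Proof. by apply: l1le_joint => //; exact: probability_le1. Qed.

Hypothesis s0 : 0 < sigma.
Let mu := mean_int P W.
Let H := cdf_std P W sigma.

Lemma cdf_std_cell j (x : R) : cellx mu sigma j <= x < cellx mu sigma (j + 1) -> H x = F j.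
Proof.
move=> /andP[x1 x2]; rewrite /H /cdf_std /cdf_real /F /cdf_int; congr (fine (P _)).
move: x1 x2; rewrite /cellx ler_pdivrMr// ltr_pdivlMr// => x1 x2.
apply/seteqP; split => w /=; rewrite /realW ler_pdivrMr// -/mu => h.
  have : (W w)%:~R < (j + 1)%:~R :> R by lra.
  by rewrite ltr_int; lia.
have : (W w)%:~R <= j%:~R :> R by rewrite ler_int.
lra.
Qed.

Lemma cdf_std_nd : nondecreasing_fun H.
Proof.
have mx (x : R) : measurable [set w | (realW W w - mean_int P W) / sigma <= x].
  exact: (measurable_int_preimage [set i | (i%:~R - mean_int P W) / sigma <= x]).
move=> x y xy; rewrite /H /cdf_std /cdf_real fine_le ?fin_num_measure//.
apply: le_measure; rewrite ?inE//.
by move=> w /= /le_trans; apply.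
Qed.

Lemma dK_fin : exists2 k : R, dK H Phi = k%:E & 0 <= k <= 1.
Proof.
have H01 x : 0 <= H x <= 1.
  have mx : measurable [set w | (realW W w - mean_int P W) / sigma <= x].
    exact: (measurable_int_preimage [set i | (i%:~R - mean_int P W) / sigma <= x]).
  exact: fine01.
have D1 : (dK H Phi <= 1)%E.
  apply: ge_ereal_sup => _ [x _ <-]; rewrite lee_fin ler_norml.
  have /andP[h1 h2] := H01 x; have h3 := Phi_ge0 x; have h4 := Phi_le1 x.
  by apply/andP; split; lra.
have D0 : (0 <= dK H Phi)%E.
  by apply: (le_trans (_ : 0 <= (`|H 0 - Phi 0|)%:E)%E) => //; apply: ereal_sup_ubound; exists 0.
have Df : dK H Phi \is a fin_num by rewrite ge0_fin_numE// (le_lt_trans D1)// ltry.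
exists (fine (dK H Phi)); first by rewrite fineK.
by rewrite fine_ge0//= -lee_fin fineK.
Qed.

End ModelFacts.

(** * Choice of the averaging length *)

Section Choice.
Context {R : realType}.
Variables (sigma c0 d theta : R).

(* The averaging length is [L ~ sigma * d ^ theta], where [d] is the distance
   to the normal law; the slack [theta] absorbs all error terms. *)
Lemma scale_choice : 0 < theta <= 4^-1 -> 0 < c0 -> c0 / sigma <= d <= 1 ->
  1 <= c0 * sigma -> 1 <= sigma ->
  exists2 L : nat, (0 < L)%N &
    sigma * d `^ theta <= L%:R /\
    (forall m : nat, 1 <= theta * m%:R -> (2 * L%:R) ^+ m <= 4 ^+ m * (sigma ^+ m * d)).
Proof.
move=> /andP[t0 t1] c00 /andP[cd d1] cs s1.
have s0 : 0 < sigma by lra.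
have d0 : 0 < d by apply: lt_le_trans cd; rewrite divr_gt0.
(* From [c0 / sigma <= d] and [1 <= c0 * sigma] follows [1 <= sigma ^ 2 * d]. As [theta <= 1 / 2],
   the target length is at least 1 and rounding it up costs at most a factor 2. *)
have sd1 : 1 <= sigma * d `^ 2^-1.
  rewrite powR12_sqrt ?(ltW d0)// -(ler_sqr (_ : 1 \is Num.nneg)) ?nnegrE ?mulr_ge0 ?sqrtr_ge0 ?(ltW s0)//.
  rewrite expr1n exprMn sqr_sqrtr ?(ltW d0)//; move: cd; rewrite ler_pdivrMr// => cd.
  by rewrite (le_trans cs)// expr2 mulrC -mulrA ler_wpM2l ?(ltW s0)// mulrC.
pose X := sigma * d `^ theta.
have X1 : 1 <= X.
  apply: (le_trans sd1); rewrite ler_wpM2l ?(ltW s0)//.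
  by apply: ger_powR; rewrite ?d0 ?d1//; lra.
have /andP[X2 X3] : (Num.truncn X)%:R <= X < (Num.truncn X).+1%:R.
  by rewrite truncn_itv//; lra.
exists (Num.truncn X).+1 => //; split; first exact: ltW.
move=> m tm.
have : (Num.truncn X).+1%:R <= 2 * X by rewrite -natr1; lra.
move=> LX; apply: (@le_trans _ _ ((4 * X) ^+ m)).
  by apply: lerXn2r; rewrite ?nnegrE; lra.
rewrite exprMn ler_wpM2l// /X exprMn ler_wpM2l ?exprn_ge0 ?(ltW s0)//.
rewrite -powR_mulrn ?powR_ge0// -powRrM -[X in _ <= X]powRr1 ?(ltW d0)//.
by apply: ger_powR; rewrite ?d0 ?d1.
Qed.

End Choice.

(** * Rates *)

Section RateOptimization.
Context {R : realType}.
Notation D := ('X - 1 : {poly R}).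
Variables (sigma d c0 theta A B E Cf : R) (l : nat) (p1 p2 q f : int -> R).
Hypothesis pqf : (fun j => p1 j + p2 j - q j) =1 act D f.
Hypotheses (A0 : 0 <= A) (B0 : 0 <= B) (E0 : 0 <= E) (Cf0 : 0 <= Cf).
Hypotheses (t14 : 0 < theta <= 4^-1) (c00 : 0 < c0) (cd1 : c0 / sigma <= d <= 1)
  (cs1 : 1 <= c0 * sigma) (s1 : 1 <= sigma).
Hypothesis tl : 1 <= theta * (2 * l).-1%:R.
Hypotheses (p1_1 : l1le p1 1) (q_1 : l1le q 1).
Hypothesis p1_smooth : l1le (act (D ^+ (2 * l)) p1) (A / sigma ^+ (2 * l)).
Hypothesis q_smooth : l1le (act (D ^+ (2 * l)) q) (B / sigma ^+ (2 * l)).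

Let s0 : 0 < sigma. Proof. exact: lt_le_trans s1. Qed.
Let d0 : 0 < d.
Proof. by case/andP: cd1 => + _; apply: lt_le_trans; rewrite divr_gt0. Qed.
Let d1 : d <= 1. Proof. by case/andP: cd1. Qed.
Let sd : sigma^-1 <= d / c0.
Proof. by case/andP: cd1 => + _; rewrite ler_pdivlMr// mulrC. Qed.
Let l_gt0 : (0 < l)%N.
Proof. by move: tl; case: l => //; rewrite muln0/= mulr0 ler10. Qed.

Let d_le (e : R) : 0 <= e <= 1 -> d <= d `^ e.
Proof.
move=> /andP[e0 e1]; rewrite -[X in X <= _]powRr1 ?(ltW d0)//.
by apply: ger_powR; rewrite ?d0 ?d1.
Qed.

(** The exchange rate: a division by [L] gains [1 / sigma] and loses [theta] in the exponent of
    [d]. *)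
Let invL (L : nat) (e : R) : (0 < L)%N -> sigma * d `^ theta <= L%:R ->
  d `^ e / L%:R <= d `^ (e - theta) / sigma.
Proof.
move=> L0 Lge; rewrite powRB; last by rewrite (gt_eqF d0) implybT.
rewrite -mulrA ler_wpM2l ?powR_ge0// -invfM lef_pV2 ?posrE ?ltr0n//.
  by rewrite mulrC.
by rewrite mulr_gt0// powR_gt0.
Qed.

(** One difference is spent to leave l1, but the bound keeps order [sigma ^ (- 2 l)]; the spare
    [1 / sigma] is the one in the local rates. *)
Let sup_smooth (p : int -> R) a : l1le p 1 -> l1le (act (D ^+ (2 * l)) p) a ->
  forall j, `|act (D ^+ (2 * l).-1) p j| <= a.
Proof.
move=> pl1 pa; apply: (@l1le_sup_diff _ _ _ (pnorm (D ^+ (2 * l).-1) * 1)).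
  exact: l1le_act.
apply: l1le_ext pa => j; rewrite -actM -exprS prednK//.
by rewrite muln_gt0.
Qed.

Let main_sup (L : nat) : (0 < L)%N ->
  (forall m : nat, 1 <= theta * m%:R -> (2 * L%:R) ^+ m <= 4 ^+ m * (sigma ^+ m * d)) ->
  (2 * L%:R) ^+ (2 * l).-1 * (A / sigma ^+ (2 * l) + B / sigma ^+ (2 * l)) <=
    4 ^+ (2 * l).-1 * (A + B) * d / sigma.
Proof.
move=> L0 Lle; rewrite -mulrDl.
apply: (@le_trans _ _ (4 ^+ (2 * l).-1 * (sigma ^+ (2 * l).-1 * d) * ((A + B) / sigma ^+ (2 * l)))).
  by rewrite ler_wpM2r ?Lle// divr_ge0 ?addr_ge0// exprn_ge0// ltW.
have -> : sigma ^+ (2 * l) = sigma * sigma ^+ (2 * l).-1.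
  by rewrite -exprS prednK// muln_gt0.
rewrite le_eqVlt; apply/orP; left; apply/eqP; field.
by rewrite expf_neq0 ?gt_eqF.
Qed.

Lemma dloc_rate_sup : (forall j, `|p2 j| <= E / sigma ^+ 2) ->
  (forall j, `|f j| <= Cf * d `^ (1 - theta)) ->
  forall j, `|p1 j + p2 j - q j| <=
    (4 ^+ (2 * l).-1 * (A + B) + 2 ^+ (2 * l).-1 * (E / c0) + 2 ^+ (2 * l).-1 * 2 * Cf) / sigma
    * d `^ (1 - 2 * theta).
Proof.
move=> p2E fC j.
have [L L0 [Lge Lle]] := scale_choice t14 c00 cd1 cs1 s1.
apply: (le_trans (dloc_le_sup L0 pqf (sup_smooth p1_1 p1_smooth) (sup_smooth q_1 q_smooth)
  p2E fC j)).
have h1 := main_sup L0 Lle.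
have dd : d <= d `^ (1 - 2 * theta) by apply: d_le; case/andP: t14 => ? ?; lra.
have h3 := invL (1 - theta) L0 Lge.
have e3 : 1 - theta - theta = 1 - 2 * theta by ring.
rewrite e3 in h3.
rewrite 2!(mulrDl _ _ sigma^-1) 2!(mulrDl _ _ (d `^ _)).
apply: lerD; first apply: lerD.
- apply: (le_trans h1); rewrite mulrAC -!mulrA.
  do 2 (apply: ler_wpM2l; rewrite ?addr_ge0 ?exprn_ge0//).
  by rewrite ler_wpM2l ?invr_ge0 ?(ltW s0).
(* Of the two factors [1 / sigma] of the rough part, one is kept and the other is exchanged for
   [d / c0]. *)
- rewrite -!mulrA; apply: ler_wpM2l; rewrite ?exprn_ge0//; apply: ler_wpM2l => //.
  rewrite expr2 invfM mulrCA ler_wpM2l ?invr_ge0 ?(ltW s0)//.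
  by rewrite (le_trans sd)// mulrC ler_wpM2l ?invr_ge0 ?(ltW c00).
- rewrite -!mulrA; do 2 (apply: ler_wpM2l; rewrite ?exprn_ge0//).
  by rewrite mulrCA ler_wpM2l// mulrC (le_trans h3)// mulrC.
Qed.

Lemma dloc_rate_l1 : (forall j, `|p2 j| <= E / sigma ^+ 2) ->
  l1le f (Cf * (sigma * d `^ (1 - theta))) ->
  forall j, `|p1 j + p2 j - q j| <=
    (4 ^+ (2 * l).-1 * (A + B) + 2 ^+ (2 * l).-1 * (E / c0) + 2 ^+ (2 * l).-1 * 2 * Cf) / sigma
    * d `^ (1 - 3 * theta).
Proof.
move=> p2E fC j.
have [L L0 [Lge Lle]] := scale_choice t14 c00 cd1 cs1 s1.
apply: (le_trans (dloc_le_l1 L0 pqf (sup_smooth p1_1 p1_smooth) (sup_smooth q_1 q_smooth)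
  p2E fC j)).
have h1 := main_sup L0 Lle.
have dd : d <= d `^ (1 - 3 * theta) by apply: d_le; case/andP: t14 => ? ?; lra.
have h3 := invL (1 - theta) L0 Lge.
have h4 := invL (1 - 2 * theta) L0 Lge.
have e3 : 1 - theta - theta = 1 - 2 * theta by ring.
have e4 : 1 - 2 * theta - theta = 1 - 3 * theta by ring.
rewrite e3 in h3; rewrite e4 in h4.
rewrite 2!(mulrDl _ _ sigma^-1) 2!(mulrDl _ _ (d `^ _)).
apply: lerD; first apply: lerD.
- apply: (le_trans h1); rewrite mulrAC -!mulrA.
  do 2 (apply: ler_wpM2l; rewrite ?addr_ge0 ?exprn_ge0//).
  by rewrite ler_wpM2l ?invr_ge0 ?(ltW s0).
- rewrite -!mulrA; apply: ler_wpM2l; rewrite ?exprn_ge0//; apply: ler_wpM2l => //.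
  rewrite expr2 invfM mulrCA ler_wpM2l ?invr_ge0 ?(ltW s0)//.
  by rewrite (le_trans sd)// mulrC ler_wpM2l ?invr_ge0 ?(ltW c00).
- rewrite -!mulrA; do 2 (apply: ler_wpM2l; rewrite ?exprn_ge0//).
  rewrite mulrCA ler_wpM2l// [leRHS]mulrC; apply: (le_trans _ h4).
  have L0' : 0 <= (L%:R : R)^-1 by rewrite invr_ge0.
  have : d `^ (1 - theta) / L%:R * (sigma / L%:R) <= d `^ (1 - 2 * theta) / sigma * (sigma / L%:R).
    by rewrite ler_wpM2r// mulr_ge0// ltW.
  rewrite (_ : _ / sigma * (sigma / _) = d `^ (1 - 2 * theta) / L%:R); last first.
    by rewrite mulrA divfK ?gt_eqF.
  apply: le_trans; rewrite le_eqVlt; apply/orP; left; apply/eqP; ring.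
Qed.

(** Everything stays in l1, so all [2 l] differences are available, and the single division by [L]
    compensates the factor [sigma] in the bound on [f]. *)
Lemma dTV_rate_l1 : l1le p2 (E / sigma) ->
  l1le f (Cf * (sigma * d `^ (1 - theta))) ->
  l1le (fun j => p1 j + p2 j - q j)
    ((4 ^+ (2 * l) * (A + B) + 2 ^+ (2 * l) * (E / c0) + 2 ^+ (2 * l) * 2 * Cf)
    * d `^ (1 - 2 * theta)).
Proof.
move=> p2E fC.
have [L L0 [Lge Lle]] := scale_choice t14 c00 cd1 cs1 s1.
apply: (l1le_le (dTV_le_l1 L0 pqf p1_smooth q_smooth p2E fC)).
have dd : d <= d `^ (1 - 2 * theta) by apply: d_le; case/andP: t14 => ? ?; lra.
have h3 := invL (1 - theta) L0 Lge.
have e3 : 1 - theta - theta = 1 - 2 * theta by ring.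
rewrite e3 in h3.
rewrite 2!(mulrDl _ _ (d `^ _)).
apply: lerD; first apply: lerD.
- rewrite -mulrDl.
  have tl' : 1 <= theta * (2 * l)%:R.
    by apply: (le_trans tl); rewrite ler_wpM2l ?ler_nat ?leq_pred//; case/andP: t14 => /ltW.
  apply: (@le_trans _ _ (4 ^+ (2 * l) * (sigma ^+ (2 * l) * d) * ((A + B) / sigma ^+ (2 * l)))).
    by rewrite ler_wpM2r ?Lle// divr_ge0 ?addr_ge0// exprn_ge0// ltW.
  rewrite (_ : _ * _ * _ = 4 ^+ (2 * l) * (A + B) * d); last first.
    by field; rewrite expf_neq0 ?gt_eqF.
  by rewrite ler_wpM2l// mulr_ge0 ?addr_ge0// exprn_ge0.
- rewrite -!mulrA; apply: ler_wpM2l; rewrite ?exprn_ge0//; apply: ler_wpM2l => //.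
  by rewrite (le_trans sd)// mulrC ler_wpM2l ?invr_ge0 ?(ltW c00).
- rewrite -!mulrA; do 2 (apply: ler_wpM2l; rewrite ?exprn_ge0//).
  rewrite mulrCA ler_wpM2l//.
  have : d `^ (1 - theta) / L%:R * sigma <= d `^ (1 - 2 * theta) / sigma * sigma.
    by rewrite ler_wpM2r// ltW.
  rewrite divfK ?gt_eqF//; apply: le_trans.
  rewrite le_eqVlt; apply/orP; left; apply/eqP; ring.
Qed.

End RateOptimization.

Section LatticeConstant.
Context {R : realType}.

(** A common constant for the Kolmogorov ([m0 / 4]) and Wasserstein ([m0 / 16]) lattice bounds,
    capped at 1 for [powR_rate]. *)
Definition lattice_const : R := Num.min 1 (gpeak * expR (- 2^-1) / 16).

Lemma lattice_const_gt0 : 0 < lattice_const.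
Proof. by rewrite lt_min ltr01/= !mulr_gt0 ?gpeak_gt0 ?expR_gt0. Qed.

(** The lattice bound raised to the power [1 - theta]; [c0 <= 1] gives [c0 <= c0 ^ (1 - theta)]. *)
Lemma powR_rate (c0 sigma d theta : R) : 0 < c0 <= 1 -> 0 < sigma -> 0 <= theta <= 1 ->
  c0 / sigma <= d -> sigma `^ (theta - 1) <= d `^ (1 - theta) / c0.
Proof.
move=> /andP[c00 c01] s0 /andP[t0 t1] cd.
have t1' : 0 <= 1 - theta by lra.
rewrite ler_pdivlMr// -opprB -mulN1r powRrM powR_inv1 ?(ltW s0)//.
apply: (@le_trans _ _ ((c0 / sigma) `^ (1 - theta))); last first.
  by apply: ge0_ler_powR; rewrite ?nnegrE// ?divr_ge0 ?(ltW s0) ?(ltW c00)//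
    (le_trans _ cd)// divr_ge0 ?(ltW s0) ?(ltW c00).
rewrite powRM ?invr_ge0 ?(ltW s0) ?(ltW c00)// mulrC ler_wpM2r ?powR_ge0//.
rewrite -[X in X <= _]powRr1 ?(ltW c00)//; apply: ger_powR; rewrite ?c00//; lra.
Qed.

End LatticeConstant.

(** * Rates for a single member of the family *)

Section Member.
Context {d : measure_display} {T : measurableType d} {R : realType}.
Variables (P : probability T R) (FF : set (set T)) (N : T -> nat) (Y : T -> int)
  (Z : nat -> T -> int) (W : T -> int) (u beta k Ct sigma : R).
Hypotheses (u0 : 0 < u) (beta0 : 0 < beta) (s400 : 400 <= sigma).
Hypothesis mh : model_hyp P FF N Y Z W u beta k Ct sigma.
Notation D := ('X - 1 : {poly R}).
Notation c0 := (@lattice_const R).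

Let mu := mean_int P W.
Let q := TP_pmf mu (sigma ^+ 2).
Let F := cdf_int P W.
Let G := cdf_pmf q.
Let H := cdf_std P W sigma.
(** Shifted by one because [Dif F j] is the mass at [j + 1]. *)
Let p1 j := p_main P W N beta sigma (j + 1).
Let p2 j := p_rest P W N beta sigma (j + 1).
Let q1 j := q (j + 1).
Let f j := F j - G j.

Let s0 : 0 < sigma. Proof. by have h := s400; lra. Qed.
Let s1 : 1 <= sigma. Proof. by have h := s400; lra. Qed.
Let s2 : 2 <= sigma. Proof. by have h := s400; lra. Qed.
Let s4 : 4 <= sigma. Proof. by have h := s400; lra. Qed.
Let qpmf : is_pmf q. Proof. exact: TP_is_pmf. Qed.

Let mW : int_rv W. Proof. by case: mh => _ [_ [[_ [_ ?]] _]]. Qed.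
Let mN n : measurable [set w | N w = n].
Proof. by case: mh => [[_ sub] [FN _]]; exact/sub. Qed.

Let cell j x : cellx mu sigma j <= x < cellx mu sigma (j + 1) -> H x = F j.
Proof. exact: cdf_std_cell. Qed.
Let Hnd : {homo H : x y / x <= y}.
Proof. exact: cdf_std_nd. Qed.

Lemma Dif_cdfB j : Dif F j - Dif G j = p1 j + p2 j - q1 j.
Proof.
by rewrite Dif_cdf_pmf// /Dif (cdf_int_split P mW mN beta sigma).
Qed.

Let pqf : (fun j => p1 j + p2 j - q1 j) =1 act D f.
Proof.
move=> j; rewrite -Dif_cdfB actB actX act1 /Dif /f; ring.
Qed.

Let p1_1 : l1le p1 1.
Proof. by apply: l1le_shift; exact: l1le_p_main. Qed.

Let q1_1 : l1le q1 1.
Proof.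
apply: l1le_shift; apply/l1leP; rewrite -qpmf.2 le_eqVlt; apply/orP; left; apply/eqP.
by apply: eq_esum => j _; rewrite ger0_norm// qpmf.1.
Qed.

Definition model_const (l : nat) : R := (8 * l%:R * l.+1%:R / (Num.min u 1 * beta)) ^+ l.
Definition poisson_const (l : nat) : R := (8 * l%:R * l.+1%:R) ^+ l.

Let p1_smooth l : l1le (act (D ^+ (2 * l)) p1) (model_const l / sigma ^+ (2 * l)).
Proof.
rewrite /model_const (exprM sigma) -expr_div_n.
apply: (@l1le_ext _ (fun j => act (D ^+ (2 * l)) (p_main P W N beta sigma) (j + 1))).
  by move=> j; rewrite -act_shift.
apply: l1le_shift; apply: (l1le_le (model_smooth l u0 beta0 s0 mh)).
by rewrite mulrA invfM mulrA.
Qed.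

Let q1_smooth l : l1le (act (D ^+ (2 * l)) q1) (poisson_const l / sigma ^+ (2 * l)).
Proof.
rewrite /poisson_const (exprM sigma) -expr_div_n.
apply: (@l1le_ext _ (fun j => act (D ^+ (2 * l)) q (j + 1))).
  by move=> j; rewrite -act_shift.
by apply: l1le_shift; exact: TP_smooth.
Qed.

(** Taken at [n = 2] for the local bounds and [n = 1] for total variation. The absolute value is
    there because [Ct] has no prescribed sign. *)
Let p2_tail (n : nat) : n%:R <= k -> l1le p2 (`|Ct| / sigma ^+ n).
Proof.
move=> nk; apply: l1le_shift; apply: l1le_p_rest => //.
case: mh => _ [_ [_ [_ [_ [_ tl]]]]]; apply: (le_trans tl).
rewrite lee_fin; apply: (@le_trans _ _ (`|Ct| * sigma `^ (- k))).
  by rewrite ler_wpM2r ?powR_ge0// ler_norm.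
rewrite ler_wpM2l// -powR_mulrn ?(ltW s0)// -powRN.
by rewrite ler_powR// lerN2.
Qed.

Let c0_ge0 : 0 <= c0. Proof. exact: (ltW lattice_const_gt0). Qed.
Let c01 : 0 < c0 <= 1. Proof. by rewrite lattice_const_gt0/= ge_min lexx. Qed.

Variables (theta : R) (l : nat).
Hypotheses (t14 : 0 < theta <= 4^-1) (tl : 1 <= theta * (2 * l).-1%:R).
Hypothesis cs1 : 1 <= c0 * sigma.

Definition rate_const (m : nat) (Cf : R) :=
  4 ^+ m * (model_const l + poisson_const l) + 2 ^+ m * (`|Ct| / c0) + 2 ^+ m * 2 * Cf.

Let model_const_ge0 : 0 <= model_const l.
Proof.
apply: exprn_ge0; apply: divr_ge0; first by rewrite !mulr_ge0.
by rewrite mulr_ge0 ?(ltW beta0)// le_min ler01 (ltW u0).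
Qed.

Let poisson_const_ge0 : 0 <= poisson_const l.
Proof. by apply: exprn_ge0; rewrite !mulr_ge0. Qed.

Lemma rate_const_ge0 m Cf : 0 <= Cf -> 0 <= rate_const m Cf.
Proof.
move=> Cf0; apply: addr_ge0; first apply: addr_ge0.
- by apply: mulr_ge0; [exact: exprn_ge0|exact: addr_ge0].
- by apply: mulr_ge0; [exact: exprn_ge0|exact: divr_ge0].
- by apply: mulr_ge0 => //; apply: mulr_ge0 => //; exact: exprn_ge0.
Qed.

Let t01 : 0 <= theta <= 1. Proof. by have := t14 => /andP[? ?]; apply/andP; split; lra. Qed.

Lemma dloc_dK_member C (kk : R) : 0 <= C ->
  (forall j, `|G j - Phi (cellx mu sigma j)| <= C * sigma `^ (theta - 1)) ->
  2 <= k -> dK H Phi = kk%:E -> kk <= 1 -> forall j,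
  `|Dif F j - Dif G j| <= rate_const (2 * l).-1 (1 + C / c0) / sigma * kk `^ (1 - 2 * theta).
Proof.
move=> C0 CG k2 dKE kk1 j; rewrite Dif_cdfB.
have ckk : c0 / sigma <= kk.
  apply: (le_trans _ (dK_ge_lattice s0 cell s4 dKE)).
  rewrite ler_wpM2r ?invr_ge0 ?(ltW s0)// ge_min; apply/orP; right.
  by rewrite ler_wpM2l ?mulr_ge0 ?expR_ge0 ?(ltW gpeak_gt0)// lef_pV2 ?posrE//; lra.
have kk0 : 0 <= kk by rewrite (le_trans _ ckk)// divr_ge0// ltW.
apply: (dloc_rate_sup pqf model_const_ge0 poisson_const_ge0 (normr_ge0 Ct) _ t14 (andP c01).1
  _ cs1 s1 tl p1_1 q1_1 (p1_smooth l) (q1_smooth l)).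
- by rewrite addr_ge0// divr_ge0.
- by rewrite ckk kk1.
- by move=> i; apply: (l1le_pt i (p2_tail _)).
move=> i; rewrite mulrDl mul1r.
have -> : f i = (F i - Phi (cellx mu sigma i)) - (G i - Phi (cellx mu sigma i)) by rewrite /f; ring.
apply: (le_trans (ler_normB _ _)); apply: lerD.
  apply: (le_trans (dK_cell s0 cell i dKE)).
  have [->|kn0] := eqVneq kk 0; first exact: powR_ge0.
  have kp : 0 < kk by rewrite lt_neqAle eq_sym kn0.
  rewrite -[X in X <= _]powRr1//; apply: ger_powR; rewrite ?kp//.
  by case/andP: t01 => ? ?; lra.
apply: (le_trans (CG i)); rewrite -mulrA ler_wpM2l// mulrC.
exact: powR_rate.
Qed.

(** The Riemann sum error 1 of [l1le_cells] is at most [sigma * w / c0] by the lattice bound, whence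
    the summand [c0^-1]. *)
Let f_l1 C (w : R) : 0 <= C ->
  l1le (fun j => G j - Phi (cellx mu sigma j)) (C * sigma `^ theta) ->
  dW H Phi = w%:E -> w <= 1 -> c0 / sigma <= w /\
  l1le f ((1 + c0^-1 + C / c0) * (sigma * w `^ (1 - theta))).
Proof.
move=> C0 CG dWE w1.
have cw : c0 / sigma <= w.
  rewrite -lee_fin -dWE; apply: (le_trans _ (dW_ge_lattice s0 cell Hnd s4)).
  by rewrite lee_fin ler_wpM2r ?invr_ge0 ?(ltW s0)// ge_min lexx orbT.
have w0 : 0 < w by rewrite (lt_le_trans _ cw)// divr_gt0//; case/andP: c01.
have ww : w <= w `^ (1 - theta).
  rewrite -[X in X <= _]powRr1 ?(ltW w0)//; apply: ger_powR; rewrite ?w0//.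
  by case/andP: t01 => ? ?; lra.
split=> //.
apply: (@l1le_ext _ (fun i => (F i - Phi (cellx mu sigma i)) - (G i - Phi (cellx mu sigma i)))).
  by move=> i; rewrite /f; ring.
apply: (l1le_le (l1leB (l1le_cells s0 cell Hnd dWE) CG)).
rewrite 2!mulrDl mul1r; apply: lerD; first apply: lerD.
- by rewrite ler_wpM2l// ltW.
- rewrite -div1r mulrAC mul1r ler_pdivlMr ?(andP c01).1// mul1r.
  rewrite (@le_trans _ _ (sigma * w))//; last by rewrite ler_wpM2l// ltW.
  by move: cw; rewrite ler_pdivrMr// mulrC.
- rewrite -mulrA ler_wpM2l//.
  have -> : sigma `^ theta = sigma * sigma `^ (theta - 1).
    rewrite -{2}[sigma]powRr1 ?(ltW s0)// -powRD; first by congr powR; ring.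
    by rewrite (gt_eqF s0) implybT.
  by rewrite mulrCA ler_wpM2l ?(ltW s0)// mulrC; exact: powR_rate.
Qed.

Lemma dloc_dW_member C (w : R) : 0 <= C ->
  l1le (fun j => G j - Phi (cellx mu sigma j)) (C * sigma `^ theta) ->
  2 <= k -> dW H Phi = w%:E -> w <= 1 -> forall j,
  `|Dif F j - Dif G j| <=
    rate_const (2 * l).-1 (1 + c0^-1 + C / c0) / sigma * w `^ (1 - 3 * theta).
Proof.
move=> C0 CG k2 dWE w1 j; rewrite Dif_cdfB.
have [cw fl1] := f_l1 C0 CG dWE w1.
apply: (dloc_rate_l1 pqf model_const_ge0 poisson_const_ge0 (normr_ge0 Ct) _ t14 (andP c01).1
  _ cs1 s1 tl p1_1 q1_1 (p1_smooth l) (q1_smooth l)) => //.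
- by rewrite !addr_ge0// ?divr_ge0// invr_ge0.
- by rewrite cw w1.
- by move=> i; apply: (l1le_pt i (p2_tail _)).
Qed.

Lemma dTV_dW_member C (w : R) : 0 <= C ->
  l1le (fun j => G j - Phi (cellx mu sigma j)) (C * sigma `^ theta) ->
  1 <= k -> dW H Phi = w%:E -> w <= 1 ->
  l1le (fun j => Dif F j - Dif G j)
    (rate_const (2 * l) (1 + c0^-1 + C / c0) * w `^ (1 - 2 * theta)).
Proof.
move=> C0 CG k1 dWE w1.
have [cw fl1] := f_l1 C0 CG dWE w1.
apply: (@l1le_ext _ (fun j => p1 j + p2 j - q1 j)); first by move=> j; rewrite Dif_cdfB.
refine (dTV_rate_l1 pqf model_const_ge0 poisson_const_ge0 (normr_ge0 Ct) _ t14 (andP c01).1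
  _ cs1 s1 tl (p1_smooth l) (q1_smooth l) _ fl1) => //.
- by rewrite !addr_ge0// ?divr_ge0// invr_ge0.
- by rewrite cw w1.
- by rewrite -[sigma]expr1; exact: p2_tail.
Qed.

(** A crude bound for the case of Wasserstein distance above 1: three pieces of mass at most 1. *)
Lemma l1le_Dif_cdfB : l1le (fun j => Dif F j - Dif G j) 3.
Proof.
apply: (@l1le_ext _ (fun j => p1 j + p2 j - q1 j)); first by move=> j; rewrite Dif_cdfB.
have -> : 3 = 1 + 1 + 1 :> R by ring.
apply: l1leB => //; apply: l1leD => //; apply: l1le_shift.
apply: l1le_p_rest => //; apply: probability_le1.
exact: (measurable_nat_preimage mN [set n | n%:R < beta * sigma ^+ 2]).
Qed.

End Member.

(** * Choice of [theta] and uniform constants *)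

Section Conclusion.
Context {R : realType}.
Notation c0 := (@lattice_const R).

Lemma smoothing_order (theta : R) : 0 < theta -> exists l : nat, 1 <= theta * (2 * l).-1%:R.
Proof.
move=> t0; exists (Num.bound theta^-1).+1.
have h : theta^-1 < (Num.bound theta^-1)%:R by rewrite archi_boundP// invr_ge0 ltW.
rewrite -ler_pdivrMl// mulr1 (le_trans (ltW h))//.
by rewrite ler_nat; lia.
Qed.

Lemma dloc_le (F G : int -> R) (b : R) :
  (forall j, `|Dif F j - Dif G j| <= b) -> (dloc F G <= b%:E)%E.
Proof. by move=> h; apply: ge_ereal_sup => _ [j _ <-]; rewrite lee_fin. Qed.

Lemma dTV_le (F G : int -> R) (b : R) :
  l1le (fun j => Dif F j - Dif G j) b -> (dTV F G <= (2^-1 * b)%:E)%E.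
Proof. by move=> /l1leP h; rewrite /dTV EFinM; apply: lee_wpmul2l. Qed.

Lemma dW_ge0 (F G : R -> R) : (0 <= dW F G)%E.
Proof. by apply: integral_ge0 => x _; rewrite lee_fin. Qed.

Lemma poweR_ge1 (w e : R) : 1 <= w -> 0 <= e -> 1 <= w `^ e.
Proof. by move=> w1 e0; rewrite -(powRr0 w) ler_powR. Qed.

Lemma local_rates (u beta k Ct : R) : 0 < u -> 0 < beta -> 2 <= k ->
   exists C s0 : R,
   forall (d : measure_display) (T : measurableType d) (P : probability T R)
     (F : set (set T)) (N : T -> nat) (Y : T -> int) (Z : nat -> T -> int)
     (W : T -> int) (sigma : R),
     0 < sigma -> s0 <= sigma ->
     model_hyp P F N Y Z W u beta k Ct sigma ->
     (dloc (cdf_int P W) (cdf_pmf (TP_pmf (mean_int P W) (sigma ^+ 2)))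
        <= (C / sigma)%:E * poweR (dK (cdf_std P W sigma) Phi) (1 - k^-1))%E /\
     (dloc (cdf_int P W) (cdf_pmf (TP_pmf (mean_int P W) (sigma ^+ 2)))
        <= (C / sigma)%:E * poweR (dW (cdf_std P W sigma) Phi) (1 - 2 / (k + 1)))%E.
Proof.
move=> u0 beta0 k2.
have k0 : 0 < k by lra.
have k1 : 0 < k + 1 by lra.
(* Solutions of [1 - 2 * th1 = 1 - k^-1] and [1 - 3 * th2 = 1 - 2 / (k + 1)]; [2 <= k] puts both
   below [1 / 4]. *)
pose th1 := (2 * k)^-1; pose th2 := 2 / (3 * (k + 1)).
have t1 : 0 < th1 <= 4^-1.
  by rewrite invr_gt0 mulr_gt0//= lef_pV2 ?posrE ?mulr_gt0//; lra.
have t2 : 0 < th2 <= 4^-1.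
  by rewrite divr_gt0 ?mulr_gt0//= ler_pdivrMr ?mulr_gt0//; lra.
have t1' : 0 < th1 <= 2^-1 by have := t1 => /andP[-> ?]/=; lra.
have t2' : 0 < th2 <= 2^-1 by have := t2 => /andP[-> ?]/=; lra.
have [l1 l1P] := smoothing_order (andP t1).1.
have [l2 l2P] := smoothing_order (andP t2).1.
have [C1 [C10 C1P]] := TP_Phi_sup t1'.
have [C2 [C20 C2P]] := TP_Phi_l1 t2'.
have c00 : 0 < c0 := lattice_const_gt0.
pose K1 := rate_const u beta Ct l1 (2 * l1).-1 (1 + C1 / c0).
pose K2 := rate_const u beta Ct l2 (2 * l2).-1 (1 + c0^-1 + C2 / c0).
have K10 : 0 <= K1 by apply: rate_const_ge0 => //; rewrite addr_ge0// divr_ge0// ltW.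
have K20 : 0 <= K2.
  by apply: rate_const_ge0 => //; rewrite !addr_ge0 ?divr_ge0// ?invr_ge0 ltW.
(* The added 1 keeps the constant positive when the Wasserstein distance is infinite; the threshold
   gives both [400 <= sigma] and [1 <= c0 * sigma]. *)
exists (K1 + K2 + 1), (400 + c0^-1) => d T P F N Y Z W sigma s0 ss mh.
have s400 : 400 <= sigma by apply: le_trans ss; rewrite lerDl invr_ge0 ltW.
have cs : 1 <= c0 * sigma.
  by rewrite mulrC -ler_pdivrMr// div1r; apply: le_trans ss; rewrite lerDr ler0n.
have mW : int_rv W by case: mh => _ [_ [[_ [_ ?]] _]].
have [kk kE /andP[kk0 kk1]] := dK_fin P mW sigma.
have e1 : 1 - 2 * th1 = 1 - k^-1 by rewrite /th1; field; rewrite gt_eqF.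
have e2 : 1 - 3 * th2 = 1 - 2 / (k + 1) by rewrite /th2; field; rewrite gt_eqF.
have e10 : 0 <= 1 - k^-1 by rewrite subr_ge0 invf_le1//; lra.
have e20 : 0 < 1 - 2 / (k + 1) by rewrite subr_gt0 ltr_pdivrMr//; lra.
have b1 j : `|Dif (cdf_int P W) j - Dif (cdf_pmf (TP_pmf (mean_int P W) (sigma ^+ 2))) j| <=
    K1 / sigma * kk `^ (1 - k^-1).
  rewrite -e1; apply: (dloc_dK_member u0 beta0 s400 mh t1 l1P cs C10 _ k2 kE kk1).
  exact: C1P.
split.
  rewrite kE poweR_EFin -EFinM; apply: dloc_le => j; apply: (le_trans (b1 j)).
  by rewrite ler_wpM2r ?powR_ge0// ler_wpM2r ?invr_ge0 ?(ltW s0)//; lra.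
have := dW_ge0 (cdf_std P W sigma) Phi.
case wE : (dW (cdf_std P W sigma) Phi) => [w| |] // w0; last first.
  by rewrite poweRyr ?gt_eqF// gt0_muley ?leey// lte_fin divr_gt0//; lra.
rewrite poweR_EFin -EFinM; apply: dloc_le => j.
have [w1|w1] := leP w 1.
  have := dloc_dW_member u0 beta0 s400 mh t2 l2P cs C20 (C2P _ _ s400) k2 wE w1 j.
  rewrite e2 -/K2 => h; apply: (le_trans h).
  by rewrite ler_wpM2r ?powR_ge0// ler_wpM2r ?invr_ge0 ?(ltW s0)//; lra.
(* For [w > 1] the Kolmogorov bound suffices: its distance is at most 1, while the power of [w] is
   at least 1. *)
apply: (le_trans (b1 j)); apply: ler_pM; rewrite ?powR_ge0 ?divr_ge0 ?(ltW s0)//.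
  by rewrite ler_wpM2r ?invr_ge0 ?(ltW s0)//; lra.
apply: (@le_trans _ _ 1); last by rewrite poweR_ge1// ltW.
have p1 : 1 `^ (1 - k^-1) = 1 :> R by rewrite powR1.
by rewrite -[X in _ <= X]p1; apply: ge0_ler_powR; rewrite ?nnegrE.
Qed.

Lemma total_variation_rate (u beta k Ct : R) : 0 < u -> 0 < beta -> 1 <= k ->
   exists C s0 : R,
   forall (d : measure_display) (T : measurableType d) (P : probability T R)
     (F : set (set T)) (N : T -> nat) (Y : T -> int) (Z : nat -> T -> int)
     (W : T -> int) (sigma : R),
     0 < sigma -> s0 <= sigma ->
     model_hyp P F N Y Z W u beta k Ct sigma ->
     (dTV (cdf_int P W) (cdf_pmf (TP_pmf (mean_int P W) (sigma ^+ 2)))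
        <= C%:E * poweR (dW (cdf_std P W sigma) Phi) (k / (k + 1)))%E.
Proof.
move=> u0 beta0 k1.
have k0 : 0 < k by lra.
have kp : 0 < k + 1 by lra.
(* Solves [1 - 2 * th = k / (k + 1)]; here [1 <= k] already gives [th <= 1 / 4]. *)
pose th := (2 * (k + 1))^-1.
have t : 0 < th <= 4^-1.
  by rewrite invr_gt0 mulr_gt0//= lef_pV2 ?posrE ?mulr_gt0//; lra.
have t' : 0 < th <= 2^-1 by have := t => /andP[-> ?]/=; lra.
have [l lP] := smoothing_order (andP t).1.
have [C [C0 CP]] := TP_Phi_l1 t'.
have c00 : 0 < c0 := lattice_const_gt0.
pose K := rate_const u beta Ct l (2 * l) (1 + c0^-1 + C / c0).
have K0 : 0 <= K.
  by apply: rate_const_ge0 => //; rewrite !addr_ge0 ?divr_ge0// ?invr_ge0 ltW.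
(* The added 2 covers the crude bound [3 / 2] used when [w > 1]. *)
exists (K + 2), (400 + c0^-1) => d T P F N Y Z W sigma s0 ss mh.
have s400 : 400 <= sigma by apply: le_trans ss; rewrite lerDl invr_ge0 ltW.
have cs : 1 <= c0 * sigma.
  by rewrite mulrC -ler_pdivrMr// div1r; apply: le_trans ss; rewrite lerDr ler0n.
have e : 1 - 2 * th = k / (k + 1) by rewrite /th; field; rewrite gt_eqF.
have e0 : 0 < k / (k + 1) by rewrite divr_gt0.
have := dW_ge0 (cdf_std P W sigma) Phi.
case wE : (dW (cdf_std P W sigma) Phi) => [w| |] // w0; last first.
  by rewrite poweRyr ?gt_eqF// gt0_muley ?leey// lte_fin; lra.
rewrite poweR_EFin -EFinM.
have [w1|w1] := leP w 1.
  have := dTV_dW_member u0 beta0 s400 mh t lP cs C0 (CP _ _ s400) k1 wE w1.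
  rewrite e => /dTV_le h; apply: (le_trans h); rewrite lee_fin mulrA.
  by rewrite ler_wpM2r ?powR_ge0// -/K; lra.
apply: (le_trans (dTV_le (l1le_Dif_cdfB s400 mh))); rewrite lee_fin.
have := poweR_ge1 (ltW w1) (ltW e0).
have : 0 <= K * (w `^ (k / (k + 1)) ) by rewrite mulr_ge0// powR_ge0.
move=> h1 h2; rewrite mulrDl (@le_trans _ _ (2 * w `^ (k / (k + 1))))//; last by rewrite lerDr.
lra.
Qed.

End Conclusion.

Theorem theorem5 (R : realType) :
  (forall u beta k Ct : R, 0 < u -> 0 < beta -> 2 <= k ->
   exists C s0 : R,
   forall (d : measure_display) (T : measurableType d) (P : probability T R)
     (F : set (set T)) (N : T -> nat) (Y : T -> int) (Z : nat -> T -> int)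
     (W : T -> int) (sigma : R),
     0 < sigma -> s0 <= sigma ->
     model_hyp P F N Y Z W u beta k Ct sigma ->
     (dloc (cdf_int P W) (cdf_pmf (TP_pmf (mean_int P W) (sigma ^+ 2)))
        <= (C / sigma)%:E * poweR (dK (cdf_std P W sigma) Phi) (1 - k^-1))%E /\
     (dloc (cdf_int P W) (cdf_pmf (TP_pmf (mean_int P W) (sigma ^+ 2)))
        <= (C / sigma)%:E * poweR (dW (cdf_std P W sigma) Phi) (1 - 2 / (k + 1)))%E)
  /\
  (forall u beta k Ct : R, 0 < u -> 0 < beta -> 1 <= k ->
   exists C s0 : R,
   forall (d : measure_display) (T : measurableType d) (P : probability T R)
     (F : set (set T)) (N : T -> nat) (Y : T -> int) (Z : nat -> T -> int)
     (W : T -> int) (sigma : R),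
     0 < sigma -> s0 <= sigma ->
     model_hyp P F N Y Z W u beta k Ct sigma ->
     (dTV (cdf_int P W) (cdf_pmf (TP_pmf (mean_int P W) (sigma ^+ 2)))
        <= C%:E * poweR (dW (cdf_std P W sigma) Phi) (k / (k + 1)))%E).
Proof.
split=> u beta k Ct.
- exact: local_rates.
- exact: total_variation_rate.
Qed.
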